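(* Let $\mu,\upsilon>-1$, $0<\rho\le1$, and let $N\ge1$, $\jmath$, $s$ be integers with $0\le\jmath\le s\le N+1$. If $f\bigl(1-(1-t)^{1/\rho}\bigr)\in B_{\mu,\upsilon}^{s,1}(J)$, then the orthogonal projector $\Pi_{N,\varkappa^{\mu,\upsilon,\rho}}$ satisfies $$\bigl\|\mathcal{D}_\rho^{\jmath}(f-\Pi_{N,\varkappa^{\mu,\upsilon,\rho}}f)\bigr\|_{0,\varkappa^{\mu+\jmath,\upsilon+\jmath,\rho}}\le c\sqrt{\frac{(N-s+1)!}{(N-\jmath+1)!}}\;N^{(\jmath-s)/2}\,\bigl\|\partial_t^s\{f(1-(1-t)^{1/\rho})\}\bigr\|_{0,\varkappa^{\mu+s,\upsilon+s,1}}.$$ For fixed $s$, this estimate simplifies to $$\bigl\|\mathcal{D}_\rho^{\jmath}(f-\Pi_{N,\varkappa^{\mu,\upsilon,\rho}}f)\bigr\|_{0,\varkappa^{\mu+\jmath,\upsilon+\jmath,\rho}}\le cN^{\jmath-s}\,\bigl\|\partial_t^s\{f(1-(1-t)^{1/\rho})\}\bigr\|_{0,\varkappa^{\mu+s,\upsilon+s,1}},$$ where $c$ is a constant independent of $N$ and $f$. In particular (case $\jmath=0$), $$\|f-\Pi_{N,\varkappa^{\mu,\upsilon,\rho}}f\|_{0,\varkappa^{\mu,\upsilon,\rho}}\le cN^{-s}\bigl\|\partial_t^s\{f(1-(1-t)^{1/\rho})\}\bigr\|_{0,\varkappa^{\mu+s,\upsilon+s,1}},$$ and (case $\jmath=1$,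 so $s\ge1$) $$\|\partial_t(f-\Pi_{N,\varkappa^{\mu,\upsilon,\rho}}f)\|_{0,\tilde\varkappa^{\mu,\upsilon,\rho}}\le cN^{1-s}\bigl\|\partial_t^s\{f(1-(1-t)^{1/\rho})\}\bigr\|_{0,\varkappa^{\mu+s,\upsilon+s,1}},$$ where $\tilde\varkappa^{\mu,\upsilon,\rho}(t)=\rho^{-1}(1-t)^{\rho\mu+1}\bigl(1-(1-t)^\rho\bigr)^{\upsilon+1}$.
   Context: $J=[0,1]$. $P_N^\rho(J)=\mathrm{span}\{1,(1-t)^\rho,(1-t)^{2\rho},\dots,(1-t)^{N\rho}\}$. The weight is $\varkappa^{a,b,\rho}(t)=\rho(1-t)^{\rho(a+1)-1}\bigl(1-(1-t)^\rho\bigr)^b$; in particular $\varkappa^{a,b,1}(t)=(1-t)^a t^b$. For a weight $\varkappa$, $(g,f)_\varkappa=\int_0^1 gf\varkappa\,dt$, $\|f\|_{0,\varkappa}=(f,f)_\varkappa^{1/2}$, and $L^2_\varkappa(J)$ is the associated space. $\mathcal{D}_\rho f(t)=\frac{(1-t)^{1-\rho}}{\rho}f'(t)$, and $\mathcal{D}_\rho^k$ is its $k$-fold composition. $B_{\mu,\upsilon}^{s,1}(J)=\{f:\ \partial_t^kf\in L^2_{\varkappa^{\mu+k,\upsilon+k,1}}(J),\ 0\le k\le s\}$ (weak derivatives). $\Pi_{N,\varkappa^{\mu,\upsilon,\rho}}:L^2_{\varkappa^{\mu,\upsilon,\rho}}(J)\to P_N^\rho(J)$ is the orthogonal projection with respect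 to $(\cdot,\cdot)_{\varkappa^{\mu,\upsilon,\rho}}$, i.e. $(f-\Pi_{N,\varkappa^{\mu,\upsilon,\rho}}f,\,f_N)_{\varkappa^{\mu,\upsilon,\rho}}=0$ for all $f_N\in P_N^\rho(J)$. The notation $\partial_t^s\{f(1-(1-t)^{1/\rho})\}$ means the $s$-th derivative of the composed function $t\mapsto f(1-(1-t)^{1/\rho})$. *)

(* Defs.v *)
From HB Require Import structures.
From mathcomp Require Import all_boot all_order all_algebra.
From mathcomp Require Import all_classical all_reals all_analysis.
Import Order.TTheory GRing.Theory Num.Theory.
Import numFieldNormedType.Exports.

Set Implicit Arguments.
Unset Strict Implicit.
Unset Printing Implicit Defensive.

Local Open Scope classical_set_scope.
Local Open Scope ring_scope.

Section Defs.
Context {R : realType}.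
Local Notation mu := (@lebesgue_measure R).
Implicit Types (w f g u p q phi : R -> R).

(* Functions on J = [0,1] are total functions on R; only their values on J (for
   weak derivatives, on its interior) are ever used. *)
Definition J : set R := `[0, 1]%classic.
Definition intJ : set R := `]0, 1[%classic.

(* At the endpoints of J a negative power takes the junk value 0 `^ a = 0;
   this is a null set. *)
Definition weight (a b rho t : R) : R :=
  rho * (1 - t) `^ (rho * (a + 1) - 1) * (1 - (1 - t) `^ rho) `^ b.

Definition weight_tilde (a b rho t : R) : R :=
  rho^-1 * (1 - t) `^ (rho * a + 1) * (1 - (1 - t) `^ rho) `^ (b + 1).

Definition inner w g f : \bar R := (\int[mu]_(t in J) (g t * f t * w t)%:E)%E.

(* Extended-real valued: a function outside the weighted L^2 space has norm
   +oo, so that an upper bound on the norm includes its finiteness. *)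
Definition wnorm w f : \bar R := (inner w f f `^ 2^-1)%E.

Definition L2 w : set (R -> R) :=
  [set f | measurable_fun J f /\ (inner w f f < +oo)%E].

Definition test_function phi : Prop :=
  (forall n x, derivable (derive1n n phi) x 1) /\
  exists a b : R, [/\ 0 < a, b < 1 &
    forall x, ~ (a <= x <= b) -> phi x = 0].

Definition is_weak_derivative (k : nat) u g : Prop :=
  [/\ locally_integrable intJ u, locally_integrable intJ g &
    forall phi, test_function phi ->
      \int[mu]_(t in intJ) (u t * derive1n k phi t) =
      (-1) ^+ k * \int[mu]_(t in intJ) (g t * phi t)].

Definition weakly_derivable (k : nat) u : Prop :=
  exists g, is_weak_derivative k u g.

(* A representative of the k-th weak derivative, which is unique almost
   everywhere; the default value cst 0 is used when there is none. *)
Definition weak_derivative (k : nat) u : R -> R :=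
  xget (cst 0 : R -> R) [set g | is_weak_derivative k u g].

Definition B1 (a b : R) (s : nat) : set (R -> R) :=
  [set u | forall k : nat, (k <= s)%N ->
    weakly_derivable k u /\
    L2 (weight (a + k%:R) (b + k%:R) 1) (weak_derivative k u)].

Definition D_rho (rho : R) u : R -> R :=
  fun t => (1 - t) `^ (1 - rho) / rho * weak_derivative 1 u t.

Definition D_rho_iter (rho : R) (k : nat) u : R -> R := iter k (D_rho rho) u.

(* No default value occurs in the weak derivatives taken in D_rho_iter. *)
Definition D_rho_derivable (rho : R) (k : nat) u : Prop :=
  forall i : nat, (i < k)%N -> weakly_derivable 1 (D_rho_iter rho i u).

Definition P_rho (rho : R) (N : nat) : set (R -> R) :=
  [set p | exists c : 'I_N.+1 -> R,
    p = fun t => \sum_(i < N.+1) c i * (1 - t) `^ (i%:R * rho)].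

Definition is_projection (a b rho : R) (N : nat) f p : Prop :=
  P_rho rho N p /\
  forall q, P_rho rho N q -> inner (weight a b rho) (f \- p) q = 0%E.

(* The element of P_rho rho N characterised by is_projection, which exists and
   is unique for f in L2 (weight a b rho) when a, b > -1 and rho > 0. *)
Definition Proj (a b rho : R) (N : nat) f : R -> R :=
  xget (cst 0 : R -> R) [set p | is_projection a b rho N f p].

Definition pullback (rho : R) f : R -> R :=
  fun t => f (1 - (1 - t) `^ (rho^-1)).

End Defs.

(* Main.v *)
(* The substitution x = 1 - (1-t)^rho turns D_rho into d/dx, the space P_rho N into
   the polynomials of degree at most N, and the weights into the Jacobi weights
   w_k = (1-x)^(a+k) x^(b+k) on (0,1). Let v be the pulled-back function and p its
   orthogonal projection for w_0. Integration by parts shows that d_k = v^(k) - p^(k)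
   is orthogonal in w_k to the polynomials of degree at most N - k. If d is
   orthogonal in w_k to the polynomials of degree less than n, then
   n (n + a + b + 2k + 1) |d|^2_{w_k} <= |d'|^2_{w_(k+1)}: writing
   w_k d = - (w_(k+1) q)', this follows by induction on n from the same inequality
   for q, without completeness of the Jacobi polynomials. Chaining these
   inequalities from j to s, and using |d_s| <= |v^(s)|, gives the first estimate
   with c = 1. Weak derivatives are compared with primitives by testing against
   smoothed indicator functions of intervals with Lebesgue points as ends. *)
Require Import Defs.
From HB Require Import structures.
From mathcomp Require Import all_boot all_order all_algebra.
From mathcomp Require Import all_classical all_reals all_analysis.
From mathcomp Require Import measurable_realfun ring lra zify.
Import Order.TTheory GRing.Theory Num.Theory.
Import numFieldNormedType.Exports.
Local Open Scope classical_set_scope.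
Local Open Scope ring_scope.
Set Implicit Arguments.
Unset Strict Implicit.
Unset Printing Implicit Defensive.

(** * Real-valued Lebesgue integrals and Cauchy-Schwarz *)

Section Integration.
Context {R : realType}.
Local Notation mu := (@lebesgue_measure R).
Implicit Types (A B : set R) (f g h : R -> R).

(** The functions are only locally absolutely continuous on (0,1) and the weights may blow up at its
    ends, so boundary terms need not have limits there. It is enough that they come arbitrarily
    close to 0 somewhere near each end ([small_ends]), which a weighted L^2 bound forces because
    1/(x(1-x)) is not integrable. Only the square identity for q needs more: with Q = -int_0^x w v,
    its boundary term is controlled by Q^2 = o(W), which rests on int_0^x w <= C W(x) near 0 and the
    mirror image near 1. The constant n(n+a+b+1) is the n-th eigenvalue of the Jacobi operator. It
    reproduces itself in the induction because n(n+a+b+3) + (a+b+2) = (n+1)(n+a+b+2). With n = N+1-k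
    at order k the second factor is N+k+2+a+b > N, since a, b > -1. The first factors multiply up to
    the factorial ratio and the second ones dominate the power of N. The simplified estimates follow
    because N+1-k >= N/(s+1) for k < s <= N+1, whence c^2 = (s+1)^s. *)

Definition intg A f : Prop := mu.-integrable A (EFin \o f).
Definition It A f : R := \int[mu]_(x in A) f x.

Lemma intg_meas A f : intg A f -> measurable_fun A f.
Proof. by move=> /(measurable_int mu)/measurable_EFinP. Qed.

Lemma eq_intg A f g : measurable A -> (forall x, A x -> f x = g x) ->
  intg A f -> intg A g.
Proof.
by move=> mA fg; apply: eq_integrable => // x; rewrite inE => Ax /=; rewrite fg.
Qed.

Lemma eq_It A f g : (forall x, A x -> f x = g x) -> It A f = It A g.
Proof. by move=> fg; apply: eq_Rintegral => x; rewrite inE => /fg. Qed.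

Lemma intgS A B f : measurable A -> measurable B -> B `<=` A ->
  intg A f -> intg B f.
Proof. by move=> mA mB BA fi; apply: integrableS fi. Qed.

Lemma intg_le A f g : measurable A -> measurable_fun A f ->
  (forall x, A x -> `|f x| <= g x) -> intg A g -> intg A f.
Proof.
move=> mA mf fg ig; apply: (@le_integrable _ _ _ mu A mA _ (EFin \o g)) => //.
  exact/measurable_EFinP.
move=> x Ax /=; rewrite lee_fin.
by rewrite (le_trans (fg _ Ax))// ler_norm.
Qed.

Lemma intgD A f g : measurable A -> intg A f -> intg A g ->
  intg A (fun x => f x + g x).
Proof. by move=> mA; exact: integrableD. Qed.

Lemma intgB A f g : measurable A -> intg A f -> intg A g ->
  intg A (fun x => f x - g x).
Proof. by move=> mA; exact: integrableB. Qed.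

Lemma intgZ A k f : measurable A -> intg A f -> intg A (fun x => k * f x).
Proof. by move=> mA; exact: integrableZl. Qed.

Lemma intgN A f : measurable A -> intg A f -> intg A (fun x => - f x).
Proof. by move=> mA; exact: integrableN. Qed.

Lemma intg_norm A f : measurable A -> intg A f -> intg A (fun x => `|f x|).
Proof. by move=> mA; exact: integrable_norm. Qed.

Lemma ItD A f g : measurable A -> intg A f -> intg A g ->
  It A (fun x => f x + g x) = It A f + It A g.
Proof. by move=> mA; exact: RintegralD. Qed.

Lemma ItB A f g : measurable A -> intg A f -> intg A g ->
  It A (fun x => f x - g x) = It A f - It A g.
Proof. by move=> mA; exact: RintegralB. Qed.

Lemma ItZ A k f : measurable A -> intg A f ->
  It A (fun x => k * f x) = k * It A f.
Proof. by move=> mA; exact: RintegralZl. Qed.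

Lemma ItN A f : measurable A -> intg A f ->
  It A (fun x => - f x) = - It A f.
Proof.
move=> mA fi; rewrite -mulN1r -ItZ//; apply: eq_It => x _; by rewrite mulN1r.
Qed.

Lemma It_ge0 A f : (forall x, A x -> 0 <= f x) -> 0 <= It A f.
Proof. by move=> f0; apply: Rintegral_ge0. Qed.

Lemma le_It A f g : measurable A -> intg A f -> intg A g ->
  (forall x, A x -> f x <= g x) -> It A f <= It A g.
Proof. by move=> mA; exact: le_Rintegral. Qed.

Lemma ItE A f : measurable A -> intg A f ->
  (\int[mu]_(x in A) (f x)%:E)%E = (It A f)%:E.
Proof. by move=> mA fi; rewrite /It /Rintegral fineK//; apply: integrable_fin_num. Qed.

Lemma It_abs A f : measurable A -> intg A f -> `|It A f| <= It A (fun x => `|f x|).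
Proof. by move=> mA; exact: le_normr_Rintegral. Qed.

Lemma It_subset A B f : measurable A -> measurable B -> B `<=` A ->
  intg A f -> (forall x, A x -> 0 <= f x) -> It B f <= It A f.
Proof.
move=> mA mB BA fi f0; rewrite /It /Rintegral fine_le//.
- by apply: integrable_fin_num => //; apply: integrableS fi.
- by apply: integrable_fin_num.
apply: ge0_subset_integral => //; first exact: measurable_int fi.
Qed.

Lemma intg_bounded (a b c : R) f : measurable_fun `[a, b] f ->
  (forall x, a <= x <= b -> `|f x| <= c) -> intg `[a, b] f.
Proof.
move=> mf fc; apply: (@intg_le _ _ (fun=> c)) => //.
apply: measurable_bounded_integrable => //; last exact: bounded_cst.
by rewrite /= lebesgue_measure_itv/=; case: ifP; rewrite -?EFinB ltry.
Qed.

Lemma It_cst (a b c : R) : a <= b -> It `[a, b] (fun=> c) = c * (b - a).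
Proof.
move=> ab; rewrite /It Rintegral_cst//= lebesgue_measure_itv/= lte_fin.
case: ltP => // ba; have -> : a = b by apply/le_anti; rewrite ab.
by rewrite subrr.
Qed.

Lemma intg_cont (a b : R) f : {within `[a, b], continuous f} -> intg `[a, b] f.
Proof.
by move=> cf; apply: continuous_compact_integrable => //; exact: segment_compact.
Qed.

Lemma intg_cont_in (a b : R) f :
  (forall x, a <= x <= b -> {for x, continuous f}) -> intg `[a, b] f.
Proof.
move=> cf; apply: intg_cont; apply: continuous_in_subspaceT => x.
by rewrite inE/= in_itv/= => /cf.
Qed.

Lemma It_split (a c b : R) f : a <= c -> c <= b -> intg `[a, b] f ->
  It `[a, b] f = It `[a, c] f + It `[c, b] f.
Proof.
move=> ac cb fi.
have := @Rintegral_itvB R f (BLeft a) (BRight b) c fi.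
rewrite !bnd_simp => /(_ ac cb) /eqP; rewrite subr_eq addrC => /eqP.
rewrite /It => ->; congr (_ + _).
apply: Rintegral_itv_obnd_cbnd; apply: integrableS fi => //=.
by apply: subset_itvr; rewrite bnd_simp.
Qed.

Lemma It_point (a : R) f : It `[a, a] f = 0.
Proof. by rewrite /It set_itv1 Rintegral_set1. Qed.

(* Cauchy-Schwarz, from the nonnegativity of [t |-> int (f - t g)^2 w]. *)
Lemma It_CS A f g w : measurable A -> (forall x, A x -> 0 <= w x) ->
  measurable_fun A (fun x => f x * g x * w x) ->
  intg A (fun x => f x ^+ 2 * w x) -> intg A (fun x => g x ^+ 2 * w x) ->
  intg A (fun x => f x * g x * w x) /\
  It A (fun x => f x * g x * w x) ^+ 2 <=
  It A (fun x => f x ^+ 2 * w x) * It A (fun x => g x ^+ 2 * w x).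
Proof.
move=> mA w0 mfg fi gi.
have fgi : intg A (fun x => f x * g x * w x).
  apply: (intg_le mA mfg _ (intgD mA fi gi)) => x Ax.
  have wx := w0 _ Ax.
  rewrite normrM (ger0_norm wx) -mulrDl ler_wpM2r//.
  by rewrite ler_norml; apply/andP; split; nra.
split=> //.
set F := It A (fun x => f x ^+ 2 * w x); set G := It A (fun x => g x ^+ 2 * w x).
set P := It A _.
have key t : 0 <= F - t * (2 * P) + t ^+ 2 * G.
  have -> : F - t * (2 * P) + t ^+ 2 * G =
      It A (fun x => (f x - t * g x) ^+ 2 * w x).
    have i1 := intgZ (t * 2) mA fgi; have i2 := intgZ (t ^+ 2) mA gi.
    rewrite mulrA -(ItZ (t * 2) mA fgi) -(ItZ (t ^+ 2) mA gi).
    rewrite -(ItB mA fi i1) -(ItD mA (intgB mA fi i1) i2).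
    by apply: eq_It => x _; ring.
  by apply: It_ge0 => x /w0 w0x; rewrite mulr_ge0// sqr_ge0.
have F0 : 0 <= F by apply: It_ge0 => x /w0 w0x; rewrite mulr_ge0// sqr_ge0.
have G0 : 0 <= G by apply: It_ge0 => x /w0 w0x; rewrite mulr_ge0// sqr_ge0.
have [Gz|Gn] := eqVneq G 0.
  have [->|Pn] := eqVneq P 0; first by rewrite expr0n/= mulr_ge0.
  (* With [G = 0] the quadratic is affine in [t]; at this [t] its value is -1, so [P] cannot be
     nonzero. *)
  have := key ((F + 1) / (2 * P)); rewrite Gz mulr0 addr0.
  rewrite divfK ?mulf_neq0// ?pnatr_eq0//; lra.
have Gp : 0 < G by rewrite lt0r Gn.
(* The minimiser of the quadratic in [t]. *)
have := key (P / G).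
have -> : F - P / G * (2 * P) + (P / G) ^+ 2 * G = F - P ^+ 2 / G by field.
by rewrite subr_ge0 ler_pdivrMr.
Qed.

End Integration.

(** * Pointwise derivatives *)

Section PointwiseDerivatives.
Context {R : realType}.
Implicit Types (f g : R -> R) (x df dg : R).

Lemma is_derive1B f g x df dg : is_derive x 1 f df -> is_derive x 1 g dg ->
  is_derive x 1 (fun y => f y - g y) (df - dg).
Proof. by move=> hf hg; exact: is_deriveB. Qed.

Lemma is_derive1M f g x df dg : is_derive x 1 f df -> is_derive x 1 g dg ->
  is_derive x 1 (fun y => f y * g y) (df * g x + f x * dg).
Proof.
move=> hf hg; apply: is_derive_eq (is_deriveM hf hg) _.
by rewrite /GRing.scale/= addrC (mulrC df).
Qed.

Lemma is_derive1_onem x : is_derive x 1 (fun y : R => 1 - y) (-1).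
Proof.
have h1 : is_derive x 1 (fun=> 1 : R) 0 by exact: is_derive_cst.
have h2 : is_derive x 1 (fun y : R => y) 1 by exact: is_derive_id.
by apply: is_derive_eq (is_derive1B h1 h2) _; rewrite sub0r.
Qed.

Lemma is_derive1_cont f x df : is_derive x 1 f df -> {for x, continuous f}.
Proof. by case=> d _; apply: differentiable_continuous; exact/derivable1_diffP. Qed.

End PointwiseDerivatives.
#[global] Hint Resolve measurable_itv : core.

(** * Locally absolutely continuous functions on (0,1) *)

Section AbsolutelyContinuous.
Context {R : realType}.
Local Notation mu := (@lebesgue_measure R).
Implicit Types (U V f g h : R -> R).

(* [U] is locally absolutely continuous on (0,1), with derivative [g]. *)
Definition acpair U g : Prop := forall a b : R, 0 < a -> a <= b -> b < 1 ->
  intg `[a, b] g /\ U b - U a = It `[a, b] g.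

Lemma It_continuous (a b : R) f : a <= b -> intg `[a, b] f ->
  {within `[a, b], continuous (fun x => It `[a, x] f)}.
Proof. exact: parameterized_integral_continuous. Qed.

(** Around [x] the function is a constant plus an integral with variable upper end. *)
Lemma acpair_cont U g (x : R) : acpair U g -> 0 < x < 1 -> {for x, continuous U}.
Proof.
move=> ac /andP[x0 x1].
pose a := x / 2; pose b := (1 + x) / 2.
have a0 : 0 < a by rewrite /a; lra.
have ax : a < x by rewrite /a; lra.
have xb : x < b by rewrite /b; lra.
have b1 : b < 1 by rewrite /b; lra.
have ab : a < b := lt_trans ax xb.
have [gi _] := ac a b a0 (ltW ab) b1.
have cI := It_continuous (ltW ab) gi.
have cU : {within `[a, b], continuous (fun y => U a + It `[a, y] g)}.
  by move=> y; apply: cvgD; [exact: cvg_cst|exact: cI].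
apply: (@within_continuous_continuous _ _ _ a b) => //; last by rewrite in_itv/= ax.
apply: subspace_eq_continuous cU => y; rewrite inE/= in_itv/= => /andP[ay yb].
have [_ E] := ac a y a0 ay (le_lt_trans yb b1).
by rewrite -[LHS]/(U a + It `[a, y] g) -E addrC subrK.
Qed.

Lemma cont_meas_intJ U : (forall x, 0 < x < 1 -> {for x, continuous U}) ->
  measurable_fun (@intJ R) U.
Proof.
move=> cU; apply: open_continuous_measurable_fun => [|x].
  exact: interval_open.
by rewrite inE /intJ/= in_itv/= => /cU.
Qed.

Lemma acpair_meas U g : acpair U g -> measurable_fun (@intJ R) U.
Proof. by move=> ac; apply: cont_meas_intJ => x x01; exact: acpair_cont ac x01. Qed.

Lemma acpair_eq U V g h : acpair U g -> (forall x, 0 < x < 1 -> U x = V x) ->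
  (forall x, 0 < x < 1 -> g x = h x) -> acpair V h.
Proof.
move=> ac UV gh a b a0 ab b1; have [gi E] := ac a b a0 ab b1.
have eqgh x : `[a, b]%classic x -> g x = h x.
  rewrite /= in_itv/= => /andP[ax xb]; apply: gh.
  by rewrite (lt_le_trans a0 ax) (le_lt_trans xb b1).
split; first exact: eq_intg gi.
rewrite -(UV a) ?a0 ?(le_lt_trans ab)// -(UV b) ?b1 ?(lt_le_trans a0)//.
by rewrite E; exact: eq_It.
Qed.

Lemma acpair_sub U V g h : acpair U g -> acpair V h ->
  acpair (fun x => U x - V x) (fun x => g x - h x).
Proof.
move=> acU acV a b a0 ab b1.
have [gi EU] := acU a b a0 ab b1; have [hi EV] := acV a b a0 ab b1.
split; first exact: intgB.
by rewrite ItB// -EU -EV; ring.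
Qed.

Lemma acpairZ U g k : acpair U g -> acpair (fun x => k * U x) (fun x => k * g x).
Proof.
move=> acU a b a0 ab b1; have [gi EU] := acU a b a0 ab b1.
split; first exact: intgZ.
by rewrite ItZ// -EU; ring.
Qed.

Lemma acpair_C1 (U g : R -> R) :
  (forall x : R, 0 < x < 1 -> is_derive x 1 U (g x)) ->
  (forall x : R, 0 < x < 1 -> {for x, continuous g}) -> acpair U g.
Proof.
move=> dU cg a b a0; rewrite le_eqVlt => /predU1P[<- a1|ab b1].
  rewrite It_point subrr; split=> //; apply: intg_cont_in => x /andP[ax xa].
  by apply: cg; rewrite (lt_le_trans a0 ax) (le_lt_trans xa a1).
have itv x : a <= x <= b -> 0 < x < 1.
  by move=> /andP[ax xb]; rewrite (lt_le_trans a0 ax) (le_lt_trans xb b1).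
split; first by apply: intg_cont_in => x /itv/cg.
have dUx x : a <= x <= b -> derivable U x 1 by move=> /itv/dU[].
have cU x : a <= x <= b -> {for x, continuous U}.
  by move=> /dUx d; apply: differentiable_continuous; exact/derivable1_diffP.
rewrite /It /Rintegral (@continuous_FTC2 _ g U a b)//.
- by apply: continuous_in_subspaceT => x; rewrite inE/= in_itv/= => /itv/cg.
- split.
  + by move=> x; rewrite in_itv/= => /andP[/ltW ax /ltW xb]; apply: dUx; rewrite ax.
  + by apply: cvg_at_right_filter; apply: cU; rewrite lexx ltW.
  + by apply: cvg_at_left_filter; apply: cU; rewrite lexx ltW.
- move=> x; rewrite in_itv/= => /andP[/ltW ax /ltW xb].
  by rewrite derive1E; have [] := dU x (itv x _); rewrite ?ax.
Qed.

(* The defect [d x y] of the product rule is additive and at most [m x y ^+ 2],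
   where [m] is the continuous additive function [int (|g| + |h|)]; repeated
   halving of [m] forces [d = 0]. *)
Lemma acpair_mul U V g h : acpair U g -> acpair V h ->
  acpair (fun x => U x * V x) (fun x => g x * V x + U x * h x).
Proof.
move=> acU acV a b a0 ab b1.
have [gi _] := acU a b a0 ab b1; have [hi _] := acV a b a0 ab b1.
have sub : `[a, b] `<=` (@intJ R).
  move=> x; rewrite /intJ/= !in_itv/= => /andP[ax xb].
  by rewrite (lt_le_trans a0 ax) (le_lt_trans xb b1).
have mJ : measurable (@intJ R) by exact: measurable_itv.
(* Continuity on a compact interval gives boundedness, so products with an integrable function stay
   integrable. *)
have bnd W k : acpair W k -> exists M, forall x, a <= x <= b -> `|W x| <= M.
  move=> acW; have cW : {within `[a, b], continuous (fun x => `|W x|)}.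
    apply: continuous_in_subspaceT => x; rewrite inE => /sub.
    rewrite /intJ/= in_itv/= => /(acpair_cont acW) cx.
    by apply: continuous_comp cx _; exact: norm_continuous.
  have [c _ cmax] := EVT_max ab cW.
  by exists `|W c| => x xab; apply: cmax; rewrite in_itv.
have prod W k f : acpair W k -> intg `[a, b] f -> intg `[a, b] (fun x => f x * W x).
  move=> acW fi; have [M WM] := bnd W k acW.
  apply: (@intg_le _ _ _ (fun x => M * `|f x|)) => //; last first.
  - exact/intgZ/intg_norm.
  - move=> x; rewrite /= in_itv/= => /WM WxM.
    by rewrite normrM mulrC ler_wpM2r.
  - apply: measurable_funM; first exact: intg_meas fi.
    by apply: measurable_funS (acpair_meas acW).
pose k x := g x * V x + U x * h x.
have ki : intg `[a, b] k.
  apply: intgD => //; first exact: prod acV gi.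
  by apply: eq_intg (prod U g h acU hi) => // x _; rewrite mulrC.
split=> //.
pose m x y := It `[x, y] (fun t => `|g t| + `|h t|).
have mi : intg `[a, b] (fun t => `|g t| + `|h t|).
  by apply: intgD => //; exact: intg_norm.
have subi x y : a <= x -> y <= b -> `[x, y] `<=` `[a, b].
  by move=> ax yb; apply: subset_itv; rewrite bnd_simp.
have itg f x y : a <= x -> y <= b -> intg `[a, b] f -> intg `[x, y] f.
  by move=> ax yb; apply: intgS => //; exact: subi.
pose d x y := U y * V y - U x * V x - It `[x, y] k.
have dadd x c y : a <= x -> x <= c -> c <= y -> y <= b -> d x y = d x c + d c y.
  move=> ax xc cy yb; rewrite /d (@It_split _ x c y)//; first by ring.
  exact: itg ki.
have madd x c y : a <= x -> x <= c -> c <= y -> y <= b -> m x y = m x c + m c y.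
  by move=> ax xc cy yb; rewrite /m (@It_split _ x c y)//; exact: itg mi.
have m0 x y : 0 <= m x y by apply: It_ge0 => t _; rewrite addr_ge0.
have osc W f x y t u : acpair W f -> (forall t, `|f t| <= `|g t| + `|h t|) ->
    intg `[a, b] f ->
    a <= x -> x <= t -> t <= u -> u <= y -> y <= b -> `|W u - W t| <= m x y.
  move=> acW fm fi ax xt tu uy yb.
  have [fi' ->] := acW t u (lt_le_trans a0 (le_trans ax xt)) tu
    (le_lt_trans uy (le_lt_trans yb b1)).
  apply: le_trans (It_abs _ fi') _ => //.
  apply: (@le_trans _ _ (m t u)).
    apply: le_It => //; first exact: intg_norm.
    by apply: itg mi; [exact: le_trans xt|exact: le_trans yb].
  rewrite (madd x t y) ?(le_trans tu)// (madd t u y) ?(le_trans ax)//.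
  by have := m0 x t; have := m0 u y; lra.
have dle x y : a <= x -> x <= y -> y <= b -> `|d x y| <= m x y ^+ 2.
  move=> ax xy yb.
  have x0 : 0 < x := lt_le_trans a0 ax; have y1 : y < 1 := le_lt_trans yb b1.
  have [gi' EU] := acU x y x0 xy y1; have [hi' EV] := acV x y x0 xy y1.
  have gVi : intg `[x, y] (fun t => g t * V t) by apply: itg (prod V h g acV gi).
  have hUi : intg `[x, y] (fun t => h t * U t) by apply: itg (prod U g h acU hi).
  (* Writing [U y * V y - U x * V x = V y * (U y - U x) + U x * (V y - V x)] leaves only
     oscillations of [U] and [V] multiplied by [g] and [h], which is where the square of [m] comes
     from. *)
  have -> : d x y =
      It `[x, y] (fun t => (V y * g t - g t * V t) + (U x * h t - h t * U t)).
    rewrite ItD//; [|by apply: intgB => //; exact: intgZ..].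
    rewrite ItB//; [|exact: intgZ]; rewrite (ItB _ (intgZ _ _ hi'))//.
    rewrite !ItZ// -EU -EV /d.
    have -> : It `[x, y] k = It `[x, y] (fun t => g t * V t) + It `[x, y] (fun t => h t * U t).
      by rewrite -ItD//; apply: eq_It => t _; rewrite /k (mulrC (U t)).
    by ring.
  apply: le_trans (It_abs _ _) _ => //.
    by apply: intgD => //; apply: intgB => //; exact: intgZ.
  have mi' : intg `[x, y] (fun t => `|g t| + `|h t|) by apply: itg mi.
  rewrite expr2 -[X in X * m x y]/(m x y) {2}/m -ItZ//; apply: le_It => //.
  - apply: intg_norm => //.
    by apply: intgD => //; apply: intgB => //; exact: intgZ.
  - exact: intgZ.
  - move=> t; rewrite /= in_itv/= => /andP[xt ty].
    have hV : `|V y - V t| <= m x y.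
      by apply: (osc V h) => // s; rewrite lerDr.
    have hU : `|U t - U x| <= m x y.
      by apply: (osc U g) => // s; rewrite lerDl.
    have -> : V y * g t - g t * V t + (U x * h t - h t * U t) =
      (V y - V t) * g t - (U t - U x) * h t by ring.
    apply: le_trans (ler_normB _ _) _; rewrite !normrM mulrDr.
    by apply: lerD; apply: ler_wpM2r.
have dle2 n : forall x y, a <= x -> x <= y -> y <= b ->
    `|d x y| <= m x y ^+ 2 * (2^-1) ^+ n.
  elim: n => [|n IH] x y ax xy yb; first by rewrite expr0 mulr1; exact: dle.
  have cm : {within `[x, y], continuous (m x)}.
    by apply: It_continuous => //; exact: itg mi.
  (* Cut where [m] is halved, not at the midpoint: the two halves contribute twice [(m / 2) ^+ 2], a
     gain of a factor 2 at each stage. *)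
  have [c] : exists2 c, c \in `[x, y] & m x c = m x y / 2.
    apply: IVT => //; have -> : m x x = 0 by exact: It_point.
    rewrite minEle maxEle m0; have := m0 x y; lra.
  rewrite in_itv/= => /andP[xc cy] mc.
  rewrite (dadd x c y)//.
  have mc' : m c y = m x y / 2 by have := madd x c y ax xc cy yb; rewrite mc; lra.
  apply: le_trans (ler_normD _ _) _.
  have := lerD (IH x c ax xc (le_trans cy yb)) (IH c y (le_trans ax xc) cy yb).
  rewrite mc mc' => /le_trans; apply.
  rewrite (exprS _ n); set e := _ ^+ n; rewrite le_eqVlt; apply/orP; left; apply/eqP.
  by field.
suff d0 : d a b = 0 by apply/eqP; rewrite -subr_eq0 -[X in X == 0]/(d a b) d0.
apply/eqP; rewrite -normr_le0; apply/ler_addgt0Pr => e e0; rewrite add0r.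
have [n ne] : exists n, m a b ^+ 2 * 2^-1 ^+ n < e.
  have M0 : 0 < m a b ^+ 2 + 1 by rewrite ltr_wpDl// sqr_ge0.
  have h2 : (fun n => (2^-1 : R) ^+ n) @ \oo --> (0 : R).
    by apply: cvg_expr; rewrite ger0_norm ?invr_ge0//; lra.
  have e' : 0 < e / (m a b ^+ 2 + 1) by rewrite divr_gt0.
  move/cvgrPdist_lt : h2 => /(_ _ e')[n _ /(_ n (leqnn n))].
  rewrite /= sub0r normrN ger0_norm ?exprn_ge0 ?invr_ge0// => he.
  exists n; move: he; rewrite ltr_pdivlMr// => he; apply: le_lt_trans he.
  rewrite mulrC ler_wpM2l ?exprn_ge0 ?invr_ge0//; lra.
exact: le_trans (dle2 n a b _ ab _) (ltW ne).
Qed.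

End AbsolutelyContinuous.

(** * Improper integrals and vanishing boundary terms *)

Section Improper.
Context {R : realType}.
Local Notation mu := (@lebesgue_measure R).
Implicit Types (F f g G : R -> R).
Local Notation I := (@intJ R).

Lemma measurable_intJ : measurable I.
Proof. exact: measurable_itv. Qed.

Lemma intJP (x : R) : I x <-> 0 < x < 1.
Proof. by rewrite /intJ/= in_itv. Qed.

(** The shift to [n.+2] keeps the left end at most 1/2, so that the interval is never empty. *)
Let itv_n (n : nat) : set R := `[n.+2%:R^-1, 1 - n.+2%:R^-1]%classic.

Let inv_le (x : R) : 0 < x -> exists n : nat, forall m : nat, (n <= m)%N -> m.+2%:R^-1 <= x.
Proof.
move=> x0; exists (Num.bound x^-1) => m nm.
rewrite -[leRHS]invrK lef_pV2 ?posrE ?invr_gt0//.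
have xi0 : 0 <= x^-1 by rewrite invr_ge0 ltW.
by apply: le_trans (ltW (archi_boundP xi0)) _; rewrite ler_nat (leq_trans nm)// -addn2 leq_addr.
Qed.

Let itv_nd : nondecreasing_seq itv_n.
Proof.
move=> m n mn; rewrite subsetEset; apply: subset_itv; rewrite bnd_simp.
  by rewrite lef_pV2 ?posrE// ler_nat !ltnS.
by rewrite lerD2l lerN2 lef_pV2 ?posrE// ler_nat !ltnS.
Qed.

Let itv_cup : \bigcup_n itv_n n = I.
Proof.
apply/seteqP; split=> [x [n _]|x].
  rewrite /itv_n /intJ/= !in_itv/= => /andP[ax xb].
  have h : 0 < (n.+2%:R^-1 : R) by rewrite invr_gt0.
  by rewrite (lt_le_trans h ax)/= (le_lt_trans xb)// ltrBlDr ltrDl.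
move=> /intJP/andP[x0 x1]; have x1' : 0 < 1 - x by rewrite subr_gt0.
have [n1 h1] := inv_le x0; have [n2 h2] := inv_le x1'.
exists (maxn n1 n2) => //; rewrite /itv_n/= in_itv/=.
by rewrite h1 ?leq_maxl//= lerBrDl -lerBrDr h2// leq_maxr.
Qed.

Let itv_sub (n : nat) : itv_n n `<=` I.
Proof. by rewrite -itv_cup; exact: bigcup_sup. Qed.

Let itv_in (n : nat) : [/\ 0 < n.+2%:R^-1 :> R, n.+2%:R^-1 <= 1 - n.+2%:R^-1 :> R &
  1 - n.+2%:R^-1 < 1 :> R].
Proof.
have h : (n.+2%:R^-1 : R) <= 2^-1 by rewrite lef_pV2 ?posrE// ler_nat.
have h0 : 0 < (n.+2%:R^-1 : R) by rewrite invr_gt0.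
move: h h0; set q := _^-1 => h h0; split; lra.
Qed.

Let itv_cvg f : measurable_fun I f -> (forall x, I x -> 0 <= f x) ->
  (\int[mu]_(x in itv_n n) (f x)%:E @[n --> \oo] --> \int[mu]_(x in I) (f x)%:E)%E.
Proof.
move=> mf f0; rewrite -itv_cup.
apply: ge0_nondecreasing_set_cvg_integral => //.
- by move=> n; exact: measurable_itv.
- move=> n; apply/measurable_EFinP; apply: measurable_funS mf => //.
  exact: measurable_intJ.
- by move=> n x /itv_sub /f0; rewrite lee_fin.
Qed.

(** Monotone convergence along [itv_n]. It serves where integrability up to the ends is not known
    beforehand and only a uniform bound on compact intervals is at hand. *)
Lemma intg_exhaust f M : measurable_fun I f -> (forall x, I x -> 0 <= f x) ->
  (forall a b : R, 0 < a -> a <= b -> b < 1 ->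
     intg `[a, b] f /\ It `[a, b] f <= M) ->
  intg I f /\ It I f <= M.
Proof.
move=> mf f0 fM; have cv := itv_cvg mf f0.
have le : (\int[mu]_(x in I) (f x)%:E <= M%:E)%E.
  rewrite -(cvg_lim _ cv)//; apply: lime_le; first by apply/cvg_ex; eexists; exact: cv.
  apply: nearW => n; have [h0 h1 h2] := itv_in n.
  have [fi] := fM _ _ h0 h1 h2.
  by rewrite -lee_fin /It /Rintegral fineK//; exact: integrable_fin_num.
have fi : intg I f.
  apply/integrableP; split; first exact/measurable_EFinP.
  have -> : (\int[mu]_(x in I) `|(EFin \o f) x| = \int[mu]_(x in I) (f x)%:E)%E.
    by apply: eq_integral => x; rewrite inE => Ix /=; rewrite ger0_norm ?f0.
  exact: le_lt_trans le (ltry _).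
split=> //; rewrite -lee_fin /It /Rintegral fineK//.
by apply: integrable_fin_num => //; exact: measurable_intJ.
Qed.

(** The integral of [|f|] over some [itv_n n] is within [e] of the full one, and the complement of a
    larger interval [[a, b]] lies in the complement of [itv_n n]. *)
Lemma It_tail f (e : R) : intg I f -> 0 < e -> exists2 d : R, 0 < d & forall a b : R,
  0 < a -> a <= d -> a <= b -> 1 - d <= b -> b < 1 -> `|It I f - It `[a, b] f| < e.
Proof.
move=> fi e0; have mI := measurable_intJ.
have fni : intg I (fun x => `|f x|) by exact: intg_norm.
have subI (a b : R) : 0 < a -> b < 1 -> `[a, b] `<=` I.
  move=> a0 b1 x; rewrite /intJ/= !in_itv/= => /andP[ax xb].
  by rewrite (lt_le_trans a0 ax) (le_lt_trans xb b1).
have setD (a b : R) : 0 < a -> b < 1 -> forall h, intg I h ->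
    It I h = It `[a, b] h + It (I `\` `[a, b]) h.
  move=> a0 b1 h hi; rewrite -{1}(setDUK (subI _ _ a0 b1)).
  have mD : measurable (I `\` `[a, b]) by apply: measurableD.
  rewrite /It Rintegral_setU//.
    by rewrite setDUK//; exact: subI.
  by apply/disj_setPS => x [? []].
have := itv_cvg (intg_meas fni) (fun x _ => normr_ge0 _).
move=> cv.
have cv' : It (itv_n n) (fun x => `|f x|) @[n --> \oo] --> It I (fun x => `|f x|).
  by rewrite ItE// in cv; exact: fine_cvg.
move/cvgrPdist_lt : cv' => /(_ _ e0)[n _ /(_ n (leqnn n))] /= hn.
have [h0 h1 h2] := itv_in n.
exists (n.+2%:R^-1) => // a b a0 an ab nb b1.
have absi : intg (I `\` `[a, b]) f by apply: intgS fi => //; exact: measurableD.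
rewrite (setD a b a0 b1 f fi) addrAC subrr add0r.
have mD : measurable (I `\` `[a, b]) by exact: measurableD.
apply: le_lt_trans (It_abs mD absi) _.
apply: le_lt_trans hn; rewrite (setD _ _ h0 h2 _ fni) addrAC subrr add0r.
rewrite ger0_norm; last by apply: It_ge0.
apply: It_subset => //.
- exact: measurableD.
- apply: setDS; apply: subset_itv; rewrite bnd_simp//.
- by apply: intgS fni => //; exact: measurableD.
Qed.

(** A lower limit 0 of [|F|] at each end, weaker than convergence to 0: this is what weighted L^2
    bounds provide. *)
Definition small_ends F : Prop := forall e d : R, 0 < e -> 0 < d ->
  (exists2 a, 0 < a < d & `|F a| < e) /\ (exists2 b, 1 - d < b < 1 & `|F b| < e).

(** Since [f] is integrable up to the ends, its integral is the limit of [F b - F a] along any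
    choice of end points, in particular along points where [F] is small. This is how every
    integration by parts is closed. *)
Lemma It_small_ends F f : acpair F f -> intg I f -> small_ends F -> It I f = 0.
Proof.
move=> ac fi sF; apply/eqP; rewrite -normr_le0; apply/ler_addgt0Pr => e e0.
rewrite add0r; have e3 : 0 < e / 3 by rewrite divr_gt0.
have [d d0 hd] := It_tail fi e3.
(* The bound 1/2 ensures that the left point does not exceed the right one. *)
pose d' := Num.min d 2^-1.
have d'0 : 0 < d' by rewrite lt_min d0/= invr_gt0.
have d'd : d' <= d by rewrite ge_min lexx.
have d'2 : d' <= 2^-1 by rewrite ge_min lexx orbT.
have [[a /andP[a0 ad] Fa] [b /andP[db b1] Fb]] := sF _ _ e3 d'0.
have ab : a <= b by lra.
have := hd a b a0 _ ab _ b1; have [_ <-] := ac a b a0 ab b1.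
move=> /(_ (ltW (lt_le_trans ad d'd))) /(_ _)H.
have {H} : `|It I f - (F b - F a)| < e / 3 by apply: H; lra.
move: Fa Fb; rewrite !ltr_norml ler_norml => /andP[? ?] /andP[? ?] /andP[? ?].
by apply/andP; split; lra.
Qed.

(* If [|F| >= e] near an end point then [G >= e^2 / (x (1 - x))] there, which is
   not integrable. *)
Lemma small_ends_sq F G : intg I G ->
  (forall x, 0 < x < 1 -> F x ^+ 2 <= x * (1 - x) * G x) -> small_ends F.
Proof.
move=> Gi FG.
have G0 x : 0 < x < 1 -> 0 <= G x.
  move=> /andP[x0 x1]; have h : 0 < x * (1 - x) by rewrite mulr_gt0 ?subr_gt0.
  rewrite -(pmulr_rge0 _ h); apply: le_trans (FG x _); first exact: sqr_ge0.
  by rewrite x0.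
(* An explicit primitive of [1 / (x (1 - x))], unbounded at both ends. *)
have acL : acpair (fun x : R => ln x - ln (1 - x)) (fun x => (x * (1 - x))^-1).
  apply: acpair_C1 => x /andP[x0 x1].
    have x1' : 0 < 1 - x by rewrite subr_gt0.
    have d1 := is_derive1_ln x0; have d2 := is_derive1_ln x1'.
    have d3 : is_derive x 1 (fun y : R => ln (1 - y)) ((1 - x)^-1 * -1).
      exact: (@is_derive1_comp _ (@ln R) (fun y => 1 - y) x _ _ d2 (is_derive1_onem x)).
    apply: is_derive_eq (is_derive1B d1 d3) _.
    by field; rewrite !gt_eqF.
  apply: continuousV; first by rewrite mulf_neq0// gt_eqF// subr_gt0.
  apply: continuousM => //; apply: continuousB => //; exact: cst_continuous.
have bound (e a b : R) : 0 < e -> 0 < a -> a <= b -> b < 1 ->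
    (forall x, a <= x <= b -> e <= `|F x|) ->
    e ^+ 2 * ((ln b - ln (1 - b)) - (ln a - ln (1 - a))) <= It I G.
  move=> e0 a0 ab b1 eF.
  have [Li ->] := acL a b a0 ab b1.
  have subI : `[a, b] `<=` I.
    move=> x; rewrite /intJ/= !in_itv/= => /andP[ax xb].
    by rewrite (lt_le_trans a0 ax) (le_lt_trans xb b1).
  have IG : It `[a, b] G <= It I G.
    apply: (It_subset measurable_intJ _ subI Gi) => //.
  rewrite -ItZ//; apply: le_trans IG.
  apply: le_It => //; [exact: intgZ|by apply: intgS Gi => //; exact: measurable_intJ|].
  move=> x xab; have /intJP x01 := subI _ xab; have /andP[x0 x1] := x01.
  have h : 0 < x * (1 - x) by rewrite mulr_gt0 ?subr_gt0.
  rewrite ler_pdivrMr// mulrC; apply: le_trans (FG x x01).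
  rewrite -[leRHS]ger0_norm ?sqr_ge0// normrX lerXn2r ?nnegrE ?normr_ge0 ?(ltW e0)//.
  by apply: eF; move: xab; rewrite /= in_itv.
have IG0 : 0 <= It I G by apply: It_ge0 => x /intJP /G0.
move=> e d e0 d0.
pose b := Num.min (d / 2) 2^-1.
have b0 : 0 < b by rewrite lt_min divr_gt0//= invr_gt0.
have bd : b <= d / 2 by rewrite ge_min lexx.
have b2 : b <= 2^-1 by rewrite ge_min lexx orbT.
(* Between [a = b * expR (- K)] and [b] the primitive grows by at least [K], so [|F| >= e]
   throughout would force the integral of [G] above its value. *)
pose K := It I G / e ^+ 2 + 1.
have K0 : 0 < K by rewrite ltr_wpDl// divr_ge0// sqr_ge0.
pose a := b * expR (- K).
have a0 : 0 < a by rewrite mulr_gt0// expR_gt0.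
have ab : a <= b.
  by rewrite -[leRHS]mulr1 ler_pM2l// -expR0 ler_expR; lra.
have lna : ln a = ln b - K by rewrite lnM ?posrE ?expR_gt0// expRK.
have lab : ln (1 - b) <= ln (1 - a) by rewrite ler_ln ?posrE; lra.
have big : It I G < e ^+ 2 * (ln b - ln (1 - b) - (ln a - ln (1 - a))).
  have e2 : 0 < e ^+ 2 by rewrite exprn_gt0.
  apply: (@lt_le_trans _ _ (e ^+ 2 * K)); last by rewrite ler_pM2l//; lra.
  by rewrite /K mulrDr mulr1 mulrC divfK ?gt_eqF// ltrDl.
split; apply: contrapT => nex.
  have eF x : a <= x <= b -> e <= `|F x|.
    move=> /andP[ax xb]; rewrite leNgt; apply/negP => Fx; apply: nex.
    by exists x => //; apply/andP; split; lra.
  have b1 : b < 1 by lra.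
  by have := bound e a b e0 a0 ab b1 eF; rewrite leNgt big.
(* The primitive changes sign under [x -> 1 - x], so the same [a] and [b] serve at the right end. *)
have eF x : 1 - b <= x <= 1 - a -> e <= `|F x|.
  move=> /andP[ax xb]; rewrite leNgt; apply/negP => Fx; apply: nex.
  by exists x => //; apply/andP; split; lra.
have h1 : 0 < 1 - b by lra.
have h2 : 1 - b <= 1 - a by lra.
have h3 : 1 - a < 1 by lra.
have := bound e (1 - b) (1 - a) e0 h1 h2 h3 eF; rewrite !subKr leNgt.
by rewrite (_ : ln (1 - a) - ln a - (ln (1 - b) - ln b) =
  ln b - ln (1 - b) - (ln a - ln (1 - a))) ?big//; ring.
Qed.

End Improper.

(** * Primitives based at 0 and their smallness at the ends *)

Section Cumulative.
Context {R : realType}.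
Implicit Types (f : R -> R).
Local Notation I := (@intJ R).

Definition cum f (x : R) : R := It `]0, x] f.

Lemma sub_oc_I (x : R) : x < 1 -> `]0, x] `<=` I.
Proof. by move=> x1 y; rewrite /intJ/= !in_itv/= => /andP[-> /le_lt_trans->]. Qed.

Lemma sub_oo_I (x : R) : 0 < x -> `]x, 1[ `<=` I.
Proof. by move=> x0 y; rewrite /intJ/= !in_itv/= => /andP[/(lt_trans x0)-> ->]. Qed.

Lemma sub_cc_I (a b : R) : 0 < a -> b < 1 -> `[a, b] `<=` I.
Proof.
move=> a0 b1 x; rewrite /intJ/= !in_itv/= => /andP[ax xb].
by rewrite (lt_le_trans a0 ax) (le_lt_trans xb b1).
Qed.

Lemma intg_oc f (x : R) : x < 1 -> intg I f -> intg `]0, x] f.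
Proof.
by move=> x1; apply: intgS => //; [exact: measurable_intJ|exact: sub_oc_I].
Qed.

Lemma intg_oo f (x : R) : 0 < x -> intg I f -> intg `]x, 1[ f.
Proof.
by move=> x1; apply: intgS => //; [exact: measurable_intJ|exact: sub_oo_I].
Qed.

Lemma intg_cc f (a b : R) : 0 < a -> b < 1 -> intg I f -> intg `[a, b] f.
Proof.
by move=> a0 b1; apply: intgS => //; [exact: measurable_intJ|exact: sub_cc_I].
Qed.

Lemma cum_It f (a b : R) : intg I f -> 0 < a -> a <= b -> b < 1 ->
  cum f b - cum f a = It `[a, b] f.
Proof.
move=> fi a0 ab b1; rewrite /cum /It.
rewrite (@Rintegral_itvB R f (BRight 0) (BRight b) a (intg_oc b1 fi));
  rewrite ?bnd_simp ?(ltW a0)//.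
apply: Rintegral_itv_obnd_cbnd; apply: intgS (intg_cc a0 b1 fi) => //.
by apply: subset_itvr; rewrite bnd_simp.
Qed.

Lemma cum_tail f (x : R) : intg I f -> 0 < x < 1 ->
  It `]x, 1[ f = It I f - cum f x.
Proof.
move=> fi /andP[x0 x1]; rewrite /cum /It /intJ.
by rewrite (@Rintegral_itvB R f (BRight 0) (BLeft 1) x fi) ?bnd_simp ?(ltW x0).
Qed.

Lemma acpair_cum f : intg I f -> acpair (cum f) f.
Proof.
move=> fi a b a0 ab b1; split; last exact: cum_It.
exact: intg_cc fi.
Qed.

Lemma cum_small f (e : R) : intg I f -> (forall x, I x -> 0 <= f x) -> 0 < e ->
  exists2 d : R, 0 < d & (forall x, 0 < x < d -> x < 1 -> cum f x < e) /\
    (forall x, 1 - d < x < 1 -> 0 < x -> It `]x, 1[ f < e).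
Proof.
move=> fi f0 e0; have [d d0 hd] := It_tail fi e0.
exists d => //; split=> x.
  move=> /andP[x0 xd] x1.
  (* [It_tail] needs an interval that also reaches within [d] of 1; the part beyond [b] is
     nonnegative and is dropped. *)
  pose b := Num.max x (1 - d).
  have b1 : b < 1 by rewrite gt_max x1; lra.
  have xb : x <= b by rewrite le_max lexx.
  have b0 : 0 < b := lt_le_trans x0 xb.
  have db : 1 - d <= b by rewrite le_max lexx orbT.
  have := hd x b x0 (ltW xd) xb db b1.
  have t0 : 0 <= It `]b, 1[ f.
    by apply: It_ge0 => y /(sub_oo_I b0)/f0.
  rewrite (@cum_tail f b) ?b0// in t0; rewrite -cum_It// => H.
  by have := ler_norm (It I f - (cum f b - cum f x)); lra.
move=> /andP[xd x1] x0.
pose a := Num.min x d.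
have a0 : 0 < a by rewrite lt_min x0.
have ax : a <= x by rewrite ge_min lexx.
have a1 : a < 1 := le_lt_trans ax x1.
have ad : a <= d by rewrite ge_min lexx orbT.
have := hd a x a0 ad ax (ltW xd) x1.
have t0 : 0 <= cum f a by apply: It_ge0 => y /(sub_oc_I a1)/f0.
rewrite (@cum_tail f x) ?x0// -cum_It// => H.
by have := ler_norm (It I f - (cum f x - cum f a)); lra.
Qed.

End Cumulative.

(** * Jacobi weights and bounds for their primitives *)

Section JacobiWeight.
Context {R : realType}.
Implicit Types (a b x : R).
Local Notation I := (@intJ R).

Definition jw a b x : R := (1 - x) `^ a * x `^ b.

(* The derivative of [jw (a + 1) (b + 1)] is [jw a b * jl a b]. *)
Definition jl a b x : R := (b + 1) * (1 - x) - (a + 1) * x.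

Lemma jw_gt0 a b x : 0 < x < 1 -> 0 < jw a b x.
Proof. by move=> /andP[x0 x1]; rewrite mulr_gt0// powR_gt0// subr_gt0. Qed.

Lemma jw_ge0 a b x : 0 <= jw a b x.
Proof. by rewrite mulr_ge0// powR_ge0. Qed.

Lemma jwS a b x : 0 < x < 1 -> jw (a + 1) (b + 1) x = jw a b x * (x * (1 - x)).
Proof.
move=> /andP[x0 x1]; rewrite /jw !powRD; try by apply/implyP => _; lra.
by rewrite !powRr1; [ring|lra|lra].
Qed.

Lemma is_derive_jw a b x : 0 < x < 1 ->
  is_derive x 1 (jw (a + 1) (b + 1)) (jw a b x * jl a b x).
Proof.
move=> x01; have /andP[x0 x1] := x01; have x1' : 0 < 1 - x by lra.
have d2 := is_derive1_powR (b + 1) x0.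
have d1 := @is_derive1_comp R (fun y => y `^ (a + 1)) (fun y => 1 - y) x _ _
  (is_derive1_powR (a + 1) x1') (is_derive1_onem x).
apply: is_derive_eq (is_derive1M d1 d2) _.
rewrite /jw /= !addrK /jl !powRD; try by apply/implyP => _; lra.
by rewrite !powRr1; [ring|lra|lra].
Qed.

Lemma jw_cont a b x : 0 < x < 1 -> {for x, continuous (jw a b)}.
Proof.
move=> x01; have := is_derive_jw (a - 1) (b - 1) x01; rewrite !subrK.
exact: is_derive1_cont.
Qed.

Lemma jl_cont a b x : {for x, continuous (jl a b)}.
Proof.
have d3 := is_derive1_onem x.
have hid : is_derive x 1 (fun y : R => y) 1 by exact: is_derive_id.
have hc c : is_derive x 1 (fun=> c : R) 0 by exact: is_derive_cst.
exact: is_derive1_cont (is_derive1B (is_derive1M (hc (b + 1)) d3)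
  (is_derive1M (hc (a + 1)) hid)).
Qed.

Lemma jw_meas a b : measurable_fun I (jw a b).
Proof. by apply: cont_meas_intJ => x; exact: jw_cont. Qed.

Lemma acpair_jw a b : acpair (jw (a + 1) (b + 1)) (fun x => jw a b x * jl a b x).
Proof.
apply: acpair_C1 => x x01; first exact: is_derive_jw.
by apply: continuousM; [exact: jw_cont|exact: jl_cont].
Qed.

Lemma jw_le1 a b x : 0 <= a -> 0 <= b -> 0 < x < 1 -> jw a b x <= 1.
Proof.
move=> a0 b0 /andP[x0 x1]; rewrite -[leRHS]mulr1.
have le1 (c y : R) : 0 <= c -> 0 < y < 1 -> y `^ c <= 1.
  move=> c0 /andP[y0 y1]; have -> : 1 = 1 `^ c :> R by rewrite powR1.
  by apply: ge0_ler_powR => //; rewrite ?nnegrE ?ltW.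
by apply: ler_pM; rewrite ?powR_ge0//; apply: le1 => //; apply/andP; lra.
Qed.

(** A constant [C] with [int_0^x w <= C W(x)] for [x <= 1/2] and [int_x^1 w <= C W(x)] for
    [x >= 1/2]. The first summand serves the left end, the second the right end. *)
Definition jC a b : R := 2 * expR (a + 1) / (b + 1) + 2 * expR (b + 1) / (a + 1).

Lemma jC_ge0 a b : -1 < a -> -1 < b -> 0 <= jC a b.
Proof.
move=> a1 b1; have ea := expR_ge0 (a + 1); have eb := expR_ge0 (b + 1).
by rewrite addr_ge0// divr_ge0 ?mulr_ge0//; lra.
Qed.

Lemma is_derive1_expRM (k y : R) :
  is_derive y 1 (fun z : R => expR (k * z)) (k * expR (k * y)).
Proof.
have hid : is_derive y 1 (fun z : R => k * z) (k * 1).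
  have hc : is_derive y 1 (fun=> k : R) 0 by exact: is_derive_cst.
  have hi : is_derive y 1 (fun z : R => z) 1 by exact: is_derive_id.
  by apply: is_derive_eq (is_derive1M hc hi) _; rewrite mul0r add0r.
have := @is_derive1_comp _ expR (fun z => k * z) y _ _ (is_derive_expR _) hid.
by move=> h; apply: is_derive_eq h _; rewrite mulr1 mulrC.
Qed.

(** The derivative [w l] of [W] need not dominate [w], because of the term [- (a + 1) x] in [l].
    Multiplying [W] by [expR (k x)] with [k = 2 (a + 1)] replaces [l] by
    [(b + 1)(1 - x) + (a + 1) x (1 - 2 x)], which is at least [(b + 1) / 2] up to 1/2, while the
    exponential stays between 1 and [expR (a + 1)]. *)
Lemma jw_It_left a b e x : -1 < a -> -1 < b -> 0 < e -> e <= x -> x <= 2^-1 ->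
  It `[e, x] (jw a b) <= jC a b * jw (a + 1) (b + 1) x.
Proof.
move=> a1 b1 e0 ex x2.
pose k := 2 * (a + 1).
have dE y := is_derive1_expRM k y.
have acE : acpair (fun z : R => expR (k * z)) (fun z => k * expR (k * z)).
  apply: acpair_C1 => y _.
  apply: continuousM; [exact: cst_continuous|exact: is_derive1_cont (dE y)].
have x1 : x < 1 by lra.
have x0 : 0 < x by lra.
have [zi EZ] := acpair_mul (acpair_jw a b) acE e0 ex x1.
have wi : intg `[e, x] (jw a b).
  by apply: intg_cont_in => y /andP[ey yx]; apply: jw_cont; apply/andP; lra.
have h : (b + 1) / 2 * It `[e, x] (jw a b) <= jw (a + 1) (b + 1) x * expR (k * x).
  have We := mulr_ge0 (jw_ge0 (a + 1) (b + 1) e) (expR_ge0 (k * e)).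
  rewrite -ItZ//; apply: (@le_trans _ _ (jw (a + 1) (b + 1) x * expR (k * x) -
    jw (a + 1) (b + 1) e * expR (k * e))); last by lra.
  rewrite EZ.
  apply: le_It => //; first exact: intgZ.
  move=> y; rewrite /= in_itv/= => /andP[ey yx].
  have y01 : 0 < y < 1 by apply/andP; lra.
  rewrite (jwS _ _ y01).
  have -> : jw a b y * jl a b y * expR (k * y) +
      jw a b y * (y * (1 - y)) * (k * expR (k * y)) =
      ((jl a b y + k * (y * (1 - y))) * expR (k * y)) * jw a b y by ring.
  apply: ler_wpM2r; first exact: jw_ge0.
  have E1 : 1 <= expR (k * y).
    by rewrite -expR0 ler_expR mulr_ge0//; rewrite /k; lra.
  have h2 : (b + 1) / 2 <= jl a b y + k * (y * (1 - y)).
    have p1 : 0 <= (b + 1) * (2^-1 - y) by apply: mulr_ge0; lra.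
    have p2 : 0 <= (a + 1) * (y * (1 - 2 * y)) by do 2!(apply: mulr_ge0; try lra).
    rewrite /jl /k; lra.
  rewrite -[leLHS]mulr1; apply: ler_pM => //; lra.
have h3 : jw (a + 1) (b + 1) x * expR (k * x) <= jw (a + 1) (b + 1) x * expR (a + 1).
  apply: ler_wpM2l; first exact: jw_ge0.
  by rewrite ler_expR /k; nra.
have h4 := le_trans h h3.
have b1' : 0 < b + 1 by lra.
apply: (@le_trans _ _ (2 * expR (a + 1) / (b + 1) * jw (a + 1) (b + 1) x)).
  rewrite -(ler_pM2l (_ : 0 < (b + 1) / 2)); last by lra.
  apply: le_trans h4 _; rewrite le_eqVlt; apply/orP; left; apply/eqP; field.
  by rewrite gt_eqF.
apply: ler_wpM2r; first exact: jw_ge0.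
by rewrite lerDl divr_ge0 ?mulr_ge0 ?expR_ge0//; lra.
Qed.

(** Mirror image of the left bound, with a decreasing exponential: now [- (l + k y (1 - y)) = (a +
    1) y + (b + 1)(1 - y)(2 y - 1)], at least [(a + 1) / 2] from 1/2 on. *)
Lemma jw_It_right a b e x : -1 < a -> -1 < b -> 2^-1 <= x -> x <= e -> e < 1 ->
  It `[x, e] (jw a b) <= jC a b * jw (a + 1) (b + 1) x.
Proof.
move=> a1 b1 x2 xe e1.
pose k := - (2 * (b + 1)).
have dE y := is_derive1_expRM k y.
have acE : acpair (fun z : R => expR (k * z)) (fun z => k * expR (k * z)).
  apply: acpair_C1 => y _.
  apply: continuousM; [exact: cst_continuous|exact: is_derive1_cont (dE y)].
have x1 : x < 1 by lra.
have x0 : 0 < x by lra.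
have [zi EZ] := acpair_mul (acpair_jw a b) acE x0 xe e1.
have wi : intg `[x, e] (jw a b).
  by apply: intg_cont_in => y /andP[xy ye]; apply: jw_cont; apply/andP; lra.
have h : (a + 1) / 2 * expR k * It `[x, e] (jw a b) <=
    jw (a + 1) (b + 1) x * expR (k * x).
  have We := mulr_ge0 (jw_ge0 (a + 1) (b + 1) e) (expR_ge0 (k * e)).
  rewrite -ItZ// -lerN2; apply: (@le_trans _ _ (jw (a + 1) (b + 1) e * expR (k * e) -
    jw (a + 1) (b + 1) x * expR (k * x))); first by lra.
  rewrite EZ -ItN; [|by []|exact: intgZ].
  apply: le_It => //; first by apply: intgN => //; exact: intgZ.
  move=> y; rewrite /= in_itv/= => /andP[xy ye].
  have y01 : 0 < y < 1 by apply/andP; lra.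
  rewrite (jwS _ _ y01).
  have -> : jw a b y * jl a b y * expR (k * y) +
      jw a b y * (y * (1 - y)) * (k * expR (k * y)) =
      - ((- (jl a b y + k * (y * (1 - y)))) * expR (k * y) * jw a b y) by ring.
  rewrite lerN2; apply: ler_wpM2r; first exact: jw_ge0.
  have E1 : expR k <= expR (k * y) by rewrite ler_expR /k; nra.
  have h2 : (a + 1) / 2 <= - (jl a b y + k * (y * (1 - y))).
    have p1 : 0 <= (a + 1) * (y - 2^-1) by apply: mulr_ge0; lra.
    have p2 : 0 <= (b + 1) * ((1 - y) * (2 * y - 1)) by do 2!(apply: mulr_ge0; try lra).
    rewrite /jl /k; lra.
  by apply: ler_pM => //; first lra; exact: expR_ge0.
have h3 : jw (a + 1) (b + 1) x * expR (k * x) <=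
    jw (a + 1) (b + 1) x * (expR (b + 1) * expR k).
  apply: ler_wpM2l; first exact: jw_ge0.
  by rewrite -expRD ler_expR /k; nra.
have h4 := le_trans h h3.
have a1' : 0 < a + 1 by lra.
have Ek := expR_gt0 k.
apply: (@le_trans _ _ (2 * expR (b + 1) / (a + 1) * jw (a + 1) (b + 1) x)).
  rewrite -(ler_pM2l (_ : 0 < (a + 1) / 2 * expR k)); last by rewrite mulr_gt0//; lra.
  apply: le_trans h4 _; rewrite le_eqVlt; apply/orP; left; apply/eqP; field.
  by rewrite gt_eqF.
apply: ler_wpM2r; first exact: jw_ge0.
by rewrite lerDr divr_ge0 ?mulr_ge0 ?expR_ge0//; lra.
Qed.

(** Cutting at 1/2 bounds all compact integrals by the two one-sided estimates, uniformly. *)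
Lemma jw_intg a b : -1 < a -> -1 < b -> intg I (jw a b).
Proof.
move=> a1 b1.
have wi (x y : R) : 0 < x -> y < 1 -> intg `[x, y] (jw a b).
  move=> x0 y1; apply: intg_cont_in => z /andP[xz zy]; apply: jw_cont.
  by rewrite (lt_le_trans x0 xz) (le_lt_trans zy y1).
apply: (proj1 (@intg_exhaust R (jw a b) (2 * (jC a b * jw (a + 1) (b + 1) 2^-1))
  (@jw_meas a b) (fun x _ => jw_ge0 a b x) _)).
move=> x y x0 xy y1; split; first exact: wi.
have h2 : 0 < (2^-1 : R) by rewrite invr_gt0.
pose x' := Num.min x 2^-1; pose y' := Num.max y 2^-1.
have x'0 : 0 < x' by rewrite lt_min x0.
have x'x : x' <= x by rewrite ge_min lexx.
have x'2 : x' <= 2^-1 by rewrite ge_min lexx orbT.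
have yy' : y <= y' by rewrite le_max lexx.
have y'2 : 2^-1 <= y' by rewrite le_max lexx orbT.
have y'1 : y' < 1 by rewrite gt_max y1; lra.
apply: (@le_trans _ _ (It `[x', y'] (jw a b))).
  apply: It_subset => //; last by move=> z _; exact: jw_ge0.
    by apply: subset_itv; rewrite bnd_simp.
  exact: wi.
rewrite (It_split x'2 y'2) ?mulr_natl ?mulr2n; last exact: wi.
by apply: lerD; [exact: jw_It_left|exact: jw_It_right].
Qed.

(** The limit of [jw_It_left] as its lower end tends to 0, now that [jw] is known to be
    integrable. *)
Lemma It_jw_oc a b x : -1 < a -> -1 < b -> 0 < x -> x <= 2^-1 ->
  It `]0, x] (jw a b) <= jC a b * jw (a + 1) (b + 1) x.
Proof.
move=> a1 b1 x0 x2; have wi := jw_intg a1 b1.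
apply/ler_addgt0Pr => e e0.
have [d d0 [hd _]] := cum_small wi (fun x _ => jw_ge0 a b x) e0.
pose y := Num.min (d / 2) x.
have y0 : 0 < y by rewrite lt_min divr_gt0//.
have yx : y <= x by rewrite ge_min lexx orbT.
have yd : y < d by rewrite gt_min; apply/orP; left; lra.
have x1 : x < 1 by lra.
have := hd y _ (le_lt_trans yx x1); rewrite y0 yd => /(_ isT).
have := cum_It wi y0 yx x1; rewrite -/(cum _ _).
by have := jw_It_left a1 b1 y0 yx x2; lra.
Qed.

Lemma It_jw_oo a b x : -1 < a -> -1 < b -> 2^-1 <= x -> x < 1 ->
  It `]x, 1[ (jw a b) <= jC a b * jw (a + 1) (b + 1) x.
Proof.
move=> a1 b1 x2 x1; have wi := jw_intg a1 b1.
have x0 : 0 < x by lra.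
apply/ler_addgt0Pr => e e0.
have [d d0 [_ hd]] := cum_small wi (fun x _ => jw_ge0 a b x) e0.
pose y := Num.max (1 - d / 2) x.
have y1 : y < 1 by rewrite gt_max x1; lra.
have xy : x <= y by rewrite le_max lexx orbT.
have yd : 1 - d < y by rewrite lt_max; apply/orP; left; lra.
have y0 : 0 < y := lt_le_trans x0 xy.
have := hd y _ y0; rewrite y1 yd => /(_ isT).
have := cum_It wi x0 xy y1; rewrite (@cum_tail _ _ x) ?x0// (@cum_tail _ _ y) ?y0//.
by have := jw_It_right a1 b1 x2 xy y1; lra.
Qed.

End JacobiWeight.

(** * Weighted L^2 functions, polynomials and orthogonality *)

Section WeightedL2.
Context {R : realType}.
Implicit Types (a b : R) (u v w g : R -> R) (p q : {poly R}).
Local Notation I := (@intJ R).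

Definition sqi w v : Prop :=
  measurable_fun I v /\ intg I (fun x => v x ^+ 2 * w x).

Lemma sqi_CS a b u v : sqi (jw a b) u -> sqi (jw a b) v ->
  intg I (fun x => u x * v x * jw a b x) /\
  It I (fun x => u x * v x * jw a b x) ^+ 2 <=
  It I (fun x => u x ^+ 2 * jw a b x) * It I (fun x => v x ^+ 2 * jw a b x).
Proof.
move=> [mu iu] [mv iv]; apply: It_CS => //.
- exact: measurable_intJ.
- by move=> x _; exact: jw_ge0.
- by apply: measurable_funM; [exact: measurable_funM|exact: jw_meas].
Qed.

Lemma sqi_prod a b u v : sqi (jw a b) u -> sqi (jw a b) v ->
  intg I (fun x => u x * v x * jw a b x).
Proof. by move=> su sv; have [] := sqi_CS su sv. Qed.

Lemma sqiB a b u v : sqi (jw a b) u -> sqi (jw a b) v ->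
  sqi (jw a b) (fun x => u x - v x).
Proof.
move=> su sv; have iuv := sqi_prod su sv.
case: su sv => [mu iu] [mv iv]; split; first exact: measurable_funB.
have mI := @measurable_intJ R.
apply: eq_intg (intgD mI (intgB mI iu (intgZ 2 mI iuv)) iv) => // x _.
ring.
Qed.

Lemma horner_cont p (x : R) : {for x, continuous (horner p)}.
Proof. exact: is_derive1_cont (is_derive_poly p x). Qed.

Lemma horner_bnd p : exists2 M : R, 0 <= M & forall x, 0 <= x <= 1 -> `|p.[x]| <= M.
Proof.
have cp : {within `[0, 1], continuous (fun x : R => `|p.[x]|)}.
  apply: continuous_in_subspaceT => x _.
  have cx := horner_cont (p := p) (x := x).
  by apply: continuous_comp cx _; exact: norm_continuous.
have [c _ cmax] := EVT_max ler01 cp.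
by exists `|p.[c]| => // x x01; apply: cmax; rewrite in_itv.
Qed.

Lemma horner_meas p : measurable_fun I (horner p).
Proof. by apply: cont_meas_intJ => x _; exact: horner_cont. Qed.

Lemma sqi_poly a b p : -1 < a -> -1 < b -> sqi (jw a b) (horner p).
Proof.
move=> a1 b1; split; first exact: horner_meas.
have [M M0 pM] := horner_bnd p.
have mI := @measurable_intJ R.
apply: intg_le (intgZ (M ^+ 2) mI (jw_intg a1 b1)) => //.
  apply: measurable_funM; last exact: jw_meas.
  by apply: measurable_funX; exact: horner_meas.
move=> x /intJP/andP[x0 x1]; rewrite normrM (ger0_norm (jw_ge0 _ _ _)).
apply: ler_wpM2r; first exact: jw_ge0.
by rewrite normrX lerXn2r ?nnegrE// pM// !ltW.
Qed.

Lemma acpair_horner p : acpair (horner p) (horner p^`()).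
Proof.
by apply: acpair_C1 => x _; exact: horner_cont.
Qed.

Definition jL a b : {poly R} := (b + 1)%:P * (1 - 'X) - (a + 1)%:P * 'X.

(* [(W p)' = w * jadj p] for the weights [w = jw a b], [W = jw (a+1) (b+1)]. *)
Definition jadj a b p : {poly R} := 'X * (1 - 'X) * p^`() + jL a b * p.

Lemma jadjE a b p x :
  (jadj a b p).[x] = x * (1 - x) * p^`().[x] + jl a b x * p.[x].
Proof. by rewrite /jadj /jL /jl !hornerE. Qed.

Lemma size_jadj a b p n : (size p <= n)%N -> (size (jadj a b p) <= n.+1)%N.
Proof.
move=> pn; have [->|p0] := eqVneq p 0.
  by rewrite /jadj deriv0 !mulr0 addr0 size_poly0.
have s1 : (size (1 - 'X : {poly R})%R <= 2)%N.
  by rewrite -opprB size_polyN size_XsubC.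
have sd : (size p^`() < size p)%N := lt_size_deriv p0.
apply: leq_trans (size_polyD _ _) _; rewrite geq_max; apply/andP; split.
  apply: leq_trans (size_polyMleq _ _) _.
  have : (size ('X * (1 - 'X) : {poly R})%R <= 3)%N.
    apply: leq_trans (size_polyMleq _ _) _.
    by rewrite size_polyX -ltnS; case: (size _) s1 => [|[|[|]]].
  by move: pn sd; lia.
apply: leq_trans (size_polyMleq _ _) _.
have : (size (jL a b) <= 2)%N.
  apply: leq_trans (size_polyD _ _) _; rewrite geq_max size_polyN; apply/andP; split.
    by rewrite mul_polyC (leq_trans (size_scale_leq _ _)).
  by rewrite mul_polyC (leq_trans (size_scale_leq _ _))// size_polyX.
by move: pn; lia.
Qed.

(** The boundary term is [v W p]. Since [W <= 1] and [W = w x (1 - x)], its square is at most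
    [x (1 - x)] times a multiple of the integrable [v ^+ 2 * w], so [small_ends_sq] applies. *)
Lemma It_adjoint a b v g p : -1 < a -> -1 < b -> acpair v g ->
  sqi (jw a b) v -> sqi (jw (a + 1) (b + 1)) g ->
  It I (fun x => g x * p.[x] * jw (a + 1) (b + 1) x) =
  - It I (fun x => v x * (jadj a b p).[x] * jw a b x).
Proof.
move=> a1 b1 ac sv sg; have mI := @measurable_intJ R.
have a2 : -1 < a + 1 by lra. have b2 : -1 < b + 1 by lra.
have i1 := sqi_prod sg (sqi_poly p a2 b2).
have i2 := sqi_prod sv (sqi_poly (jadj a b p) a1 b1).
have acF := acpair_mul ac (acpair_mul (acpair_jw a b) (acpair_horner p)).
have E x : I x -> g x * (jw (a + 1) (b + 1) x * p.[x]) + v x *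
    (jw a b x * jl a b x * p.[x] + jw (a + 1) (b + 1) x * p^`().[x]) =
    g x * p.[x] * jw (a + 1) (b + 1) x + v x * (jadj a b p).[x] * jw a b x.
  by move=> /intJP x01; rewrite jadjE (jwS _ _ x01); ring.
have [M M0 pM] := horner_bnd p.
have fi := intgD mI i1 i2.
have : It I (fun x => g x * p.[x] * jw (a + 1) (b + 1) x +
    v x * (jadj a b p).[x] * jw a b x) = 0.
  rewrite -(eq_It E); apply: (It_small_ends acF).
    by apply: eq_intg fi => // x /E.
  apply: (@small_ends_sq _ _ (fun x => M ^+ 2 * (v x ^+ 2 * jw a b x))).
    by apply: intgZ => //; case: sv.
  move=> x x01; have /andP[x0 x1] := x01.
  have W1 : jw (a + 1) (b + 1) x <= 1 by apply: jw_le1 => //; lra.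
  have W0 := jw_ge0 (a + 1) (b + 1) x.
  have p2 : p.[x] ^+ 2 <= M ^+ 2.
    by rewrite -[leLHS]ger0_norm ?sqr_ge0// normrX lerXn2r ?nnegrE// pM// !ltW.
  have -> : (v x * (jw (a + 1) (b + 1) x * p.[x])) ^+ 2 =
      (jw (a + 1) (b + 1) x * p.[x] ^+ 2) * (v x ^+ 2 * jw (a + 1) (b + 1) x) by ring.
  rewrite {2}(jwS _ _ x01).
  have -> : x * (1 - x) * (M ^+ 2 * (v x ^+ 2 * jw a b x)) =
     (1 * M ^+ 2) * (v x ^+ 2 * (jw a b x * (x * (1 - x)))) by ring.
  apply: ler_wpM2r; last by apply: ler_pM; rewrite ?sqr_ge0.
  by rewrite -(jwS _ _ x01) mulr_ge0 ?sqr_ge0.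
by rewrite ItD// => /eqP; rewrite addr_eq0 => /eqP.
Qed.

Definition perp w v n : Prop := forall p, (size p <= n)%N ->
  It I (fun x => v x * p.[x] * w x) = 0.

(** Moving the derivative onto the test polynomial turns [p] into [jadj a b p], larger in size by at
    most one; hence the loss of one degree. *)
Lemma perp_deriv a b v g n : -1 < a -> -1 < b -> acpair v g ->
  sqi (jw a b) v -> sqi (jw (a + 1) (b + 1)) g ->
  perp (jw a b) v n.+1 -> perp (jw (a + 1) (b + 1)) g n.
Proof.
move=> a1 b1 ac sv sg pv p pn; rewrite (It_adjoint p a1 b1 ac sv sg).
by rewrite pv ?oppr0// size_jadj.
Qed.

Lemma poly_primitive p n : (size p <= n)%N ->
  exists2 P : {poly R}, (size P <= n.+1)%N & P^`() = p.
Proof.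
(* At [i = 0] the division by zero yields 0, a harmless choice of the constant of integration. *)
move=> pn; exists (\poly_(i < n.+1) (p`_i.-1 / i%:R)); first exact: size_poly.
apply/polyP => i; rewrite coef_deriv coef_poly ltnS; case: ltnP => ni.
  by rewrite /= -[LHS]mulr_natr divfK// pnatr_eq0.
by rewrite mul0rn nth_default// (leq_trans pn).
Qed.

End WeightedL2.

(** * The weighted Poincare inequality *)

Section Poincare.
Context {R : realType}.
Implicit Types (a b : R) (v g : R -> R).
Local Notation I := (@intJ R).

Lemma intg_cstI (c : R) : intg I (fun=> c).
Proof.
apply: (@intgS _ `[0, 1] I) => //; first exact: measurable_itv.
  by apply: subset_itv; rewrite bnd_simp.
by apply: (@intg_bounded _ _ _ `|c|) => // x _.
Qed.

Section Primitive.
Variables (a b : R) (v g : R -> R).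
Hypotheses (a1 : -1 < a) (b1 : -1 < b) (ac : acpair v g).
Hypotheses (sv : sqi (jw a b) v) (sg : sqi (jw (a + 1) (b + 1)) g).
Hypothesis (v1 : It I (fun x => v x * jw a b x) = 0).

Let w := jw a b.
Let W := jw (a + 1) (b + 1).
Let W2 := jw (a + 1 + 1) (b + 1 + 1).
Let l := jl a b.
Let S := It I (fun x => v x ^+ 2 * w x).
Let phi x := v x * w x.

(* [q] solves [(W q)' = - w v], and [D] is its derivative. *)
Definition jprim x : R := -1 * cum phi x.
Local Notation Q := jprim.
Definition jquo x : R := Q x * (W x)^-1.
Local Notation q := jquo.
Definition jdquo x : R := - (v x + l x * q x) / (x * (1 - x)).
Local Notation D := jdquo.

Let mI : measurable I := measurable_intJ.
Let w0 x : 0 <= w x. Proof. exact: jw_ge0. Qed.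
Let W0 x : 0 < x < 1 -> 0 < W x. Proof. exact: jw_gt0. Qed.
Let vwi : intg I (fun x => v x ^+ 2 * w x). Proof. by case: sv. Qed.
Let vw0 x : 0 <= v x ^+ 2 * w x. Proof. by rewrite mulr_ge0 ?sqr_ge0. Qed.
Let wi : intg I w. Proof. exact: jw_intg. Qed.

Let phii : intg I phi.
Proof.
apply: eq_intg (sqi_prod sv (sqi_poly 1 a1 b1)) => // x _.
by rewrite hornerC mulr1.
Qed.

Let acQ : acpair Q (fun x => -1 * phi x).
Proof. exact/acpairZ/acpair_cum. Qed.

Let CS A : measurable A -> A `<=` I ->
  It A phi ^+ 2 <= It A w * It A (fun x => v x ^+ 2 * w x).
Proof.
move=> mA AI.
have i1 : intg A (fun x => 1 ^+ 2 * w x).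
  by apply: eq_intg (intgS mI mA AI wi) => // x _; rewrite expr1n mul1r.
have m1 : measurable_fun A (fun x => v x * 1 * w x).
  apply: (@eq_measurable_fun _ _ _ _ _ phi) => [x _|]; first by rewrite mulr1.
  exact: measurable_funS mI AI (intg_meas phii).
have [_] := It_CS mA (fun x _ => w0 x) m1 (intgS mI mA AI vwi) i1.
rewrite mulrC (@eq_It _ _ _ phi); last by move=> x _; rewrite mulr1.
by rewrite (@eq_It _ _ (fun x => 1 ^+ 2 * w x) w)// => x _; rewrite expr1n mul1r.
Qed.

(** Cauchy-Schwarz of [v] against 1 on []0, x]]. The local integral of [v ^+ 2 * w] is kept because
    it tends to 0 with [x], which gives [Q ^+ 2 = o(W)]. *)
Let Q_left x : 0 < x -> x <= 2^-1 ->
  Q x ^+ 2 <= jC a b * W x * cum (fun x => v x ^+ 2 * w x) x.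
Proof.
move=> x0 x2; have x1 : x < 1 by lra.
rewrite /Q mulN1r sqrrN; apply: le_trans (CS _ (sub_oc_I x1)) _ => //.
by apply: ler_wpM2r; [exact: It_ge0|exact: It_jw_oc].
Qed.

(** Here the vanishing mean [v1] enters: it makes [Q x] equal to the integral of [v w] from [x] to
    1. *)
Let Q_right x : 2^-1 <= x -> x < 1 ->
  Q x ^+ 2 <= jC a b * W x * It `]x, 1[ (fun x => v x ^+ 2 * w x).
Proof.
move=> x2 x1; have x0 : 0 < x by lra.
have -> : Q x = It `]x, 1[ phi.
  by rewrite (@cum_tail R phi x) ?x0// v1 /Q mulN1r sub0r.
apply: le_trans (CS _ (sub_oo_I x0)) _ => //.
by apply: ler_wpM2r; [exact: It_ge0|exact: It_jw_oo].
Qed.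

Let S0 : 0 <= S. Proof. exact: It_ge0. Qed.

Let C := jC a b * S.
Let C0 : 0 <= C. Proof. by rewrite mulr_ge0// jC_ge0. Qed.

Let Q_bnd x : 0 < x < 1 -> Q x ^+ 2 <= C * W x.
Proof.
move=> x01; have /andP[x0 x1] := x01.
have CW : 0 <= jC a b * W x by rewrite mulr_ge0 ?jC_ge0// ltW// W0.
rewrite /C mulrAC; have [x2|x2] := leP x 2^-1.
  apply: le_trans (Q_left x0 x2) _; apply: ler_wpM2l => //.
  by apply: It_subset => //; exact: sub_oc_I.
apply: le_trans (Q_right (ltW x2) x1) _; apply: ler_wpM2l => //.
by apply: It_subset => //; exact: sub_oo_I.
Qed.

Let Qmeas : measurable_fun I Q. Proof. exact: acpair_meas acQ. Qed.

Let acWV : acpair (fun x => (W x)^-1) (fun x => - (W x) ^- 2 * (w x * l x)).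
Proof.
apply: acpair_C1 => x x01.
  have Wn : W x != 0 by rewrite gt_eqF// W0.
  exact: (is_deriveV Wn (is_derive_jw a b x01)).
have cW : {for x, continuous W} by exact: jw_cont.
have Wn : W x != 0 by rewrite gt_eqF// W0.
apply: continuousM; last by apply: continuousM; [exact: jw_cont|exact: jl_cont].
apply: continuousN; apply: continuousV; first by rewrite expf_neq0.
by apply: continuousM.
Qed.

(** The quotient rule for [Q / W], with [Q' = - v w], [W' = w l] and [W = w x (1 - x)] inserted. *)
Lemma acpair_jquo : acpair q D.
Proof.
apply: acpair_eq (acpair_mul acQ acWV) _ _ => // x x01.
have /andP[x0 x1] := x01.
have wn : w x != 0 by rewrite gt_eqF// jw_gt0.
rewrite /D /q /phi /W (jwS _ _ x01) -/(w x).
by field; rewrite wn !gt_eqF// subr_gt0.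
Qed.

Let qmeas : measurable_fun I q. Proof. exact: acpair_meas acpair_jquo. Qed.

Let qW x : 0 < x < 1 -> q x * W x = Q x.
Proof. by move=> x01; rewrite /q divfK// gt_eqF// W0. Qed.

Let q2W x : 0 < x < 1 -> q x ^+ 2 * W x = Q x ^+ 2 / W x.
Proof. by move=> x01; rewrite /q; field; rewrite gt_eqF// W0. Qed.

(** [q ^+ 2 * W] equals [Q ^+ 2 / W], which [Q_bnd] bounds by the constant [C]. *)
Lemma sqi_jquo : sqi W q.
Proof.
split=> //; apply: intg_le (intg_cstI C) => //.
  by apply: measurable_funM; [exact: measurable_funX|exact: jw_meas].
move=> x /intJP x01; rewrite q2W// ger0_norm ?divr_ge0 ?sqr_ge0 ?(ltW (W0 x01))//.
by rewrite ler_pdivrMr ?W0// Q_bnd.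
Qed.

(** The boundary term of the square identity. Squaring [v + l q = - x (1 - x) D] and using
    [l' = - lam] gives [F' = v^2 w - lam q^2 W - D^2 W2], whose integral reads
    [|v|^2 = |q'|^2 + lam |q|^2]. *)
Let F x := Q x * q x * l x.
Let lam := a + b + 2.
Let lam0 : 0 < lam. Proof. by rewrite /lam; move: a1 b1; lra. Qed.
Let f x := v x ^+ 2 * w x - lam * (q x ^+ 2 * W x) - D x ^+ 2 * W2 x.

Let acF : acpair F f.
Proof.
have dl (x : R) : is_derive x 1 l (- lam).
  have hid : is_derive x 1 (fun y : R => y) 1 by exact: is_derive_id.
  have hc (c : R) : is_derive x 1 (fun=> c : R) 0 by exact: is_derive_cst.
  apply: is_derive_eq (is_derive1B (is_derive1M (hc (b + 1)) (is_derive1_onem x))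
    (is_derive1M (hc (a + 1)) hid)) _.
  by rewrite /lam; ring.
have acl : acpair l (fun=> - lam).
  by apply: acpair_C1 => x _; exact: cst_continuous.
apply: acpair_eq (acpair_mul (acpair_mul acQ acpair_jquo) acl) _ _ => // x x01.
have /andP[x0 x1] := x01.
have wn : w x != 0 by rewrite gt_eqF// jw_gt0.
rewrite /f -(qW x01) /W2 /W !(jwS _ _ x01) -/(w x) /D /phi.
by field; rewrite !gt_eqF// subr_gt0.
Qed.

Let l_bnd x : 0 < x < 1 -> `|l x| <= lam.
Proof.
move=> /andP[x0 x1]; rewrite ler_norml /l /jl /lam.
have a1' := a1; have b1' := b1.
have p1 : 0 <= (b + 1) * (1 - x) by apply: mulr_ge0; lra.
have p2 : 0 <= (b + 1) * x by apply: mulr_ge0; lra.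
have p3 : 0 <= (a + 1) * (1 - x) by apply: mulr_ge0; lra.
have p4 : 0 <= (a + 1) * x by apply: mulr_ge0; lra.
apply/andP; split; lra.
Qed.

Let F_le x k : 0 < x < 1 -> Q x ^+ 2 <= k * W x -> `|F x| <= k * lam.
Proof.
move=> x01 Qk; have -> : F x = Q x ^+ 2 / W x * l x.
  by rewrite /F /q; ring.
rewrite normrM ger0_norm ?divr_ge0 ?sqr_ge0 ?(ltW (W0 x01))//.
apply: ler_pM => //; last exact: l_bnd.
  by rewrite divr_ge0 ?sqr_ge0 ?(ltW (W0 x01)).
by rewrite ler_pdivrMr ?W0.
Qed.

(** [Q_bnd] only makes [F] bounded. Smallness comes from the local integrals in [Q_left] and
    [Q_right], since [|F| <= lam Q^2 / W]. *)
Let F_small : small_ends F.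
Proof.
move=> e d e0 d0.
have K0 : 0 < jC a b * lam + 1 by rewrite ltr_wpDl// mulr_ge0 ?jC_ge0// ltW.
have e'0 : 0 < e / (jC a b * lam + 1) by rewrite divr_gt0.
have [d' d'0 [hl hr]] := cum_small vwi (fun x _ => vw0 x) e'0.
have key k x : 0 < x < 1 -> 0 <= k -> k < e / (jC a b * lam + 1) ->
    Q x ^+ 2 <= jC a b * W x * k -> `|F x| < e.
  move=> x01 k0 ke; rewrite mulrAC => /(F_le x01)/le_lt_trans; apply.
  move: ke; rewrite ltr_pdivlMr// mulrDr mulr1 => /le_lt_trans; apply.
  by rewrite mulrAC (mulrC _ k) mulrA mulrAC (mulrC k) lerDl.
pose r := Num.min (Num.min d d') 2^-1.
have r0 : 0 < r by rewrite !lt_min d0 d'0 invr_gt0 ltr0n.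
have rd : r <= d by rewrite !ge_min lexx.
have rd' : r <= d' by rewrite !ge_min lexx !orbT.
have r2 : r <= 2^-1 by rewrite !ge_min lexx !orbT.
pose m := r / 2; have rm : r = m * 2 by rewrite /m divfK.
clearbody m; rewrite {}rm {r} in r0 rd rd' r2.
split.
  exists m; first by apply/andP; lra.
  apply: (key (cum (fun x => v x ^+ 2 * w x) m)).
  - apply/andP; lra.
  - exact: It_ge0.
  - apply: hl; [apply/andP|]; lra.
  - apply: Q_left; lra.
exists (1 - m); first by apply/andP; lra.
apply: (key (It `]1 - m, 1[ (fun x => v x ^+ 2 * w x))).
- apply/andP; lra.
- exact: It_ge0.
- apply: hr; [apply/andP|]; lra.
- apply: Q_right; lra.
Qed.

Let Dmeas : measurable_fun I D.
Proof.
have -> : D = fun x => -1 * (v x + l x * q x) * (x * (1 - x))^-1.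
  by apply/funext => x; rewrite /D mulN1r.
apply: measurable_funM; last first.
  apply: cont_meas_intJ => x /andP[x0 x1].
  apply: continuousV; first by rewrite mulf_neq0// gt_eqF// subr_gt0.
  apply: continuousM => //; apply: continuousB => //; exact: cst_continuous.
apply: measurable_funM => //; apply: measurable_funD; first by case: sv.
apply: measurable_funM => //; apply: cont_meas_intJ => x _; exact: jl_cont.
Qed.

(** Integrability of [D ^+ 2 * W2] is not known beforehand. On compact intervals its integral is
    that of the other terms of [f] minus an increment of the bounded [F], which gives a uniform
    bound; the identity then follows from [F_small]. *)
Lemma sqi_jdquo : sqi W2 D /\ It I (fun x => D x ^+ 2 * W2 x) =
  S - (a + b + 2) * It I (fun x => q x ^+ 2 * W x).
Proof.
have [_ qi] := sqi_jquo.
have hi : intg I (fun x => v x ^+ 2 * w x - lam * (q x ^+ 2 * W x)).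
  by apply: intgB => //; exact: intgZ.
have D0 x : 0 <= D x ^+ 2 * W2 x by rewrite mulr_ge0 ?sqr_ge0 ?jw_ge0.
have mD : measurable_fun I (fun x => D x ^+ 2 * W2 x).
  by apply: measurable_funM; [exact: measurable_funX|exact: jw_meas].
have [Di _] : intg I (fun x => D x ^+ 2 * W2 x) /\
    It I (fun x => D x ^+ 2 * W2 x) <= S + 2 * (C * lam).
  apply: intg_exhaust => // x y x0 xy y1.
  have [fi EF] := acF x0 xy y1.
  have mA : measurable `[x, y] by exact: measurable_itv.
  have hi' := intg_cc x0 y1 hi.
  have E z : `[x, y]%classic z ->
      (v z ^+ 2 * w z - lam * (q z ^+ 2 * W z)) - f z = D z ^+ 2 * W2 z.
    by move=> _; rewrite /f; ring.
  split; first by apply: eq_intg E _ => //; exact: intgB.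
  rewrite -(eq_It E) ItB// -EF.
  have hle : It `[x, y] (fun z => v z ^+ 2 * w z - lam * (q z ^+ 2 * W z)) <= S.
    apply: (@le_trans _ _ (It `[x, y] (fun z => v z ^+ 2 * w z))).
      apply: le_It => //; first exact: intg_cc.
      move=> z; rewrite /= in_itv/= => /andP[xz zy].
      rewrite gerBl; apply: mulr_ge0; first exact: ltW.
      by rewrite mulr_ge0 ?sqr_ge0 ?jw_ge0.
    by apply: It_subset => //; exact: sub_cc_I.
  have x01 : 0 < x < 1 by rewrite x0 (le_lt_trans xy).
  have y01 : 0 < y < 1 by rewrite y1 (lt_le_trans x0).
  have := F_le x01 (Q_bnd x01); have := F_le y01 (Q_bnd y01).
  by rewrite !ler_norml => /andP[h1 h2] /andP[h3 h4]; lra.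
split; first by split.
have fi : intg I f by exact: intgB.
have := It_small_ends acF fi F_small.
rewrite /f ItB// ItB ?ItZ//; last exact: intgZ.
by rewrite -/S -/lam => /subr0_eq ->.
Qed.

(** Integration by parts of [v Q]; the square of this boundary term is at most
    [C W v^2 = C x (1 - x) v^2 w]. *)
Lemma It_jquo : It I (fun x => g x * q x * W x) = S.
Proof.
have gi := sqi_prod sg sqi_jquo.
have E x : I x -> g x * Q x + v x * (-1 * phi x) = g x * q x * W x - v x ^+ 2 * w x.
  by move=> /intJP x01; rewrite -(qW x01) /phi; ring.
have fi : intg I (fun x => g x * Q x + v x * (-1 * phi x)).
  by apply: eq_intg (intgB mI gi vwi) => // x /E ->.
have : It I (fun x => g x * Q x + v x * (-1 * phi x)) = 0.
  apply: (It_small_ends (acpair_mul ac acQ) fi).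
  apply: (@small_ends_sq _ _ (fun x => C * (v x ^+ 2 * w x))); first exact: intgZ.
  move=> x x01; rewrite exprMn.
  have -> : x * (1 - x) * (C * (v x ^+ 2 * w x)) = v x ^+ 2 * (C * W x).
    by rewrite /W (jwS _ _ x01) -/(w x); ring.
  by apply: ler_wpM2l; [exact: sqr_ge0|exact: Q_bnd].
by rewrite (eq_It E) (ItB mI gi vwi) => /subr0_eq h; exact: h.
Qed.

Lemma perp_jquo n : perp w v n.+1 -> perp W q n.
Proof.
move=> pv p /poly_primitive [P Pn <-].
have a2 : -1 < a + 1 by move: a1; lra.
have b2 : -1 < b + 1 by move: b1; lra.
have i1 := sqi_prod sqi_jquo (sqi_poly P^`() a2 b2).
have i2 := sqi_prod sv (sqi_poly P a1 b1).
have E x : I x -> -1 * phi x * P.[x] + Q x * P^`().[x] =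
    q x * P^`().[x] * W x - v x * P.[x] * w x.
  by move=> /intJP x01; rewrite -(qW x01) /phi; ring.
have fi : intg I (fun x => -1 * phi x * P.[x] + Q x * P^`().[x]).
  by apply: eq_intg (intgB mI i1 i2) => // x /E ->.
have [M M0 PM] := horner_bnd P.
have : It I (fun x => -1 * phi x * P.[x] + Q x * P^`().[x]) = 0.
  apply: (It_small_ends (acpair_mul acQ (acpair_horner P)) fi).
  apply: (@small_ends_sq _ _ (fun x => M ^+ 2 * C * w x)); first exact: intgZ.
  move=> x x01; rewrite exprMn.
  have -> : x * (1 - x) * (M ^+ 2 * C * w x) = (C * W x) * M ^+ 2.
    by rewrite /W (jwS _ _ x01) -/(w x); ring.
  have /andP[x0 x1] := x01.
  apply: ler_pM; rewrite ?sqr_ge0 ?Q_bnd//.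
  by rewrite -[leLHS]ger0_norm ?sqr_ge0// normrX lerXn2r ?nnegrE// PM// !ltW.
by rewrite (eq_It E) (ItB mI i1 i2) (pv _ Pn) subr0.
Qed.

End Primitive.

(* Induction on [n]: with [q] such that [v w = - (q W)'], the adjoint of the
   derivative satisfies [|v|^2 = |q'|^2 + (a + b + 2) |q|^2] and
   [|v|^2 = (v', q)], while [q] is orthogonal to one degree less. *)
Lemma poincare n a b v g : -1 < a -> -1 < b -> acpair v g ->
  sqi (jw a b) v -> sqi (jw (a + 1) (b + 1)) g -> perp (jw a b) v n ->
  n%:R * (n%:R + a + b + 1) * It I (fun x => v x ^+ 2 * jw a b x) <=
  It I (fun x => g x ^+ 2 * jw (a + 1) (b + 1) x).
Proof.
elim: n a b v g => [|n IH] a b v g a1 b1 ac sv sg pv.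
  rewrite !mul0r; apply: It_ge0 => x _; by rewrite mulr_ge0 ?sqr_ge0 ?jw_ge0.
have v1 : It I (fun x => v x * jw a b x) = 0.
  rewrite -(pv 1); last by rewrite size_poly1.
  by apply: eq_It => x _; rewrite hornerC mulr1.
have a2 : -1 < a + 1 by lra. have b2 : -1 < b + 1 by lra.
have sq := sqi_jquo a1 b1 sv v1.
have [sD ED] := sqi_jdquo a1 b1 sv v1.
have := IH _ _ _ _ a2 b2 (acpair_jquo a1 b1 sv) sq sD
  (perp_jquo a1 b1 sv v1 pv).
have [_] := sqi_CS sg sq; rewrite (It_jquo a1 b1 ac sv sg v1) ED.
set S := It I (fun x => v x ^+ 2 * _).
set T := It I (fun x => jquo a b v x ^+ 2 * _).
set G := It I (fun x => g x ^+ 2 * _).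
have S0 : 0 <= S by apply: It_ge0 => x _; rewrite mulr_ge0 ?sqr_ge0 ?jw_ge0.
have T0 : 0 <= T by apply: It_ge0 => x _; rewrite mulr_ge0 ?sqr_ge0 ?jw_ge0.
have G0 : 0 <= G by apply: It_ge0 => x _; rewrite mulr_ge0 ?sqr_ge0 ?jw_ge0.
rewrite -(natr1 n); set N : R := n%:R => CS TS.
have N0 : 0 <= N by rewrite ler0n.
clearbody N S T G.
(* The inductive hypothesis at [a + 1], [b + 1] plus the term [(a + b + 2) T]: [N (N + a + b + 3) +
   (a + b + 2) = (N + 1)(N + a + b + 2)]. *)
have TS' : (N + 1) * (N + 1 + a + b + 1) * T <= S by lra.
have [Sz|Sn] := eqVneq S 0; first by rewrite Sz mulr0.
have Sp : 0 < S by rewrite lt0r Sn.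
(* With [L] the constant, [S^2 <= G T] and [L T <= S] give [L S^2 <= G S], from which one factor [S]
   is cancelled. *)
rewrite -(ler_pM2r Sp) -(mulrA _ S S) -expr2.
have L0 : 0 <= (N + 1) * (N + 1 + a + b + 1) by apply: mulr_ge0; lra.
apply: le_trans (ler_wpM2l L0 CS) _.
by rewrite mulrCA; apply: ler_wpM2l.
Qed.

End Poincare.

(** * Existence of the projection and the chain of error estimates *)

Section ProjectionError.
Context {R : realType}.
Implicit Types (a b : R) (v : R -> R) (p : {poly R}).
Local Notation I := (@intJ R).

Let mI : measurable I := @measurable_intJ R.

(** One Gram-Schmidt step at a time: the induction hypothesis is used for [v] and also for ['X^n],
    which yields the monic orthogonal polynomial [T] of degree [n]. *)
Lemma proj_exists n a b v : -1 < a -> -1 < b -> sqi (jw a b) v ->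
  exists2 p : {poly R}, (size p <= n)%N &
    perp (jw a b) (fun x => v x - p.[x]) n.
Proof.
move=> a1 b1; elim: n v => [|n IH] v sv.
  exists 0; first by rewrite size_poly0.
  move=> q; rewrite leqn0 size_poly_eq0 => /eqP ->.
  rewrite (@eq_It _ _ _ (fun=> 0 * 0)) => [|x _]; last by rewrite hornerC mulr0 !mul0r.
  by rewrite /It Rintegral_cst// mulr0 mul0r.
have sX := sqi_poly 'X^n a1 b1.
have [T0 T0n pT] := IH _ sX; have [p pn pp] := IH _ sv.
pose T := 'X^n - T0.
have TE x : T.[x] = ('X^n).[x] - T0.[x] by rewrite hornerD hornerN.
have sT := sqi_poly T a1 b1; have sp := sqi_poly p a1 b1.
pose c := It I (fun x => (v x - p.[x]) * T.[x] * jw a b x) /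
  It I (fun x => T.[x] ^+ 2 * jw a b x).
have svp := sqiB sv sp.
have sn : (size T <= n.+1)%N.
  apply: leq_trans (size_polyD _ _) _; rewrite size_polyXn size_polyN geq_max leqnn.
  exact: leqW.
exists (p + c *: T).
  apply: leq_trans (size_polyD _ _) _; rewrite geq_max (leqW pn)/=.
  exact: leq_trans (size_scale_leq _ _) sn.
have [i1 cs] := sqi_CS svp sT.
have cE : It I (fun x => (v x - p.[x]) * T.[x] * jw a b x) -
    c * It I (fun x => T.[x] ^+ 2 * jw a b x) = 0.
  (* If [T] has norm 0 then [c] is 0 by default; Cauchy-Schwarz shows that the numerator vanishes
     too. *)
  rewrite /c; have [z|nz] := eqVneq (It I (fun x => T.[x] ^+ 2 * jw a b x)) 0.
    move: cs; rewrite z mulr0 => cs.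
    have /eqP : It I (fun x => (v x - p.[x]) * T.[x] * jw a b x) ^+ 2 = 0.
      by apply/eqP; rewrite eq_le cs sqr_ge0.
    by rewrite sqrf_eq0 => /eqP ->; rewrite mulr0 subrr.
  by rewrite divfK// subrr.
have pTn (q : {poly R}) : (size q <= n)%N -> It I (fun x => T.[x] * q.[x] * jw a b x) = 0.
  by move=> /pT <-; apply: eq_It => x _; rewrite TE.
have orthT : It I (fun x => (v x - (p + c *: T).[x]) * T.[x] * jw a b x) = 0.
  rewrite -[RHS]cE -ItZ//; last by case: sT.
  rewrite -ItB//; last by apply: intgZ => //; case: sT.
  by apply: eq_It => x _; rewrite hornerD hornerZ; ring.
have orthq (q : {poly R}) : (size q <= n)%N ->
    It I (fun x => (v x - (p + c *: T).[x]) * q.[x] * jw a b x) = 0.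
  move=> qn; have sq := sqi_poly q a1 b1.
  have iq := sqi_prod svp sq; have iT := sqi_prod sT sq.
  have <- : It I (fun x => (v x - p.[x]) * q.[x] * jw a b x) -
      c * It I (fun x => T.[x] * q.[x] * jw a b x) = 0.
    by rewrite (pp q qn) (pTn q qn) mulr0 subrr.
  rewrite -ItZ// -ItB//; last exact: intgZ.
  by apply: eq_It => x _; rewrite hornerD hornerZ; ring.
(* [T] is monic of degree [n], so the subtraction removes the top coefficient of [q]. *)
move=> q qn; pose q' := q - q`_n *: T.
have q'n : (size q' <= n)%N.
  apply/leq_sizeP => j nj; rewrite coefB coefZ /T coefB coefXn.
  have T0j : T0`_j = 0 by rewrite nth_default// (leq_trans T0n).
  rewrite T0j subr0; have [->|jn] := eqVneq j n; first by rewrite mulr1 subrr.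
  rewrite mulr0 subr0 nth_default// (leq_trans qn)// ltn_neqAle nj eq_sym.
  by rewrite jn.
have sv' := sqiB sv (sqi_poly (p + c *: T) a1 b1).
have i2 := sqi_prod sv' (sqi_poly q' a1 b1); have i3 := sqi_prod sv' sT.
transitivity (It I (fun x => (v x - (p + c *: T).[x]) * q'.[x] * jw a b x) +
   q`_n * It I (fun x => (v x - (p + c *: T).[x]) * T.[x] * jw a b x)).
  rewrite -ItZ// -ItD//; last exact: intgZ.
  apply: eq_It => x _; rewrite /q' [in q'.[x]]hornerD hornerN hornerZ; ring.
by rewrite orthq// orthT mulr0 addr0.
Qed.

Lemma size_derivn_le k p : (size p^`(k) <= size p - k)%N.
Proof.
elim: k => [|k IH]; first by rewrite subn0.
rewrite derivnS; have [->|z] := eqVneq p^`(k) 0.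
  by rewrite deriv0 size_poly0.
by have := lt_size_deriv z; move: IH; lia.
Qed.

Section Chain.
Variables (a b : R) (N s : nat) (V : nat -> R -> R) (p : {poly R}).
Hypotheses (a1 : -1 < a) (b1 : -1 < b) (N1 : (1 <= N)%N) (sN : (s <= N.+1)%N).
Hypothesis acV : forall k, (k < s)%N -> acpair (V k) (V k.+1).
Hypothesis sV : forall k, (k <= s)%N -> sqi (jw (a + k%:R) (b + k%:R)) (V k).
Hypothesis pN : (size p <= N.+1)%N.
Hypothesis perp0 : perp (jw a b) (fun x => V 0%N x - p.[x]) N.+1.

Definition derr k x : R := V k x - (p^`(k)).[x].

Let w k := jw (a + k%:R) (b + k%:R).
Let E k := It I (fun x => derr k x ^+ 2 * w k x).

Let ak k : -1 < a + k%:R. Proof. by have := ler0n R k; move: a1; lra. Qed.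
Let bk k : -1 < b + k%:R. Proof. by have := ler0n R k; move: b1; lra. Qed.

Let wS k : w k.+1 = jw (a + k%:R + 1) (b + k%:R + 1).
Proof. by rewrite /w -!addrA !natr1. Qed.

Lemma sqi_derr k : (k <= s)%N -> sqi (w k) (derr k).
Proof. by move=> ks; apply: sqiB; [exact: sV|exact: sqi_poly]. Qed.

Lemma acpair_derr k : (k < s)%N -> acpair (derr k) (derr k.+1).
Proof.
move=> ks; apply: acpair_sub; first exact: acV.
by rewrite derivnS; exact: acpair_horner.
Qed.

Lemma perp_derr k : (k <= s)%N -> perp (w k) (derr k) (N.+1 - k).
Proof.
elim: k => [|k IH] ks.
  by rewrite subn0 /w !addr0 => q /perp0.
have ks' : (k < s)%N by [].
rewrite wS; apply: (perp_deriv (ak k) (bk k) (acpair_derr ks')).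
- exact: sqi_derr (ltnW ks).
- by rewrite -wS; exact: sqi_derr.
- have -> : ((N.+1 - k.+1).+1 = N.+1 - k)%N by lia.
  exact: IH (ltnW ks).
Qed.

Let E0 k : 0 <= E k.
Proof. by apply: It_ge0 => x _; rewrite mulr_ge0 ?sqr_ge0 ?jw_ge0. Qed.

(** [poincare] at [n = N + 1 - k]: its second factor is [N + k + 2 + a + b], at least [N] because
    [a + b > -2]. *)
Let E_step k : (k < s)%N -> (N.+1 - k)%:R * N%:R * E k <= E k.+1.
Proof.
move=> ks; have := poincare (ak k) (bk k) (acpair_derr ks) (sqi_derr (ltnW ks)).
rewrite -wS => /(_ _ (sqi_derr ks) (perp_derr (ltnW ks))).
apply: le_trans; apply: ler_wpM2r; first exact: E0.
have kN : (k <= N)%N by lia.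
apply: ler_wpM2l; first by rewrite ler0n.
rewrite natrB; last exact: leqW.
rewrite -natr1; have := ler0n R k; move: a1 b1; lra.
Qed.

Let E_last : E s <= It I (fun x => V s x ^+ 2 * w s x).
Proof.
have sP := sqi_poly p^`(s) (ak s) (bk s); have sd := sqi_derr (leqnn s).
have szP : (size p^`(s) <= N.+1 - s)%N by exact: leq_trans (size_derivn_le s p) (leq_sub2r s pN).
have o := perp_derr (leqnn s) szP.
have i1 := sqi_prod sd sP.
have -> : It I (fun x => V s x ^+ 2 * w s x) =
    E s + 2 * It I (fun x => derr s x * (p^`(s)).[x] * w s x) +
    It I (fun x => (p^`(s)).[x] ^+ 2 * w s x).
  case: sP sd => _ iP [_ id].
  rewrite -ItZ// -ItD//; last exact: intgZ.
  rewrite -ItD//; last by apply: intgD => //; exact: intgZ.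
  by apply: eq_It => x _; rewrite /derr; ring.
rewrite o mulr0 addr0 lerDl.
by apply: It_ge0 => x _; rewrite mulr_ge0 ?sqr_ge0 ?jw_ge0.
Qed.

(** Descending induction from [s], with [m = s - j]. The factors [N + 1 - k] for [j <= k < s]
    multiply up to the quotient of the two factorials. *)
Lemma derr_bound j : (j <= s)%N ->
  (N.+1 - j)`!%:R * N%:R ^+ (s - j) * E j <=
  (N.+1 - s)`!%:R * It I (fun x => V s x ^+ 2 * w s x).
Proof.
move=> js; apply: (@le_trans _ _ ((N.+1 - s)`!%:R * E s)); last first.
  by apply: ler_wpM2l; [exact: ler0n|exact: E_last].
suff aux m : (m <= s)%N -> (N.+1 - (s - m))`!%:R * N%:R ^+ m * E (s - m) <=
    (N.+1 - s)`!%:R * E s.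
  by have := aux _ (leq_subr j s); rewrite subKn.
elim: m => [|m IH] ms; first by rewrite !subn0 expr0 mulr1.
apply: le_trans (IH (ltnW ms)).
set k := (s - m.+1)%N; have -> : (s - m = k.+1)%N by rewrite /k; lia.
have ks : (k < s)%N by rewrite /k; lia.
have := E_step ks; have -> : (N.+1 - k = (N.+1 - k.+1).+1)%N by lia.
rewrite factS natrM exprS.
set n1 : R := _.+1%:R; set n2 : R := _`!%:R; set e := _ ^+ m => h.
have h2 : 0 <= n2 * e by rewrite mulr_ge0// ?ler0n// exprn_ge0// ler0n.
have -> : n1 * n2 * (N%:R * e) * E k = n2 * e * (n1 * N%:R * E k) by ring.
exact: ler_wpM2l.
Qed.

End Chain.

(** Each of the [s - j] factors [N + 1 - k] with [j <= k < s] satisfies [N <= (s + 1)(N + 1 - k)].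
    The exponent of [s + 1] is then raised to [s] to make the constant independent of [j]. *)
Lemma fact_ratio_bound (N s j : nat) : (1 <= N)%N -> (j <= s)%N -> (s <= N.+1)%N ->
  (N ^ (s - j) * (N.+1 - s)`! <= s.+1 ^ s * (N.+1 - j)`!)%N.
Proof.
move=> N1 js sN.
apply: (@leq_trans (s.+1 ^ (s - j) * (N.+1 - j)`!)); last first.
  by rewrite leq_mul2r leq_pexp2l ?leq_subr ?orbT.
suff aux m : (m <= s)%N ->
    (N ^ m * (N.+1 - s)`! <= s.+1 ^ m * (N.+1 - (s - m))`!)%N.
  by have := aux _ (leq_subr j s); rewrite subKn.
elim: m => [|m IH] ms; first by rewrite !expn0 subn0.
have := IH (ltnW ms).
set k := (s - m.+1)%N; have -> : (s - m = k.+1)%N by rewrite /k; lia.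
have ks : (k < s)%N by rewrite /k; lia.
rewrite (_ : N.+1 - k = (N.+1 - k.+1).+1)%N; last by lia.
move=> h; rewrite factS !expnS -mulnA mulnACA; apply: leq_mul => //.
(* This leaves [N <= s (N + 2 - s)]: the right side is concave in [s] and equals [N + 1] at both
   [s = 1] and [s = N + 1]. *)
have : (s * (N.+1 - s).+1 <= s.+1 * (N.+1 - k.+1).+1)%N by apply: leq_mul => //; lia.
apply: leq_trans; nia.
Qed.

End ProjectionError.

(** * Smooth bumps and smoothed indicator functions *)

Section Bump.
Context {R : realType}.
Implicit Types (q : {poly R}) (x z c e : R).
Local Notation I := (@intJ R).

Lemma is_derive1X (f : R -> R) (m : nat) (x df : R) : is_derive x 1 f df ->
  is_derive x 1 (fun y => f y ^+ m) (m%:R * f x ^+ m.-1 * df).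
Proof.
move=> hf; elim: m => [|m IH].
  by rewrite !mul0r; exact: is_derive_cst.
have -> : (fun y => f y ^+ m.+1) = (fun y => f y * f y ^+ m).
  by apply/funext => y; rewrite exprS.
apply: is_derive_eq (is_derive1M hf IH) _; rewrite -natr1 /=.
by case: m {IH} => [|m] /=; rewrite ?exprS; ring.
Qed.

Lemma is_derive1_quadratic (f : R -> R) (K x : R) : f x = 0 ->
  (forall z, `|f z| <= K * (z - x) ^+ 2) -> is_derive x 1 f 0.
Proof.
move=> fx0 fK; apply/is_derive1_caratheodory.
exists (fun z => f z / (z - x)); split.
- move=> z; rewrite fx0 subr0; have [->|zx] := eqVneq z x.
    by rewrite subrr mulr0 fx0.
  by rewrite divfK// subr_eq0.
- have K0 : 0 <= K.
    have := le_trans (normr_ge0 _) (fK (x + 1)).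
    by rewrite addrAC subrr add0r expr1n mulr1.
  have K1 : 0 < K + 1 by lra.
  apply/cvgrPdist_lt => e e0 /=; rewrite fx0 mul0r.
  apply/nbhs_ballP; exists (e / (K + 1)); first exact: divr_gt0.
  move=> z; rewrite /ball/= distrC sub0r normrN => zd.
  have [->|zx] := eqVneq z x; first by rewrite fx0 mul0r normr0.
  have zx' : 0 < `|z - x| by rewrite normr_gt0 subr_eq0.
  rewrite normrM normfV ltr_pdivrMr//; apply: le_lt_trans (fK z) _.
  rewrite -[_ ^+ 2]ger0_norm ?sqr_ge0// normrX expr2 mulrA ltr_pM2r//.
  by move: zd; rewrite ltr_pdivlMr// mulrDr mulr1 mulrC; lra.
- by rewrite fx0 mul0r.
Qed.

Definition bumpf q (m : nat) x : R :=
  if 0 < x < 1 then q.[x] * ((x * (1 - x))^-1 ^+ m * expR (- (x * (1 - x))^-1)) else 0.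

(** One term of the exponential series, of order [m + 2], bounds [expR y^-1] from below; its two
    powers beyond [m] leave [y ^+ 2]. *)
Lemma expRN_inv_le (m : nat) (y : R) : 0 < y ->
  y^-1 ^+ m * expR (- y^-1) <= m.+2`!%:R * y ^+ 2.
Proof.
move=> y0; have yi : 0 <= y^-1 by rewrite invr_ge0 ltW.
have := expR_ge1Dxn m.+1 yi; have f0 : 0 < (m.+2`!%:R : R) by rewrite ltr0n fact_gt0.
have e0 := expR_gt0 y^-1 => h.
rewrite expRN ler_pdivrMr// -ler_pdivrMl// ?mulr_gt0 ?exprn_gt0//.
apply: le_trans (_ : y^-1 ^+ m.+2 / m.+2`!%:R <= _); last by apply: le_trans h; lra.
rewrite le_eqVlt; apply/orP; left; apply/eqP; rewrite !exprS; field.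
by rewrite !gt_eqF.
Qed.

Lemma poly_bnd01 q : exists2 M : R, 0 <= M & forall x, 0 < x < 1 -> `|q.[x]| <= M.
Proof.
have cp : {within `[0, 1], continuous (fun x : R => `|q.[x]|)}.
  apply: continuous_in_subspaceT => x _.
  have cx := is_derive1_cont (is_derive_poly q x).
  by apply: continuous_comp cx _; exact: norm_continuous.
have [c _ cmax] := EVT_max ler01 cp.
exists `|q.[c]| => // x /andP[x0 x1]; apply: cmax.
by rewrite in_itv/= !ltW.
Qed.

(** For [x] outside (0,1) and [z] inside, [z (1 - z) <= |z - x|]. Quadratic decay makes the
    derivative 0 at the ends and beyond, whatever the pole order [m]. *)
Lemma bumpf_quadratic q m x : ~~ (0 < x < 1) ->
  exists K : R, forall z, `|bumpf q m z| <= K * (z - x) ^+ 2.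
Proof.
move=> x01; have [M M0 qM] := poly_bnd01 q.
exists (M * m.+2`!%:R) => z; rewrite /bumpf; case: ifPn => [z01|_]; last first.
  by rewrite normr0 mulr_ge0 ?sqr_ge0// mulr_ge0// ler0n.
have /andP[z0 z1] := z01; have y0 : 0 < z * (1 - z) by rewrite mulr_gt0 ?subr_gt0.
rewrite normrM -mulrA; apply: ler_pM => //; first exact: qM.
rewrite ger0_norm; last by rewrite mulr_ge0 ?expR_ge0// exprn_ge0// invr_ge0 ltW.
apply: le_trans (expRN_inv_le m y0) _; apply: ler_wpM2l; first exact: ler0n.
have : z * (1 - z) <= `|z - x|.
  move: x01; rewrite negb_and -!leNgt => /orP[xl|xr].
    by rewrite ger0_norm; nra.
  by rewrite ler0_norm; nra.
move=> h; rewrite -[leRHS]ger0_norm ?sqr_ge0// normrX.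
by rewrite lerXn2r ?nnegrE ?(ltW y0).
Qed.

(* The functions [bumpf q m] are closed under differentiation, hence smooth:
   the derivative of [bumpf q m] is [bumpf (bumpd q m) m.+2]. *)
Definition bumpd q (m : nat) : {poly R} :=
  q^`() * ('X * (1 - 'X)) ^+ 2 + (1 - 'X *+ 2) * q * (1 - ('X * (1 - 'X)) *+ m).

Lemma bumpdE q m x : (bumpd q m).[x] = q^`().[x] * (x * (1 - x)) ^+ 2 +
  (1 - x *+ 2) * q.[x] * (1 - (x * (1 - x)) *+ m).
Proof.
by rewrite /bumpd expr2 !(hornerM, hornerD, hornerN, hornerMn, hornerX, hornerC) expr2.
Qed.

Lemma is_derive_bumpf q m x : is_derive x 1 (bumpf q m) (bumpf (bumpd q m) m.+2 x).
Proof.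
have [x01|x01] := boolP (0 < x < 1); last first.
  have [K hK] := bumpf_quadratic q m x01.
  rewrite [X in is_derive _ _ _ X]/bumpf (negbTE x01).
  by apply: (is_derive1_quadratic _ hK); rewrite /bumpf (negbTE x01).
have /andP[x0 x1] := x01.
have y0 : 0 < x * (1 - x) by rewrite mulr_gt0 ?subr_gt0.
have yn : x * (1 - x) != 0 by rewrite gt_eqF.
have dy : is_derive x 1 (fun z : R => z * (1 - z)) (1 - x *+ 2).
  have hi : is_derive x 1 (fun z : R => z) 1 by exact: is_derive_id.
  by apply: is_derive_eq (is_derive1M hi (is_derive1_onem x)) _; ring.
have dyi := @is_deriveV R (fun z => z * (1 - z)) x _ 1 yn dy.
have dm : is_derive x 1 (fun z : R => (z * (1 - z))^-1 ^+ m)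
    (- (m%:R * (1 - x *+ 2) * (x * (1 - x))^-1 ^+ m.+1)).
  apply: is_derive_eq (is_derive1X m dyi) _.
  rewrite /GRing.scale/= -exprVn; case: m => [|m]; first by rewrite !mul0r oppr0.
  by rewrite /= !exprS; ring.
have dn : is_derive x 1 (fun z : R => - (z * (1 - z))^-1)
    ((1 - x *+ 2) * (x * (1 - x))^-1 ^+ 2).
  apply: is_derive_eq (@is_deriveN _ _ _ (fun z : R => (z * (1 - z))^-1) x 1 _ dyi) _.
  by rewrite /GRing.scale/= -exprVn; ring.
have de : is_derive x 1 (fun z : R => expR (- (z * (1 - z))^-1))
    (expR (- (x * (1 - x))^-1) * ((1 - x *+ 2) * (x * (1 - x))^-1 ^+ 2)).
  exact: (@is_derive1_comp _ (@expR R) (fun z => - (z * (1 - z))^-1) x _ _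
    (is_derive_expR _) dn).
have df := is_derive1M (is_derive_poly q x) (is_derive1M dm de).
apply: (@near_eq_is_derive _ _ _ (fun z => q.[z] * ((z * (1 - z))^-1 ^+ m *
    expR (- (z * (1 - z))^-1)))).
  apply: filterS2 (lt_nbhsr x0) (lt_nbhsl x1) => z z0 z1.
  by rewrite /bumpf z0 z1.
apply: is_derive_eq df _; rewrite /bumpf x01 bumpdE.
rewrite -(mulr_natl _ m) -(mulr_natl x 2) (exprS _ m) (exprS _ m.+1) (exprS _ m).
move: (expR _) => E; move: yn; set P := _ ^+ m; move: P; set y := x * (1 - x) => P yn'.
by field.
Qed.

(** The prefactor [k] absorbs the [e^-1] that each differentiation of a rescaled function
    produces. *)
Definition bumps (k : R) q (m : nat) c e x : R := k * bumpf q m ((x - c) / e).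

Lemma is_derive_rescale (f : R -> R) (df c e x : R) :
  is_derive ((x - c) / e) 1 f df -> is_derive x 1 (fun y => f ((y - c) / e)) (df / e).
Proof.
move=> hf; have hi : is_derive x 1 (fun y : R => y) 1 by exact: is_derive_id.
have hc (r : R) : is_derive x 1 (fun=> r : R) 0 by exact: is_derive_cst.
have h : is_derive x 1 (fun y : R => (y - c) / e) e^-1.
  by apply: is_derive_eq (is_derive1M (is_derive1B hi (hc c)) (hc e^-1)) _; ring.
exact: (@is_derive1_comp _ f (fun y => (y - c) / e) x _ _ hf h).
Qed.

Lemma is_derive_bumps k q m c e x :
  is_derive x 1 (bumps k q m c e) (bumps (k / e) (bumpd q m) m.+2 c e x).
Proof.
have hc (r : R) : is_derive x 1 (fun=> r : R) 0 by exact: is_derive_cst.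
have h := is_derive_rescale (is_derive_bumpf q m ((x - c) / e)).
apply: is_derive_eq (is_derive1M (hc k) h) _.
by rewrite /bumps; ring.
Qed.

Lemma derive1_bumps k q m c e :
  derive1 (bumps k q m c e) = bumps (k / e) (bumpd q m) m.+2 c e.
Proof.
by apply/funext => x; rewrite derive1E; have [] := is_derive_bumps k q m c e x.
Qed.

Fixpoint bumpn (n : nat) (a : R * {poly R} * nat) e : R * {poly R} * nat :=
  if n is n'.+1 then let a' := bumpn n' a e in
    (a'.1.1 / e, bumpd a'.1.2 a'.2, a'.2.+2) else a.

Lemma derive1n_bumps n k q m c e : let a := bumpn n (k, q, m) e in
  derive1n n (bumps k q m c e) = bumps a.1.1 a.1.2 a.2 c e.
Proof.
elim: n => [//|n IH]; rewrite derive1nS IH.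
exact: derive1_bumps.
Qed.

Lemma bumps_out k q m c e x : 0 < e -> ~ (c <= x <= c + e) -> bumps k q m c e x = 0.
Proof.
move=> e0 nx; rewrite /bumps /bumpf; case: ifPn => [/andP[h0 h1]|]; last by rewrite mulr0.
exfalso; apply: nx; move: h0 h1; rewrite ltr_pdivrMr// ltr_pdivlMr//.
by move=> h0 h1; apply/andP; split; lra.
Qed.

Lemma test_bumps k q m c e : 0 < c -> 0 < e -> c + e < 1 ->
  test_function (bumps k q m c e).
Proof.
move=> c0 e0 ce; split.
  by move=> n x; rewrite derive1n_bumps; have [] := is_derive_bumps
    (bumpn n (k, q, m) e).1.1 (bumpn n (k, q, m) e).1.2 (bumpn n (k, q, m) e).2 c e x.
by exists c, (c + e); split=> // x; exact: bumps_out.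
Qed.

Definition bump : R -> R := bumpf 1 0.

Lemma bump_ge0 x : 0 <= bump x.
Proof.
rewrite /bump /bumpf; case: ifP => // _.
by rewrite hornerC expr0 !mul1r expR_ge0.
Qed.

Lemma bump_le1 x : bump x <= 1.
Proof.
rewrite /bump /bumpf; case: ifP => [/andP[x0 x1]|_]; last by [].
rewrite hornerC expr0 !mul1r -[leRHS]expR0 ler_expR oppr_le0 invr_ge0.
by rewrite mulr_ge0// ltW// subr_gt0.
Qed.

Lemma bump_out x : ~~ (0 < x < 1) -> bump x = 0.
Proof. by rewrite /bump /bumpf => /negbTE ->. Qed.

Lemma bump_cont x : {for x, continuous bump}.
Proof. exact: is_derive1_cont (is_derive_bumpf 1 0 x). Qed.

Lemma bump_intg : intg setT bump.
Proof.
apply: (@intg_le _ _ _ (\1_(`[0, 1]%classic : set R))) => //.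
- by apply: open_continuous_measurable_fun; [exact: openT|move=> x _; exact: bump_cont].
- move=> x _; rewrite ger0_norm ?bump_ge0// indicE.
  case: (boolP (x \in _)) => h; first exact: bump_le1.
  rewrite bump_out//; apply: contra h => /andP[x0 x1].
  by rewrite inE/= in_itv/= !ltW.
- exact: (@integrable_indic_itv R 0 1 true false).
Qed.

Definition bumpI x : R := It `]-oo, x] bump.

Lemma bumpI_intg x : intg `]-oo, x] bump.
Proof. by apply: intgS bump_intg. Qed.

Lemma is_derive_bumpI x : is_derive x 1 bumpI (bump x).
Proof.
have x1 : x < x + 1 by lra.
have xoo : ((-oo)%O < BRight x)%E by rewrite ltNyr.
have [d dE] := @continuous_FTC1 R bump -oo%O x (x + 1) x1 (bumpI_intg _) xoo (@bump_cont x).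
by split; [exact: d|rewrite -derive1E; exact: dE].
Qed.

Lemma bumpI_le0 x : x <= 0 -> bumpI x = 0.
Proof.
move=> x0; rewrite /bumpI (@eq_It _ _ _ (fun=> 0 * 0)) => [|y].
  by rewrite /It Rintegral_cst// !mul0r.
rewrite /= in_itv/= => yx; rewrite bump_out ?mul0r// negb_and -!leNgt.
by rewrite (le_trans yx).
Qed.

Lemma bumpI_ge1 x : 1 <= x -> bumpI x = bumpI 1.
Proof.
move=> x1; apply/eqP; rewrite -subr_eq0 /bumpI /It.
rewrite (@Rintegral_itvB R bump -oo%O (BRight x) 1 (bumpI_intg x)) ?bnd_simp//.
apply/eqP; rewrite -[LHS]/(It _ _) (@eq_It _ _ _ (fun=> 0 * 0)) => [|y].
  by rewrite /It Rintegral_cst// !mul0r.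
rewrite /= in_itv/= => /andP[y1 _]; rewrite bump_out ?mul0r// negb_and -!leNgt.
by rewrite (ltW y1) orbT.
Qed.

Lemma bumpI_ge0 x : 0 <= bumpI x.
Proof. by apply: It_ge0 => y _; exact: bump_ge0. Qed.

Lemma bumpI_le x : bumpI x <= bumpI 1.
Proof.
have [x1|x1] := leP 1 x; first by rewrite bumpI_ge1.
apply: It_subset => //; [|exact: bumpI_intg|by move=> y _; exact: bump_ge0].
by apply: subset_itvl; rewrite bnd_simp ltW.
Qed.

Lemma bumpI1_gt0 : 0 < bumpI 1.
Proof.
(* 3/16 is the minimum of [x (1 - x)] on [[1/4, 3/4]]. *)
pose k : R := expR (- (3 / 16)^-1).
have h : It `[4^-1, 3 / 4] (fun=> k) <= bumpI 1.
  apply: (@le_trans _ _ (It `[4^-1, 3 / 4] bump)).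
    apply: le_It => //.
    - by apply: intg_cont_in => x _; exact: cst_continuous.
    - by apply: intgS bump_intg.
    - move=> x; rewrite /= in_itv/= => /andP[x0 x1].
      rewrite /bump /bumpf ifT; last by apply/andP; split; lra.
      have p : 0 <= (x - 4^-1) * (3 / 4 - x) by apply: mulr_ge0; lra.
      rewrite hornerC expr0 !mul1r /k ler_expR lerN2 lef_pV2 ?posrE; lra.
  apply: It_subset => //; [|exact: bumpI_intg|by move=> y _; exact: bump_ge0].
  move=> x; rewrite /= !in_itv/=; lra.
apply: lt_le_trans h; rewrite It_cst; last by lra.
by rewrite mulr_gt0 ?expR_gt0//; lra.
Qed.

(** For small [e], approximately [bumpI 1] times the indicator of [[c, d]], with ramps on
    [[c, c + e]] and [[d, d + e]]. Both ramps lie to the right of their base point, hence the use of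
    right-sided Lebesgue points. *)
Definition plateau c d e x : R := bumpI ((x - c) / e) - bumpI ((x - d) / e).

Lemma is_derive_plateau c d e x : is_derive x 1 (plateau c d e)
  (bumps e^-1 1 0 c e x - bumps e^-1 1 0 d e x).
Proof.
have h1 := is_derive_rescale (is_derive_bumpI ((x - c) / e)).
have h2 := is_derive_rescale (is_derive_bumpI ((x - d) / e)).
apply: is_derive_eq (is_derive1B h1 h2) _.
by rewrite /bumps /bump !(mulrC e^-1).
Qed.

Lemma derive1_plateau c d e : derive1 (plateau c d e) =
  (fun x => bumps e^-1 1 0 c e x - bumps e^-1 1 0 d e x).
Proof.
by apply/funext => x; rewrite derive1E; have [] := is_derive_plateau c d e x.
Qed.

Lemma test_plateau c d e : 0 < c -> c <= d -> 0 < e -> d + e < 1 ->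
  test_function (plateau c d e).
Proof.
move=> c0 cd e0 de; split.
  have key n : let a := bumpn n (e^-1, 1, 0%N) e in
      derive1n n.+1 (plateau c d e) =
      (fun x => bumps a.1.1 a.1.2 a.2 c e x - bumps a.1.1 a.1.2 a.2 d e x).
    elim: n => [|n IH]; first exact: derive1_plateau.
    rewrite derive1nS IH; apply/funext => x; rewrite derive1E.
    by have [] := is_derive1B (is_derive_bumps (bumpn n (e^-1, 1, 0%N) e).1.1
      (bumpn n (e^-1, 1, 0%N) e).1.2 (bumpn n (e^-1, 1, 0%N) e).2 c e x)
      (is_derive_bumps (bumpn n (e^-1, 1, 0%N) e).1.1
      (bumpn n (e^-1, 1, 0%N) e).1.2 (bumpn n (e^-1, 1, 0%N) e).2 d e x).
  case=> [|n] x; first by have [] := is_derive_plateau c d e x.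
  rewrite key.
  by have [] := is_derive1B (is_derive_bumps (bumpn n (e^-1, 1, 0%N) e).1.1
      (bumpn n (e^-1, 1, 0%N) e).1.2 (bumpn n (e^-1, 1, 0%N) e).2 c e x)
      (is_derive_bumps (bumpn n (e^-1, 1, 0%N) e).1.1
      (bumpn n (e^-1, 1, 0%N) e).1.2 (bumpn n (e^-1, 1, 0%N) e).2 d e x).
exists c, (d + e); split=> // x nx; rewrite /plateau.
have [xc|xc] := ltP x c.
  rewrite !bumpI_le0 ?subrr// ler_pdivrMr// mul0r; lra.
have dx : d + e < x by rewrite ltNge; apply/negP => xd; apply: nx; rewrite xc.
by rewrite (bumpI_ge1 (x := (x - c) / e)) ?(bumpI_ge1 (x := (x - d) / e)) ?subrr//
  ler_pdivlMr//; lra.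
Qed.

End Bump.

(** * Lebesgue points and mollification *)

Section LebesguePoints.
Context {R : realType}.
Local Notation mu := (@lebesgue_measure R).
Local Notation I := (@intJ R).
Implicit Types (u g h : R -> R).

Let mI : measurable I := @measurable_intJ R.

Lemma locint_cc u (a b : R) : locally_integrable I u -> 0 < a -> b < 1 ->
  intg `[a, b] u.
Proof.
move=> [mu_ _ ku] a0 b1; have sub := sub_cc_I a0 b1.
apply/integrableP; split.
  by apply/measurable_EFinP; apply: measurable_funS mu_.
by apply: ku => //; exact: segment_compact.
Qed.

(* Right-sided Lebesgue points, stated without division. *)
Definition lebpt u (c : R) : Prop := forall e : R, 0 < e ->
  exists2 d : R, 0 < d & forall r, 0 < r < d ->
    It `[c, c + r] (fun x => `|u x - u c|) <= e * r.

Lemma lebesgue_pt_lebpt u (a b c : R) : 0 < a -> b < 1 -> a < c < b ->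
  intg `[a, b] u -> lebesgue_pt (u \_ `[a, b]) c -> lebpt u c.
Proof.
move=> a0 b1 /andP[ac cb] ui; set f := u \_ `[a, b] => Lf e e0.
have fi : intg setT f.
  by rewrite /intg /f -restrict_EFin; apply/integrable_restrict => //; rewrite setTI.
have fE x : a <= x <= b -> f x = u x.
  by move=> xab; rewrite /f patchE mem_set//= in_itv.
have mB (r : R) : measurable (ball c r : set R) by exact: measurable_ball.
have ki (r : R) : 0 < r -> intg (ball c r) (fun x => `|f x - f c|).
  move=> r0; apply: intg_norm => //; apply: intgB => //.
    by apply: intgS fi.
  rewrite ball_itv; apply: (@intgS _ `[c - r, c + r]) => //.
    by apply: subset_itv; rewrite bnd_simp.
  by apply: intg_cont_in => x _; exact: cst_continuous.
have dE (r : R) : 0 < r ->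
    davg f c r = ((r *+ 2)^-1 * It (ball c r) (fun x => `|f x - f c|))%:E.
  move=> r0; rewrite /davg /iavg lebesgue_measure_ball ?ltW// inver.
  by rewrite mulrn_eq0/= (gt_eqF r0) EFinM -ItE//; exact: ki.
move: Lf; rewrite /lebesgue_pt => /fine_cvgP[_ /cvgrPdist_lt].
(* Lebesgue points are defined by centred balls. [[c, c + r]] lies in the open ball of radius [2 r],
   of measure [4 r], so an average below [e / 4] gives [e * r]. *)
have e4 : 0 < e / 4 by rewrite divr_gt0.
move=> /(_ _ e4) [d /= d0 hd].
pose m := Num.min (d / 2) (Num.min (c - a) (b - c)).
have m0 : 0 < m by rewrite !lt_min !subr_gt0 ac cb divr_gt0.
exists m => // r /andP[r0 rm].
have rd : r < d / 2 by move: rm; rewrite lt_min => /andP[].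
have rb : r < b - c by move: rm; rewrite !lt_min => /andP[_ /andP[]].
have r20 : 0 < r * 2 by lra.
have := hd (r * 2); rewrite /= sub0r normrN gtr0_norm// => /(_ _ r20).
rewrite dE//= sub0r normrN => H.
have {H} : `|(r * 2 *+ 2)^-1 * It (ball c (r * 2)) (fun x => `|f x - f c|)| < e / 4.
  by apply: H; lra.
rewrite ger0_norm; last first.
  by rewrite mulr_ge0 ?It_ge0// invr_ge0 mulrn_wge0// ltW.
rewrite mulrC ltr_pdivrMr ?mulrn_wgt0// => H.
have c1 : a <= c <= b by rewrite !ltW.
apply: (@le_trans _ _ (It (ball c (r * 2)) (fun x => `|f x - f c|))); last first.
  by apply: le_trans (ltW H) _; rewrite mulr2n; lra.
rewrite (@eq_It _ _ _ (fun x => `|f x - f c|)); last first.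
  move=> x; rewrite /= in_itv/= => /andP[cx xr]; rewrite !fE//.
  by apply/andP; split; lra.
apply: It_subset => //; last exact: ki.
move=> x; rewrite /ball/= in_itv/= => /andP[cx xr].
by rewrite ler0_norm; lra.
Qed.

(** The differentiation theorem is applied to the cut-offs of [u] to countably many compact
    intervals exhausting (0,1). *)
Lemma ae_lebpt u : locally_integrable I u -> {ae mu, forall x, I x -> lebpt u x}.
Proof.
move=> lu.
pose a (n : nat) : R := n.+2%:R^-1; pose b n := 1 - a n.
have a0 n : 0 < a n by rewrite /a invr_gt0.
have b1 n : b n < 1 by rewrite /b ltrBlDr ltrDl.
have h n : {ae mu, forall x, a n < x < b n -> lebpt u x}.
  have ui := locint_cc lu (a0 n) (b1 n).
  have mA : measurable (`[a n, b n]%classic : set R) by exact: measurable_itv.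
  have := lebesgue_differentiation (integrable_locally_restrict mA ui).
  apply: filterS; first exact: (ae_filter_ringOfSetsType mu).
move=> x Lx xab; exact: lebesgue_pt_lebpt (a0 n) (b1 n) xab ui Lx.
have := negligible_bigcup h; apply: negligibleS => x /= nP.
apply: contrapT => nU; apply: nP => /intJP/andP[x0 x1].
have hx n : a n < x < b n -> lebpt u x.
  by move=> xn; apply: contrapT => nL; apply: nU; exists n => //= /(_ xn).
pose d := Num.min x (1 - x); have d0 : 0 < d by rewrite lt_min x0 subr_gt0.
have di0 : 0 <= d^-1 by rewrite invr_ge0 ltW.
have ha : a (Num.bound d^-1) < d.
  rewrite /a -[ltRHS]invrK ltf_pV2 ?posrE ?invr_gt0//.
  by apply: lt_le_trans (archi_boundP di0) _; rewrite ler_nat -addn2 leq_addr.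
apply: (hx (Num.bound d^-1)).
move: ha; rewrite /b /d lt_min => /andP[h1 h2]; apply/andP; split; lra.
Qed.

Lemma ae_intJ_ex (P : R -> Prop) : {ae mu, forall x, I x -> P x} ->
  forall c d : R, 0 <= c -> c < d -> d <= 1 -> exists2 x, c < x < d & P x.
Proof.
move=> [N [mN N0 sub]] c d c0 cd d1; apply: contrapT => nex.
have : (mu `]c, d[ <= mu N)%E.
  apply: le_measure; rewrite ?inE//; apply: subset_trans sub => x /= xcd Px.
  apply: nex; exists x; first by move: xcd; rewrite in_itv.
  apply: Px; move: xcd; rewrite /intJ/= !in_itv/= => /andP[cx xd].
  by rewrite (le_lt_trans c0 cx) (lt_le_trans xd d1).
rewrite N0 lebesgue_measure_itv/= lte_fin cd -EFinD lee_fin; lra.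
Qed.

(** The kernel lives on [[c, c + r]], is at most [r^-1] and has integral [bumpI 1], so the error is
    at most [r^-1] times the integral of [|u x - u c|]. *)
Lemma mollify u (c e : R) : locally_integrable I u -> 0 < c < 1 -> lebpt u c ->
  0 < e -> exists2 d : R, 0 < d & forall r, 0 < r < d ->
    `|It I (fun x => u x * bumps r^-1 1 0 c r x) - u c * bumpI 1| <= e.
Proof.
move=> lu /andP[c0 c1] Lc e0; have [d d0 hd] := Lc e e0.
pose m := Num.min d (1 - c).
have m0 : 0 < m by rewrite lt_min d0 subr_gt0.
exists m => // r /andP[r0]; rewrite lt_min => /andP[rd rc].
have cr1 : c + r < 1 by lra.
have ccr : c <= c + r by lra.
have ui := locint_cc lu c0 cr1.
pose k := bumps r^-1 1 0 c r.
have kc x : {for x, continuous k} by exact: is_derive1_cont (is_derive_bumps _ _ _ _ _ _).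
have acE : acpair (fun x => bumpI ((x - c) / r)) k.
  have dE (x : R) : is_derive x 1 (fun y => bumpI ((y - c) / r)) (k x).
    have h := @is_derive_rescale R bumpI _ c r x (is_derive_bumpI ((x - c) / r)).
    apply: is_derive_eq h _.
    by rewrite /k /bumps mulrC.
  by apply: acpair_C1 => x _.
have [ki EK] := acE c (c + r) c0 ccr cr1.
have {}EK : It `[c, c + r] k = bumpI 1.
  rewrite -EK subrr mul0r (bumpI_le0 (lexx 0)) subr0.
  by rewrite (_ : (c + r - c) / r = 1)//; field; rewrite gt_eqF.
have k_le x : `|k x| <= r^-1.
  have ri : 0 < r^-1 by rewrite invr_gt0.
  rewrite /k /bumps -/bump normrM (gtr0_norm ri) -[leRHS]mulr1 ler_pM2l//.
  by rewrite ger0_norm ?bump_ge0 ?bump_le1.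
have out x : I x -> ~ `[c, c + r]%classic x -> u x * k x = 0.
  move=> _; rewrite /= in_itv/= => /negP nx.
  by rewrite /k bumps_out ?mulr0//; exact/negP.
have uki : intg `[c, c + r] (fun x => u x * k x).
  apply: (@intg_le _ _ _ (fun x => r^-1 * `|u x|)) => //; last exact/intgZ/intg_norm.
    by apply: measurable_funM; [exact: intg_meas ui|exact: intg_meas ki].
  by move=> x _; rewrite normrM mulrC ler_wpM2r.
have -> : It I (fun x => u x * k x) = It `[c, c + r] (fun x => u x * k x).
  rewrite /It -(setIidr (sub_cc_I c0 cr1)) Rintegral_mkcondr.
  apply: eq_It => x Ix; rewrite patchE; case: ifPn => //.
  by rewrite notin_setE => /(out _ Ix).
rewrite -EK -ItZ// -ItB//; last exact: intgZ.
have uci : intg `[c, c + r] (fun=> u c).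
  by apply: intg_cont_in => x _; exact: cst_continuous.
have di : intg `[c, c + r] (fun x => `|u x - u c|) by apply: intg_norm => //; exact: intgB.
apply: le_trans (It_abs _ _) _ => //; first by apply: intgB => //; exact: intgZ.
apply: (@le_trans _ _ (It `[c, c + r] (fun x => r^-1 * `|u x - u c|))).
  apply: le_It => //.
  - by apply: intg_norm => //; apply: intgB => //; exact: intgZ.
  - exact: intgZ.
  - by move=> x _; rewrite -mulrBl normrM mulrC ler_wpM2r.
rewrite ItZ// mulrC ler_pdivrMr//; apply: hd; by rewrite r0.
Qed.

(** Fundamental lemma of the calculus of variations: at a Lebesgue point, [mollify] compares
    [h c * bumpI 1] with a test integral, which is 0. *)
Lemma ae_zero_of_test h : locally_integrable I h ->
  (forall phi, test_function phi -> It I (fun x => h x * phi x) = 0) ->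
  {ae mu, forall x, I x -> h x = 0}.
Proof.
move=> lh h0; have := ae_lebpt lh; apply: filterS; first exact: (ae_filter_ringOfSetsType mu).
move=> c Lc Ic.
have /intJP/andP[c0 c1] := Ic; have {}Lc := Lc Ic.
suff : h c * bumpI 1 = 0.
  by move/eqP; rewrite mulf_eq0 (gt_eqF bumpI1_gt0) orbF => /eqP.
apply/eqP; rewrite -normr_le0; apply/ler_addgt0Pr => e e0; rewrite add0r.
have c01 : 0 < c < 1 by rewrite c0.
have [d d0 hd] := mollify lh c01 Lc e0.
pose r := Num.min (d / 2) ((1 - c) / 2).
have r0 : 0 < r by rewrite lt_min !divr_gt0// subr_gt0.
have rd : r <= d / 2 by rewrite ge_min lexx.
have rc : r <= (1 - c) / 2 by rewrite ge_min lexx orbT.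
have := hd r; rewrite h0; last by apply: test_bumps => //; lra.
by rewrite sub0r normrN; apply; rewrite r0; lra.
Qed.

End LebesguePoints.

(** * From absolute continuity to weak derivatives *)

Section WeakDerivatives.
Context {R : realType}.
Local Notation mu := (@lebesgue_measure R).
Local Notation I := (@intJ R).
Implicit Types (u g h U : R -> R).

Let mI : measurable I := @measurable_intJ R.

Definition aeq u h : Prop := {ae mu, forall x, I x -> u x = h x}.

Lemma aeq_mp (P Q : R -> Prop) : {ae mu, forall x, I x -> P x} ->
  (forall x, I x -> P x -> Q x) -> {ae mu, forall x, I x -> Q x}.
Proof. by move=> aP PQ; apply: negligibleS aP => x /= nQ hP; apply: nQ => Ix; auto. Qed.

Lemma aeq_and (P Q : R -> Prop) : {ae mu, forall x, I x -> P x} ->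
  {ae mu, forall x, I x -> Q x} -> {ae mu, forall x, I x -> P x /\ Q x}.
Proof.
move=> aP aQ; have := negligibleU aP aQ; apply: negligibleS => x /= nPQ.
apply: contrapT => /not_orP[/contrapT hP /contrapT hQ].
by apply: nPQ => Ix; split; auto.
Qed.

Lemma aeW_intJ (P : R -> Prop) : (forall x, I x -> P x) -> {ae mu, forall x, I x -> P x}.
Proof. by move=> hP; apply: aeW => x; exact: hP. Qed.

Lemma aeq_sym u h : aeq u h -> aeq h u.
Proof. by move=> uh; apply: aeq_mp uh _ => x _ ->. Qed.

Lemma aeq_trans u h g : aeq u h -> aeq h g -> aeq u g.
Proof. by move=> uh hg; apply: aeq_mp (aeq_and uh hg) _ => x _ [-> ->]. Qed.

Lemma aeq_It A u h : measurable A -> A `<=` I -> measurable_fun I u ->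
  measurable_fun I h -> aeq u h -> intg A u -> intg A h /\ It A u = It A h.
Proof.
move=> mA AI mu_ mh uh ui.
have mu' := measurable_funS mI AI mu_; have mh' := measurable_funS mI AI mh.
have eqE : (\int[mu]_(x in A) (u x)%:E = \int[mu]_(x in A) (h x)%:E)%E.
  apply: ae_eq_integral => //; try exact/measurable_EFinP.
  by apply: negligibleS uh => x /= nuh uh; apply: nuh => /AI /uh ->.
have eqN : (\int[mu]_(x in A) `|(u x)%:E| = \int[mu]_(x in A) `|(h x)%:E|)%E.
  apply: ae_eq_integral => //; try by apply/measurable_EFinP/measurableT_comp.
  by apply: negligibleS uh => x /= nuh uh; apply: nuh => /AI /uh ->.
split; last by rewrite /It /Rintegral eqE.
move: ui => /integrableP[_ uf]; apply/integrableP; split.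
  exact/measurable_EFinP.
by rewrite -eqN.
Qed.

Lemma compact_intJ (K : set R) : K `<=` I -> compact K ->
  exists a b : R, [/\ 0 < a, b < 1 & K `<=` `[a, b]].
Proof.
move=> KI cK; have [->|/set0P K0] := eqVneq K set0.
  by exists 2^-1, 2^-1; split; [rewrite invr_gt0|lra|].
have cid : {within K, continuous (fun x : R => x)}.
  by apply: continuous_in_subspaceT => x _; exact: cvg_id.
have cN : {within K, continuous (fun x : R => - x)}.
  by apply: continuous_in_subspaceT => x _; apply: continuousN; exact: cvg_id.
have [a aK amin] := compact_EVT_min K0 cK cid.
have [b bK bmax] := compact_EVT_min K0 cK cN.
move: aK bK; rewrite !inE => /KI/intJP/andP[a0 _] /KI/intJP/andP[_ b1].
exists a, b; split=> // x Kx; rewrite /= in_itv/=.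
by rewrite amin ?inE// -lerN2 bmax ?inE.
Qed.

Lemma locint_of_cc u : measurable_fun I u ->
  (forall a b : R, 0 < a -> a <= b -> b < 1 -> intg `[a, b] u) ->
  locally_integrable I u.
Proof.
move=> mu_ ui; split=> //.
move=> K KI cK; have [a [b [a0 b1 Kab]]] := compact_intJ KI cK.
have mK : measurable K by exact: compact_measurable.
have uK : intg K u.
  have [ab|ba] := leP a b.
    by apply: intgS Kab (ui a b a0 ab b1).
  have -> : K = set0.
    apply/seteqP; split=> // x /Kab; rewrite /= in_itv/= => /andP[ax xb].
    by have := le_trans ax xb; rewrite leNgt ba.
  exact: integrable_set0.
by move: uK => /integrableP[].
Qed.

Lemma acpair_locint U g : acpair U g -> locally_integrable I U.
Proof.
move=> ac; apply: locint_of_cc; first exact: acpair_meas ac.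
move=> a b a0 ab b1; apply: intg_cont_in => x /andP[ax xb].
by apply: (acpair_cont ac); rewrite (lt_le_trans a0 ax) (le_lt_trans xb b1).
Qed.

Lemma acpair_locint_derivative U g : measurable_fun I g -> acpair U g ->
  locally_integrable I g.
Proof.
move=> mg ac; apply: locint_of_cc => // a b a0 ab b1.
by have [] := ac a b a0 ab b1.
Qed.

Lemma aeq_locint u h : measurable_fun I h -> aeq u h ->
  locally_integrable I u -> locally_integrable I h.
Proof.
move=> mh uh lu; apply: locint_of_cc => // a b a0 ab b1.
have mu_ : measurable_fun I u by case: lu.
by have [] := aeq_It (measurable_itv `[a, b]) (sub_cc_I a0 b1) mu_ mh uh
  (locint_cc lu a0 b1).
Qed.

(** The primitive is based at 1/2, since [g] need not be integrable up to 0. *)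
Lemma prim_exists g : locally_integrable I g -> exists G, acpair G g.
Proof.
move=> lg; pose G x := if 2^-1 <= x then It `[2^-1, x] g else - It `[x, 2^-1] g.
have h0 : 0 < (2^-1 : R) by rewrite invr_gt0.
have h1 : (2^-1 : R) < 1 by lra.
exists G => a b a0 ab b1; split; first exact: locint_cc.
rewrite /G; have [ha|ha] := leP 2^-1 a.
  rewrite (le_trans ha ab) (It_split ha ab); first by ring.
  exact: locint_cc.
have [hb|hb] := leP 2^-1 b.
  rewrite (It_split (ltW ha) hb); first by ring.
  exact: locint_cc.
rewrite (It_split ab (ltW hb)); first by ring.
exact: locint_cc.
Qed.

Lemma It_supp (f : R -> R) (a b : R) : 0 < a -> b < 1 ->
  (forall x, I x -> ~ (a <= x <= b) -> f x = 0) -> It I f = It `[a, b] f.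
Proof.
move=> a0 b1 f0; rewrite [RHS]/It -(setIidr (sub_cc_I a0 b1)) Rintegral_mkcondr.
apply: eq_It => x Ix; rewrite patchE; case: ifPn => //.
by rewrite notin_setE/= in_itv/= => /(f0 _ Ix).
Qed.

Lemma intg_supp (f : R -> R) (a b : R) : measurable_fun I f -> 0 < a -> b < 1 ->
  (forall x, I x -> ~ (a <= x <= b) -> f x = 0) -> intg `[a, b] f -> intg I f.
Proof.
move=> mf a0 b1 f0 fi; rewrite /intg.
have fE x : I x -> (f \_ `[a, b]) x = f x.
  move=> Ix; rewrite patchE; case: ifPn => //.
  by rewrite notin_setE/= in_itv/= => /(f0 _ Ix).
apply: (eq_intg mI fE); rewrite /intg -restrict_EFin; apply/integrable_restrict => //.
by rewrite setIidr//; exact: sub_cc_I.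
Qed.

(** The interval is taken strictly larger than the support, so that [phi] and its derivative vanish
    at its end points too. *)
Lemma test_bounds (phi : R -> R) : test_function phi -> exists a b : R,
  [/\ 0 < a, a <= b, b < 1, forall x, ~ (a < x < b) -> phi x = 0 &
   forall x, ~ (a < x < b) -> derive1 phi x = 0].
Proof.
move=> [sm [a [b [a0 b1 out]]]].
pose c := a / 2; pose d := Num.max ((1 + b) / 2) c.
have c0 : 0 < c by rewrite divr_gt0.
have bd : (1 + b) / 2 <= d by rewrite le_max lexx.
have cd : c <= d by rewrite le_max lexx orbT.
have [ab|ba] := leP a b; last first.
  have z x : phi x = 0.
    by apply: out => /andP[ax xb]; move: (le_trans ax xb); rewrite leNgt ba.
  have h2 : 0 < (2^-1 : R) by rewrite invr_gt0.
  exists 2^-1, 2^-1; split=> //; first by lra.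
  move=> x _; have -> : phi = cst 0 by apply/funext.
  by rewrite derive1_cst.
have c1 : c < a by rewrite /c; lra.
have d1 : d < 1 by rewrite gt_max; apply/andP; split; [lra|rewrite /c; lra].
exists c, d; split=> // x nx; have {nx} : x <= c \/ d <= x.
- by have [xc|xc] := leP x c; [left|right; rewrite leNgt; apply/negP => xd; apply: nx; rewrite xc].
- by move=> [h|h]; apply: out => /andP[h1 h2]; lra.
- by have [xc|xc] := leP x c; [left|right; rewrite leNgt; apply/negP => xd; apply: nx; rewrite xc].
- move=> h; have near0 : \forall y \near x, cst 0 y = phi y.
    case: h => h.
      have xa : x < a by lra.
      apply: filterS (lt_nbhsl xa) => y ya.
      by rewrite out// => /andP[h1 h2]; lra.
    have xa : b < x by lra.
    apply: filterS (lt_nbhsr xa) => y ya.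
    by rewrite out// => /andP[h1 h2]; lra.
  by rewrite derive1E -(near_eq_derive _ near0) -derive1E derive1_cst.
Qed.

Lemma test_derive (phi : R -> R) : test_function phi -> test_function (derive1 phi).
Proof.
move=> tphi; have [a [b [a0 ab b1 _ d0]]] := test_bounds tphi.
case: tphi => sm _; split.
  by move=> n x; rewrite -derive1Sn; exact: sm.
exists a, b; split=> // x nx; apply: d0 => /andP[ax xb]; apply: nx.
by rewrite !ltW.
Qed.

Lemma test_acpair (phi : R -> R) : test_function phi -> acpair phi (derive1 phi).
Proof.
move=> [sm _]; apply: acpair_C1 => x _.
  by split; [exact: (sm 0%N x)|rewrite -derive1E].
by apply: (@is_derive1_cont R _ _ ('D_1 (derive1 phi) x)); split=> //; exact: (sm 1%N x).
Qed.

Lemma test_intg k (phi : R -> R) : locally_integrable I k -> test_function phi ->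
  intg I (fun x => k x * phi x).
Proof.
move=> lk tphi; have acp := test_acpair tphi.
have [a [b [a0 ab b1 p0 _]]] := test_bounds tphi.
have mp := acpair_meas acp; have mk : measurable_fun I k by case: lk.
apply: (intg_supp _ a0 b1).
- exact: measurable_funM.
- by move=> x _ nx; rewrite p0 ?mulr0// => /andP[ax xb]; apply: nx; rewrite !ltW.
- have ki := locint_cc lk a0 b1.
  have cphi : {within `[a, b], continuous (fun x => `|phi x|)}.
    apply: continuous_in_subspaceT => x; rewrite inE => xab.
    have /intJP x01 := sub_cc_I a0 b1 xab.
    have cx := acpair_cont acp x01.
    by apply: continuous_comp cx _; exact: norm_continuous.
  have [c _ cmax] := EVT_max ab cphi.
  apply: (@intg_le _ _ _ (fun x => `|phi c| * `|k x|)) => //; last exact/intgZ/intg_norm.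
    by apply: measurable_funS (measurable_funM mk mp) => //; exact: sub_cc_I.
  move=> x; rewrite /= in_itv/= => xab; rewrite normrM mulrC ler_wpM2r//.
  by apply: cmax; rewrite in_itv.
Qed.

(** The product rule on an interval with [phi] zero at both ends leaves no boundary term. *)
Lemma acpair_weak U g u : acpair U g -> measurable_fun I g ->
  measurable_fun I u -> aeq U u -> is_weak_derivative 1 u g.
Proof.
move=> ac mg mu_ Uu; have lU := acpair_locint ac.
split; [exact: aeq_locint Uu lU|exact: acpair_locint_derivative ac|].
move=> phi tphi; have [a [b [a0 ab b1 p0 d0]]] := test_bounds tphi.
have acp := test_acpair tphi.
have mU := acpair_meas ac; have mp := acpair_meas acp.
have md : measurable_fun I (derive1 phi).
  exact: acpair_meas (test_acpair (test_derive tphi)).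
rewrite expr1 mulN1r -[LHS]/(It I (fun x => u x * derive1 phi x))
  -[X in _ = - X]/(It I (fun x => g x * phi x)).
have nin x : ~ (a <= x <= b) -> ~ (a < x < b).
  by move=> nx /andP[ax xb]; apply: nx; rewrite !ltW.
have Ui := test_intg lU (test_derive tphi).
have gi := test_intg (acpair_locint_derivative mg ac) tphi.
have [_ E2] := aeq_It mI (@subset_refl _ I) (measurable_funM mU md) (measurable_funM mu_ md)
  (aeq_mp Uu (fun x _ e => congr1 (fun z => z * derive1 phi x) e)) Ui.
have {}E2 : It I (fun x => U x * derive1 phi x) = It I (fun x => u x * derive1 phi x).
  exact: E2.
rewrite -{}E2; have [fi E] := acpair_mul ac acp a0 ab b1.
apply/eqP; rewrite -addr_eq0 addrC -ItD//.
rewrite (It_supp a0 b1); last first.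
  by move=> x _ /nin nx; rewrite /= p0// d0// !mulr0 addr0.
rewrite -E !p0 ?mulr0 ?subrr//; by rewrite ltxx ?andbF.
Qed.

End WeakDerivatives.

(** * From weak derivatives to absolutely continuous representatives *)

Section WeakToAC.
Context {R : realType}.
Local Notation mu := (@lebesgue_measure R).
Local Notation I := (@intJ R).
Implicit Types (u g h U : R -> R).

Let mI : measurable I := @measurable_intJ R.

Lemma lebpt_small g (c e : R) : locally_integrable I g -> 0 < c < 1 -> lebpt g c ->
  0 < e -> exists2 d : R, 0 < d & forall r, 0 < r < d ->
    It `[c, c + r] (fun x => `|g x|) <= e.
Proof.
move=> lg /andP[c0 c1] Lc e0; have [d d0 hd] := Lc 1 ltr01.
have G0 : 0 < 1 + `|g c| by rewrite ltr_wpDr.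
pose m := Num.min (Num.min d (1 - c)) (e / (1 + `|g c|)).
exists m; first by rewrite !lt_min d0 subr_gt0 c1 divr_gt0.
move=> r /andP[r0]; rewrite !lt_min => /andP[/andP[rd rc] re].
have cr1 : c + r < 1 by lra.
have ccr : c <= c + r by lra.
have gi := locint_cc lg c0 cr1.
have ci : intg `[c, c + r] (fun=> g c).
  by apply: intg_cont_in => x _; exact: cst_continuous.
have di : intg `[c, c + r] (fun x => `|g x - g c|) by apply: intg_norm => //; exact: intgB.
apply: (@le_trans _ _ (It `[c, c + r] (fun x => `|g x - g c| + `|g c|))).
  apply: le_It => //; first exact: intg_norm.
    by apply: intgD => //; exact: intg_norm.
  by move=> x _; rewrite -{1}(subrK (g c) (g x)) ler_normD.
rewrite ItD//; last exact: intg_norm.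
rewrite It_cst//; have := hd r; rewrite r0 rd => /(_ isT).
by move: re; rewrite ltr_pdivlMr//; lra.
Qed.

(** The test function is [plateau c d r]: its derivative is a difference of two kernels recovering
    [u c] and [u d], while the plateau tends to [Z] times the indicator of [[c, d]] as [r] tends to
    0. *)
Lemma weak_FTC u g (c d : R) : is_weak_derivative 1 u g ->
  0 < c -> c < d -> d < 1 -> lebpt u c -> lebpt u d -> lebpt g c -> lebpt g d ->
  u d - u c = It `[c, d] g.
Proof.
move=> [lu lg wd] c0 cd d1 Luc Lud Lgc Lgd.
have c01 : 0 < c < 1 by rewrite c0 (lt_trans cd).
have d01 : 0 < d < 1 by rewrite d1 (lt_trans c0).
pose Z : R := bumpI 1; have Z0 : 0 < Z by exact: bumpI1_gt0.
suff : (u d - u c - It `[c, d] g) * Z = 0.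
  by move/eqP; rewrite mulf_eq0 (gt_eqF Z0) orbF subr_eq0 => /eqP.
apply/eqP; rewrite -normr_le0; apply/ler_addgt0Pr => e e0; rewrite add0r.
(* Five errors: two mollifications, the ramp at [d] ([T1]), the ramp at [c] ([T2]) and the strip
   [[d, b]] ([T3]). The last three carry a factor at most [Z], hence [e / 5 / Z]. *)
have e5 : 0 < e / 5 by rewrite divr_gt0.
have eZ : 0 < e / 5 / Z by rewrite divr_gt0.
have [r1 r10 h1] := mollify lu c01 Luc e5.
have [r2 r20 h2] := mollify lu d01 Lud e5.
have [r3 r30 h3] := lebpt_small lg c01 Lgc eZ.
have [r4 r40 h4] := lebpt_small lg d01 Lgd eZ.
pose m := Num.min (Num.min (Num.min r1 r2) (Num.min r3 r4)) (1 - d).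
have m0 : 0 < m by rewrite !lt_min r10 r20 r30 r40 subr_gt0.
have [r r0 rm] : exists2 r, 0 < r & r < m by exists (m / 2); lra.
move: rm; rewrite !lt_min => /andP[/andP[/andP[rr1 rr2] /andP[rr3 rr4]] rd].
have dr1 : d + r < 1 by lra.
have := h1 r; rewrite r0 rr1 => /(_ isT) {}h1.
have := h2 r; rewrite r0 rr2 => /(_ isT) {}h2.
have := h3 r; rewrite r0 rr3 => /(_ isT) {}h3.
have := h4 r; rewrite r0 rr4 => /(_ isT) {}h4.
pose b := d + r; have cb : c <= b by rewrite /b; lra.
have cb' : c + r <= b by rewrite /b; lra.
have db : d <= b by rewrite /b; lra.
have d0 := lt_trans c0 cd.
have := wd _ (test_plateau c0 (ltW cd) r0 dr1).
rewrite expr1 mulN1r -[LHS]/(It I (fun x => u x * derive1 (plateau c d r) x))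
  -[X in _ = - X]/(It I (fun x => g x * plateau c d r x)) derive1_plateau.
have gi := locint_cc lg c0 dr1.
have ki (s x : R) : {for x, continuous (bumps r^-1 1 0 s r)}.
  exact: is_derive1_cont (is_derive_bumps _ _ _ _ _ _).
have mk (s : R) : measurable_fun I (bumps r^-1 1 0 s r).
  by apply: cont_meas_intJ => x _; exact: ki.
have mu_ : measurable_fun I u by case: lu.
have uki s : 0 < s -> s + r < 1 -> intg I (fun x => u x * bumps r^-1 1 0 s r x).
  move=> s0 s1; have ssr : s <= s + r by lra.
  apply: (intg_supp _ s0 s1).
  - exact: measurable_funM.
  - by move=> x _ nx; rewrite bumps_out ?mulr0.
  - have us := locint_cc lu s0 s1.
    have ck : {within `[s, s + r], continuous (fun x => `|bumps r^-1 1 0 s r x|)}.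
      apply: continuous_in_subspaceT => x _.
      have cx := ki s x.
      by apply: continuous_comp cx _; exact: norm_continuous.
    have [z _ zmax] := EVT_max ssr ck.
    apply: (@intg_le _ _ _ (fun x => `|bumps r^-1 1 0 s r z| * `|u x|)) => //.
    + by apply: measurable_funS (measurable_funM mu_ (mk s)) => //; exact: sub_cc_I.
    + move=> x; rewrite /= in_itv/= => xs; rewrite normrM mulrC ler_wpM2r//.
      by apply: zmax; rewrite in_itv.
    + exact/intgZ/intg_norm.
have -> : It I (fun x => u x * (bumps r^-1 1 0 c r x - bumps r^-1 1 0 d r x)) =
    It I (fun x => u x * bumps r^-1 1 0 c r x) - It I (fun x => u x * bumps r^-1 1 0 d r x).
  rewrite -ItB; [|exact: mI|by apply: uki; lra|by apply: uki; lra].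
  by apply: eq_It => x _; rewrite mulrBr.
set A := It I (fun x => u x * bumps r^-1 1 0 c r x) in h1 *.
set D := It I (fun x => u x * bumps r^-1 1 0 d r x) in h2 *.
have [_ [a' [b' [_ _ pout]]]] := test_plateau c0 (ltW cd) r0 dr1.
pose P s x := bumpI ((x - s) / r).
have P0 s x : 0 <= P s x by exact: bumpI_ge0.
have PZ s x : P s x <= Z by exact: bumpI_le.
have Pl s x : x <= s -> P s x = 0.
  by move=> xs; rewrite /P bumpI_le0// ler_pdivrMr// mul0r subr_le0.
have Pr s x : s + r <= x -> P s x = Z.
  by move=> xs; rewrite /P bumpI_ge1// ler_pdivlMr// mul1r; lra.
have mP s : measurable_fun I (P s).
  apply: cont_meas_intJ => x _.
  exact: is_derive1_cont (@is_derive_rescale R bumpI _ s r x (is_derive_bumpI _)).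
have mg : measurable_fun I g by case: lg.
have sub (x y : R) : c <= x -> y <= b -> `[x, y] `<=` `[c, b].
  by move=> cx yb; apply: subset_itv; rewrite bnd_simp.
have gPi s : intg `[c, b] (fun x => g x * P s x).
  apply: (@intg_le _ _ _ (fun x => Z * `|g x|)) => //.
  + by apply: measurable_funS (measurable_funM mg (mP s)) => //; exact: sub_cc_I.
  + by move=> x _; rewrite normrM mulrC ler_wpM2r// ger0_norm.
  + exact/intgZ/intg_norm.
have sE : It I (fun x => g x * plateau c d r x) =
    It `[c, b] (fun x => g x * P c x) - It `[c, b] (fun x => g x * P d x).
  rewrite (It_supp c0 dr1) => [|x _ nx].
    by rewrite -ItB//; apply: eq_It => x _; rewrite -mulrBr.
  rewrite /plateau -/(P c x) -/(P d x); have [xc|xc] := leP x c.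
    by rewrite !Pl ?subrr ?mulr0//; lra.
  have xb : b < x by rewrite ltNge; apply/negP => xb; apply: nx; rewrite (ltW xc).
  by rewrite !Pr ?subrr ?mulr0//; move: xb; rewrite /b; lra.
have T1 : `|It `[c, b] (fun x => g x * P d x)| <= e / 5.
  rewrite (It_split (ltW cd) db)// (@eq_It _ `[c, d] _ (fun=> 0)); last first.
    by move=> x; rewrite /= in_itv/= => /andP[_ xd]; rewrite Pl ?mulr0.
  rewrite (It_cst _ (ltW cd)) mul0r add0r.
  have gid : intg `[d, b] (fun x => g x * P d x).
    by apply: intgS (gPi d) => //; exact: sub (ltW cd) (lexx _).
  have gid' : intg `[d, b] g by apply: intgS gi => //; exact: sub (ltW cd) (lexx _).
  apply: le_trans (It_abs _ gid) _ => //.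
  apply: (@le_trans _ _ (It `[d, b] (fun x => Z * `|g x|))).
    apply: le_It => //; [exact: intg_norm|exact/intgZ/intg_norm|].
    by move=> x _; rewrite normrM mulrC ler_wpM2r// ger0_norm.
  rewrite ItZ//; last exact: intg_norm.
  by move: h4; rewrite ler_pdivlMr// mulrC.
have T2 : `|It `[c, b] (fun x => g x * P c x) - Z * It `[c, b] g| <= e / 5.
  rewrite -ItZ// -ItB//; last exact: intgZ.
  have ki' : intg `[c, b] (fun x => g x * P c x - Z * g x).
    by apply: intgB => //; exact: intgZ.
  have ccr : c <= c + r by rewrite lerDl ltW.
  rewrite (It_split ccr cb')// (@eq_It _ `[c + r, b] _ (fun=> 0)); last first.
    by move=> x; rewrite /= in_itv/= => /andP[xd _]; rewrite Pr// mulrC subrr.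
  rewrite It_cst// mul0r addr0.
  have ki2 : intg `[c, c + r] (fun x => g x * P c x - Z * g x).
    by apply: intgS ki' => //; exact: sub (lexx _) cb'.
  have gic : intg `[c, c + r] g by apply: intgS gi => //; exact: sub (lexx _) cb'.
  apply: le_trans (It_abs _ ki2) _ => //.
  apply: (@le_trans _ _ (It `[c, c + r] (fun x => Z * `|g x|))).
    apply: le_It => //; [exact: intg_norm|exact/intgZ/intg_norm|].
    move=> x _; rewrite (mulrC Z) -mulrBr normrM mulrC ler_wpM2r//.
    by rewrite ler0_norm ?subr_le0// opprB lerBlDr lerDl.
  rewrite ItZ//; last exact: intg_norm.
  by move: h3; rewrite ler_pdivlMr// mulrC.
have T3 : `|Z * It `[c, b] g - Z * It `[c, d] g| <= e / 5.
  rewrite (It_split (ltW cd) db)// mulrDr addrAC subrr add0r.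
  have gid' : intg `[d, b] g by apply: intgS gi => //; exact: sub (ltW cd) (lexx _).
  rewrite normrM (gtr0_norm Z0) mulrC -ler_pdivlMr//.
  exact: le_trans (It_abs _ gid') h4.
rewrite sE => E.
set X := It _ (fun x => g x * P c x) in E T2 *.
set Y := It _ (fun x => g x * P d x) in E T1 *.
set Gb := It `[c, b] g in T2 T3 *; set Gd := It `[c, d] g in T3 *.
have -> : (u d - u c - Gd) * Z =
  (A - u c * Z) - (D - u d * Z) + (X - Z * Gb) - Y + (Z * Gb - Z * Gd).
  by rewrite -(subrK D A) E; clearbody X Y Gb Gd D Z; clear; ring.
have -> : e = e / 5 + e / 5 + e / 5 + e / 5 + e / 5 by field.
apply: le_trans (ler_normD _ _) _; apply: lerD T3.
apply: le_trans (ler_normB _ _) _; apply: lerD T1.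
apply: le_trans (ler_normD _ _) _; apply: lerD T2.
apply: le_trans (ler_normB _ _) _; exact: lerD.
Qed.

(** With one common Lebesgue point [c0] of [u] and [g] fixed, [weak_FTC] expresses [u] at every
    other such point through a primitive of [g]. *)
Lemma weak_acpair u g : is_weak_derivative 1 u g -> exists2 U, acpair U g & aeq u U.
Proof.
move=> wd; have [lu lg _] := wd.
have aP := aeq_and (ae_lebpt lu) (ae_lebpt lg).
have [c0 /andP[c00 c01] [Lu Lg]] := ae_intJ_ex aP (lexx 0) ltr01 (lexx 1).
have [G acG] := prim_exists lg.
exists (fun x => u c0 + (G x - G c0)).
  move=> a b a0 ab b1; have [gi <-] := acG a b a0 ab b1.
  by split=> //; ring.
apply: aeq_mp aP _ => x /intJP/andP[x0 x1] [Lux Lgx].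
have [xc|cx|->] := ltgtP x c0; last by rewrite subrr addr0.
  have := weak_FTC wd x0 xc c01 Lux Lu Lgx Lg.
  by have [_ <-] := acG x c0 x0 (ltW xc) c01; lra.
have := weak_FTC wd c00 cx x1 Lu Lux Lg Lgx.
by have [_ <-] := acG c0 x c00 (ltW cx) x1; lra.
Qed.

Lemma ae_eq_of_test g h : locally_integrable I g -> locally_integrable I h ->
  (forall phi, test_function phi ->
    It I (fun x => g x * phi x) = It I (fun x => h x * phi x)) -> aeq g h.
Proof.
move=> lg lh E.
suff : {ae mu, forall x, I x -> g x - h x = 0}.
  by move=> gh; apply: aeq_mp gh _ => x _ /eqP; rewrite subr_eq0 => /eqP.
apply: ae_zero_of_test; first exact: locally_integrableB.
move=> phi tphi.
rewrite (@eq_It _ _ _ (fun x => g x * phi x - h x * phi x)) => [|x _]; last exact: mulrBl.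
rewrite (ItB mI (test_intg lg tphi) (test_intg lh tphi)); apply/eqP; rewrite subr_eq0.
by apply/eqP; exact: E.
Qed.

Lemma weak_derivative1_unique u g h : is_weak_derivative 1 u g ->
  is_weak_derivative 1 u h -> aeq g h.
Proof.
move=> [_ lg wg] [_ lh wh]; apply: ae_eq_of_test => // phi tphi.
by have := wg phi tphi; rewrite (wh phi tphi) expr1 !mulN1r => /oppr_inj.
Qed.

Lemma weak_derivative0_ae u g : is_weak_derivative 0 u g -> aeq u g.
Proof.
move=> [lu lg wg]; apply: ae_eq_of_test => // phi tphi.
by have := wg phi tphi; rewrite expr0 mul1r.
Qed.

(** Order [k] is tested on the derivative of [phi] and order [k + 1] on [phi]; the common sign
    cancels. *)
Lemma weak_derivative_succ k u g h : is_weak_derivative k u g ->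
  is_weak_derivative k.+1 u h -> is_weak_derivative 1 g h.
Proof.
move=> [lu lg wg] [_ lh wh]; split=> // phi tphi.
have := wh phi tphi; rewrite derive1Sn (wg _ (test_derive tphi)) exprSr -mulrA.
by move/mulfI; apply; rewrite expf_neq0// oppr_eq0 oner_eq0.
Qed.

End WeakToAC.

(** * The substitution x = 1 - (1-t)^rho *)

Section ChangeOfVariables.
Context {R : realType}.
Local Notation mu := (@lebesgue_measure R).
Local Notation I := (@intJ R).
Implicit Types (rho t x : R).

(** The inverse on (0,1) is [tau rho^-1], so each result about [tau] also serves for its inverse. *)
Definition tau rho t : R := 1 - (1 - t) `^ rho.

Definition dtau rho t : R := rho * (1 - t) `^ (rho - 1).

Lemma tau_onem rho t : 1 - tau rho t = (1 - t) `^ rho.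
Proof. by rewrite /tau subKr. Qed.

Lemma tau01 rho t : 0 < rho -> 0 < t < 1 -> 0 < tau rho t < 1.
Proof.
move=> r0 /andP[t0 t1]; have h : 0 < 1 - t by lra.
have p0 := powR_gt0 rho h; rewrite /tau.
have : (1 - t) `^ rho < 1 `^ rho.
  by rewrite gt0_ltr_powR// ?nnegrE ?ler01 ?(ltW h)//; lra.
by rewrite powR1; lra.
Qed.

Lemma tauK rho t : 0 < rho -> t < 1 -> tau rho^-1 (tau rho t) = t.
Proof.
move=> r0 t1; rewrite /tau subKr -powRrM mulfV ?gt_eqF// powRr1 ?subKr//; lra.
Qed.

Lemma tauKV rho t : 0 < rho -> t < 1 -> tau rho (tau rho^-1 t) = t.
Proof. by move=> r0; rewrite -{1}(invrK rho); apply: tauK; rewrite invr_gt0. Qed.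

Lemma tau_lt rho s t : 0 < rho -> s < t -> t < 1 -> tau rho s < tau rho t.
Proof.
move=> r0 st t1; rewrite /tau ltrD2l ltrN2.
by apply: gt0_ltr_powR => //; rewrite ?nnegrE; lra.
Qed.

Lemma tau_lt_iff rho s t : 0 < rho -> 0 < s < 1 -> 0 < t < 1 ->
  (tau rho s < tau rho t) = (s < t).
Proof.
move=> r0 /andP[s0 s1] /andP[t0 t1]; apply/idP/idP; last by move=> st; exact: tau_lt.
move=> h; rewrite ltNge le_eqVlt; apply/negP => /orP[/eqP e|ts].
  by move: h; rewrite e ltxx.
by have := lt_trans h (tau_lt r0 ts s1); rewrite ltxx.
Qed.

Lemma dtau_ge0 rho t : 0 < rho -> 0 <= dtau rho t.
Proof. by move=> r0; rewrite mulr_ge0 ?powR_ge0// ltW. Qed.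

Lemma is_derive_tau rho t : t < 1 -> is_derive t 1 (tau rho) (dtau rho t).
Proof.
move=> t1; have t1' : 0 < 1 - t by lra.
have d1 := @is_derive1_comp R (fun y => y `^ rho) (fun y => 1 - y) t _ _
  (is_derive1_powR rho t1') (is_derive1_onem t).
have hc : is_derive t 1 (fun=> 1 : R) 0 by exact: is_derive_cst.
apply: is_derive_eq (is_derive1B hc d1) _.
by rewrite /dtau; ring.
Qed.

Lemma dtau_cont rho t : t < 1 -> {for t, continuous (dtau rho)}.
Proof.
move=> t1; have t1' : 0 < 1 - t by lra.
have d1 := @is_derive1_comp R (fun y => y `^ (rho - 1)) (fun y => 1 - y) t _ _
  (is_derive1_powR (rho - 1) t1') (is_derive1_onem t).
have hc : is_derive t 1 (fun=> rho : R) 0 by exact: is_derive_cst.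
exact: is_derive1_cont (is_derive1M hc d1).
Qed.

Lemma acpair_tau rho : acpair (tau rho) (dtau rho).
Proof.
apply: acpair_C1 => t /andP[_ t1]; first exact: is_derive_tau.
exact: dtau_cont.
Qed.

Lemma measurable_tau rho : measurable_fun setT (tau rho).
Proof.
apply: measurable_funB; first exact: measurable_cst.
apply: (@measurableT_comp _ _ _ _ _ _ (fun y => y `^ rho)); first exact: measurable_powR.
by apply: measurable_funB; [exact: measurable_cst|exact: measurable_id].
Qed.

Lemma measurable_dtau rho : measurable_fun setT (dtau rho).
Proof.
apply: measurable_funM; first exact: measurable_cst.
apply: (@measurableT_comp _ _ _ _ _ _ (fun y => y `^ (rho - 1))).
  exact: measurable_powR.
by apply: measurable_funB; [exact: measurable_cst|exact: measurable_id].
Qed.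

Let mI : measurable I := @measurable_intJ R.

Section FixedExponent.
Variables (rho : R) (rho0 : 0 < rho).

Lemma dtau_intg : intg I (dtau rho).
Proof.
have mt : measurable_fun I (dtau rho) by apply: measurable_funTS; exact: measurable_dtau.
apply: (proj1 (@intg_exhaust R (dtau rho) 1 mt (fun t _ => dtau_ge0 t rho0) _)).
move=> a b a0 ab b1; have [di <-] := acpair_tau rho a0 ab b1; split=> //.
have a01 : 0 < a < 1 by rewrite a0 (le_lt_trans ab).
have b01 : 0 < b < 1 by rewrite b1 (lt_le_trans a0).
by have := tau01 rho0 a01; have := tau01 rho0 b01; lra.
Qed.

Lemma It_tau_ends e : 0 < e -> exists2 d : R, 0 < d &
  (forall t, 0 < t < d -> t < 1 -> tau rho t < e) /\
  (forall t, 1 - d < t < 1 -> 0 < t -> 1 - e < tau rho t).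
Proof.
move=> e0; pose x := Num.min (e / 2) 2^-1.
have x0 : 0 < x by rewrite lt_min divr_gt0//= invr_gt0.
have xe : x <= e / 2 by rewrite ge_min lexx.
have x2 : x <= 2^-1 by rewrite ge_min lexx orbT.
have ri : 0 < rho^-1 by rewrite invr_gt0.
have x01 : 0 < x < 1 by apply/andP; lra.
have y01 : 0 < 1 - x < 1 by apply/andP; lra.
have /andP[s0 s1] := tau01 ri x01; have /andP[r0 r1] := tau01 ri y01.
exists (Num.min (tau rho^-1 x) (1 - tau rho^-1 (1 - x))).
  by rewrite lt_min s0 subr_gt0.
split=> t.
  rewrite lt_min => /andP[t0 /andP[ts _]] t1.
  by have := tau_lt rho0 ts s1; rewrite tauKV//; lra.
move=> /andP[td t1] t0.
have : tau rho^-1 (1 - x) < t.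
  by move: td; rewrite ltrBlDr -ltrBlDl lt_min => /andP[_]; lra.
by move=> /(tau_lt rho0) /(_ t1); rewrite tauKV//; lra.
Qed.

(** [tau] is a primitive of [dtau] only inside (0,1); the constant is found by moving the left end
    towards 0, where both functions tend to 0. *)
Lemma cum_dtau s : 0 < s < 1 -> cum (dtau rho) s = tau rho s.
Proof.
move=> /andP[s0 s1]; have di := dtau_intg.
apply/eqP; rewrite -subr_eq0 -normr_le0; apply/ler_addgt0Pr => e e0; rewrite add0r.
have e2 : 0 < e / 2 by rewrite divr_gt0.
have [d d0 [h1 _]] := It_tau_ends e2.
have [d' d'0 [h2 _]] := cum_small di (fun t _ => dtau_ge0 t rho0) e2.
pose t := Num.min (Num.min (d / 2) (d' / 2)) s.
have t0 : 0 < t by rewrite !lt_min !divr_gt0// s0.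
have td : t <= d / 2 by rewrite !ge_min lexx.
have td' : t <= d' / 2 by rewrite !ge_min lexx orbT.
have ts : t <= s by rewrite !ge_min lexx orbT.
have t1 : t < 1 := le_lt_trans ts s1.
have E : cum (dtau rho) s - tau rho s = cum (dtau rho) t - tau rho t.
  have := cum_It di t0 ts s1; have [_ <-] := acpair_tau rho t0 ts s1; lra.
have k1 : tau rho t < e / 2 by apply: h1 => //; apply/andP; split; lra.
have k2 : cum (dtau rho) t < e / 2 by apply: h2 => //; apply/andP; split; lra.
have k3 : 0 <= cum (dtau rho) t by apply: It_ge0 => x _; exact: dtau_ge0.
have /andP[k4 _] : 0 < tau rho t < 1 by apply: tau01 => //; rewrite t0.
by rewrite E ler_norml; apply/andP; split; lra.
Qed.

Lemma It_dtau : It I (dtau rho) = 1.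
Proof.
have di := dtau_intg.
apply/eqP; rewrite -subr_eq0 -normr_le0; apply/ler_addgt0Pr => e e0; rewrite add0r.
have e2 : 0 < e / 2 by rewrite divr_gt0.
have [d d0 [_ h1]] := It_tau_ends e2.
have [d' d'0 [_ h2]] := cum_small di (fun t _ => dtau_ge0 t rho0) e2.
pose t := Num.max (Num.max (1 - d / 2) (1 - d' / 2)) 2^-1.
have t1 : t < 1 by rewrite !gt_max; apply/andP; split; [apply/andP; split|]; lra.
have td : 1 - d / 2 <= t by rewrite !le_max lexx.
have td' : 1 - d' / 2 <= t by rewrite !le_max lexx orbT.
have t2 : 2^-1 <= t by rewrite !le_max lexx orbT.
have t0 : 0 < t by lra.
have t01 : 0 < t < 1 by rewrite t0.
have k1 : 1 - e / 2 < tau rho t by apply: h1 => //; apply/andP; split; lra.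
have k2 : It `]t, 1[ (dtau rho) < e / 2 by apply: h2 => //; apply/andP; split; lra.
have k3 : 0 <= It `]t, 1[ (dtau rho) by apply: It_ge0 => x _; exact: dtau_ge0.
have /andP[_ k4] := tau01 rho0 t01.
move: k2 k3; rewrite (@cum_tail R (dtau rho) t)// cum_dtau// => k2 k3.
by rewrite ler_norml; apply/andP; split; lra.
Qed.

(* The image under [tau rho] of the measure with density [dtau rho] on (0,1); the
   unused argument lets the measure instance, which needs [0 < rho], be inferred. *)
Definition taum (_ : 0 < rho) (A : set (measurableTypeR R)) : \bar R :=
  (\int[mu]_(t in I `&` tau rho @^-1` A) (dtau rho t)%:E)%E.

Let mpre (A : set (measurableTypeR R)) : measurable A -> measurable (I `&` tau rho @^-1` A).
Proof.
by move=> mA; apply: (measurable_funTS (@measurable_tau rho)).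
Qed.

Let taum0 : taum rho0 set0 = 0%E.
Proof. by rewrite /taum preimage_set0 setI0 integral_set0. Qed.

Let taum_ge0 A : (0 <= taum rho0 A)%E.
Proof. by apply: integral_ge0 => t _; rewrite lee_fin dtau_ge0. Qed.

Let taum_sigma_additive : semi_sigma_additive (taum rho0).
Proof.
move=> /= F mF tF mUF; rewrite /taum; apply: cvg_toP.
  apply: ereal_nondecreasing_is_cvgn => m n mn.
  apply: lee_sum_nneg_natr => // k _ _.
  by apply: integral_ge0 => t _; rewrite lee_fin dtau_ge0.
rewrite preimage_bigcup setI_bigcupr ge0_integral_bigcup//=.
- by move=> k; exact: mpre.
- apply/measurable_EFinP; apply: measurable_funTS; exact: measurable_dtau.
- by move=> t _; rewrite lee_fin dtau_ge0.
- move=> i j _ _ [t [[_ Fi] [_ Fj]]]; apply: tF => //; by exists (tau rho t).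
Qed.

HB.instance Definition _ := isMeasure.Build _ _ _ (taum rho0)
  taum0 taum_ge0 taum_sigma_additive.

(** Two finite measures that agree on the rays []x, +oo[], a family stable under intersection, are
    equal. For [0 < x < 1] both give [1 - x], by [cum_dtau] and [It_dtau]. *)
Lemma taumE A : measurable A -> taum rho0 A = mu (I `&` A).
Proof.
move=> mA.
pose m2 : {measure set (measurableTypeR R) -> \bar R} := mrestr mu mI.
suff : taum rho0 A = m2 A by rewrite /m2 /= /mrestr setIC.
pose g (k : nat) : set R := `]- k%:R, +oo[%classic.
apply: (@measure_unique _ R (measurableTypeR R) (@RGenOInfty.G R) g _ _ _ _ (taum rho0) m2) => //.
- exact: RGenOInfty.measurableE.
- move=> _ _ [x ->] [y ->]; exists (Num.max x y).
  apply/seteqP; split=> z /=; rewrite !in_itv/= !andbT gt_max.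
    by move=> [-> ->].
  by move=> /andP[].
- by move=> k; exists (- k%:R).
- apply/seteqP; split=> // x _; exists (Num.bound (- x)) => //.
  rewrite /g/= in_itv/= andbT ltrNl.
  have [x0|x0] := leP 0 (- x); first exact: archi_boundP.
  by apply: lt_le_trans x0 _; rewrite ler0n.
- move=> _ [x ->]; rewrite /m2 /= /mrestr /taum.
  have di := dtau_intg; have ri : 0 < rho^-1 by rewrite invr_gt0.
  have [x0|x0] := leP x 0.
    have -> : I `&` tau rho @^-1` `]x, +oo[ = I.
      apply/seteqP; split=> t; first by case.
      move=> It; split=> //=; rewrite in_itv/= andbT.
      by have /intJP/(tau01 rho0)/andP[t0 _] := It; exact: le_lt_trans t0.
    have -> : `]x, +oo[ `&` I = I.
      apply/seteqP; split=> t; first by case.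
      move=> It; split=> //=; rewrite in_itv/= andbT.
      by have /intJP/andP[t0 _] := It; exact: le_lt_trans t0.
    rewrite ItE// It_dtau /intJ lebesgue_measure_itv/= lte_fin ltr01.
    by rewrite -EFinD subr0.
  have [x1|x1] := ltP x 1; last first.
    have -> : I `&` tau rho @^-1` `]x, +oo[ = set0.
      apply/seteqP; split=> t //= [/intJP/(tau01 rho0)/andP[_ t1]].
      by rewrite in_itv/= andbT => /(le_lt_trans x1)/(lt_trans t1); rewrite ltxx.
    have -> : `]x, +oo[ `&` I = set0.
      apply/seteqP; split=> t //= [+ /intJP/andP[_ t1]].
      by rewrite in_itv/= andbT => /(le_lt_trans x1)/(lt_trans t1); rewrite ltxx.
    by rewrite integral_set0 measure0.
  have x01 : 0 < x < 1 by rewrite x0.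
  have s01 := tau01 ri x01; have /andP[s0 s1] := s01.
  have -> : I `&` tau rho @^-1` `]x, +oo[ = `]tau rho^-1 x, 1[%classic.
    apply/seteqP; split=> t /=; rewrite !in_itv/= !andbT.
      move=> [/intJP t01 xt]; have /andP[_ ->] := t01; rewrite andbT.
      by rewrite -(tau_lt_iff rho0 s01 t01) tauKV.
    move=> /andP[st t1]; have t01 : 0 < t < 1 by rewrite t1 (lt_trans s0).
    by split; [exact/intJP|rewrite -{1}(tauKV rho0 x1) tau_lt_iff].
  have -> : `]x, +oo[ `&` I = `]x, 1[%classic.
    apply/seteqP; split=> t; rewrite /intJ/= !in_itv/= ?andbT.
      by move=> [-> /andP[_ ->]].
    by move=> /andP[xt t1]; rewrite xt t1 (lt_trans x0 xt).
  rewrite ItE//; last exact: intg_oo.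
  rewrite (@cum_tail R (dtau rho) (tau rho^-1 x))// cum_dtau// tauKV// It_dtau.
  by rewrite lebesgue_measure_itv/= lte_fin x1 -EFinD.
- move=> k; rewrite /taum; apply: (@le_lt_trans _ _ 1%E); last exact: ltry.
  rewrite -It_dtau -ItE//; last exact: dtau_intg.
  apply: ge0_subset_integral => //.
  + by apply: mpre; exact: measurable_itv.
  + apply/measurable_EFinP; apply: measurable_funTS; exact: measurable_dtau.
  + by move=> t _; rewrite lee_fin dtau_ge0.
Qed.

Lemma tau_change_indic (A : set R) : measurable A ->
  (\int[mu]_(t in I) (\1_A (tau rho t) * dtau rho t)%:E = mu (A `&` I))%E.
Proof.
move=> mA; rewrite setIC -taumE// /taum integral_mkcondr.
apply: eq_integral => t _; rewrite patchE indicE.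
have -> : (t \in tau rho @^-1` A) = (tau rho t \in A) by apply/idP/idP; rewrite !inE.
by case: ifP; rewrite ?mul1r ?mul0r.
Qed.

Import HBNNSimple.

Lemma tau_change_nnsfun (f : {nnsfun (measurableTypeR R) >-> R}) :
  (\int[mu]_(x in I) (f x)%:E =
   \int[mu]_(t in I) (f (tau rho t) * dtau rho t)%:E)%E.
Proof.
have mt : measurable_fun I (dtau rho) by apply: measurable_funTS; exact: measurable_dtau.
have mtau : measurable_fun I (tau rho) by apply: measurable_funTS; exact: measurable_tau.
have mfk k : measurable (f @^-1` [set k]).
  by rewrite -(setTI (_ @^-1` _)); apply: (measurable_funP f).
have m1 (k : R) : measurable_fun I (fun t => \1_(f @^-1` [set k]) (tau rho t) : R).
  apply: (@measurable_comp _ _ _ _ _ _ setT) => //.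
  by apply: measurable_indic; exact: mfk.
transitivity (\sum_(k \in range f) k%:E * mu (f @^-1` [set k] `&` I))%E.
  under eq_integral do rewrite fimfunE -fsumEFin//.
  rewrite ge0_integral_fsum//; last 2 first.
  - by move=> k; apply/measurable_EFinP; apply: measurable_funM.
  - by move=> k x _; rewrite nnfun_muleindic_ge0.
  apply: eq_fsbigr => k _; rewrite integralZl_indic_nnsfun//.
  by rewrite integral_indic.
transitivity (\int[mu]_(t in I) \sum_(k \in range f)
    (k * (\1_(f @^-1` [set k]) (tau rho t) * dtau rho t))%:E)%E; last first.
  apply: eq_integral => t _; rewrite EFinM fimfunE -fsumEFin// ge0_mule_fsuml//.
    by apply: eq_fsbigr => k _; rewrite -EFinM mulrA.
  by move=> k; rewrite EFinM nnfun_muleindic_ge0.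
rewrite ge0_integral_fsum//; last 2 first.
- move=> k; apply/measurable_EFinP; apply: measurable_funM; first exact: measurable_cst.
  exact: (measurable_funM (m1 k) mt).
- move=> k t _; rewrite mulrA EFinM mule_ge0//; last by rewrite lee_fin dtau_ge0.
  by rewrite EFinM nnfun_muleindic_ge0.
apply: eq_fsbigr => k _; rewrite -tau_change_indic//.
have [k0|k0] := leP 0 k; last first.
  have fk : f @^-1` [set k] = set0.
    apply/seteqP; split=> // x /= fx; move: k0; rewrite -fx ltNge.
    by rewrite fun_ge0.
  rewrite fk tau_change_indic// set0I measure0 mule0.
  by rewrite integral0_eq// => t _; rewrite indic0 mul0r mulr0.
rewrite -ge0_integralZl_EFin//.
- by move=> t _; rewrite lee_fin mulr_ge0// dtau_ge0.
- by apply/measurable_EFinP; exact: (measurable_funM (m1 k) mt).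
- exact: mfk.
Qed.

(* Substitution for a nonnegative measurable integrand, from indicators to simple
   functions to monotone limits. *)
Lemma tau_change (F : R -> R) : measurable_fun I F -> (forall x, I x -> 0 <= F x) ->
  (\int[mu]_(x in I) (F x)%:E =
   \int[mu]_(t in I) (F (tau rho t) * dtau rho t)%:E)%E.
Proof.
move=> mF F0.
have mt : measurable_fun I (dtau rho) by apply: measurable_funTS; exact: measurable_dtau.
have mtau : measurable_fun I (tau rho) by apply: measurable_funTS; exact: measurable_tau.
pose G := F \_ I.
have GE x : I x -> G x = F x by move=> Ix; rewrite /G patchE mem_set.
have G0 x : 0 <= G x.
  by rewrite /G patchE; case: ifPn => // /[!inE]; exact: F0.
have mG : measurable_fun setT (EFin \o G).
  by apply/measurable_EFinP; apply/(measurable_restrictT F mI).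
have tauI t : I t -> I (tau rho t) by move=> /intJP/(tau01 rho0)/intJP.
pose f_ := nnsfun_approx (@measurableT _ (measurableTypeR R)) mG.
have fcv x : (EFin \o f_^~ x) @ \oo --> (EFin \o G) x.
  by apply: cvg_nnsfun_approx => // y _; rewrite lee_fin.
have fmono x m n : (m <= n)%N -> f_ m x <= f_ n x.
  move=> mn; have := @nd_nnsfun_approx _ _ _ _ (@measurableT _ (measurableTypeR R)) _ mG _ _ mn.
  by move=> /lefP; apply.
transitivity (limn (fun n => \int[mu]_(x in I) (f_ n x)%:E))%E.
  rewrite -monotone_convergence//.
  - apply: eq_integral => x; rewrite inE => Ix; apply/esym/cvg_lim => //.
    by rewrite -GE//; exact: fcv.
  - by move=> n; apply/measurable_EFinP/measurable_funTS.
  - by move=> n x _; rewrite lee_fin.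
  - by move=> x _ m n mn; rewrite lee_fin; exact: fmono.
transitivity (limn (fun n => \int[mu]_(t in I) (f_ n (tau rho t) * dtau rho t)%:E))%E.
  by apply: congr_lim; apply/funext => n; exact: tau_change_nnsfun.
rewrite -monotone_convergence//.
- apply: eq_integral => t; rewrite inE => It; apply/cvg_lim => //.
  rewrite -(GE _ (tauI _ It)) EFinM; under eq_fun do rewrite EFinM.
  by apply: cvgeZr => //; exact: fcv.
- move=> n; apply/measurable_EFinP.
  have mn : measurable_fun I (fun t => f_ n (tau rho t)).
    by apply: (@measurable_comp _ _ _ _ _ _ setT) => //; apply: (measurable_funP (f_ n)).
  exact: (measurable_funM mn mt).
- by move=> n x _; rewrite lee_fin mulr_ge0// dtau_ge0.
- move=> x _ m n mn; rewrite lee_fin ler_wpM2r ?dtau_ge0//.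
  exact: fmono.
Qed.

End FixedExponent.
End ChangeOfVariables.

(** * Transfer of integrals, derivatives and weights *)

Section Transfer.
Context {R : realType}.
Local Notation mu := (@lebesgue_measure R).
Local Notation I := (@intJ R).
Implicit Types (u g h U F : R -> R).

Let mI : measurable I := @measurable_intJ R.

Lemma acpair_aeq U g h : measurable_fun I g -> measurable_fun I h -> aeq g h ->
  acpair U g -> acpair U h.
Proof.
move=> mg mh gh ac a b a0 ab b1; have [gi E] := ac a b a0 ab b1.
have [hi Eh] := aeq_It (measurable_itv `[a, b]) (sub_cc_I a0 b1) mg mh gh gi.
by rewrite E Eh.
Qed.

Lemma sqi_aeq a b u v : measurable_fun I v -> aeq u v -> sqi (jw a b) u ->
  sqi (jw a b) v /\
  It I (fun x => u x ^+ 2 * jw a b x) = It I (fun x => v x ^+ 2 * jw a b x).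
Proof.
move=> mv uv [mu_ ui].
have m1 : measurable_fun I (fun x => u x ^+ 2 * jw a b x).
  by apply: measurable_funM; [exact: measurable_funX|exact: jw_meas].
have m2 : measurable_fun I (fun x => v x ^+ 2 * jw a b x).
  by apply: measurable_funM; [exact: measurable_funX|exact: jw_meas].
have e : aeq (fun x => u x ^+ 2 * jw a b x) (fun x => v x ^+ 2 * jw a b x).
  by apply: aeq_mp uv _ => x _ ->.
by have [vi E] := aeq_It mI (@subset_refl _ I) m1 m2 e ui.
Qed.

Lemma weight1E a b x : I x -> weight a b 1 x = jw a b x.
Proof.
move=> /intJP/andP[x0 x1]; rewrite /weight /jw !mul1r addrK powRr1 ?subKr//; lra.
Qed.

Lemma J_integral F : measurable_fun I F ->
  (\int[mu]_(t in @J R) (F t)%:E = \int[mu]_(t in I) (F t)%:E)%E.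
Proof.
move=> mF; rewrite /J /intJ; apply: integral_itv_bndoo.
exact/measurable_EFinP.
Qed.

Lemma inner_It w f g F : measurable_fun I F -> intg I F ->
  (forall t, I t -> g t * f t * w t = F t) -> inner w g f = (It I F)%:E.
Proof.
move=> mF Fi E; rewrite /inner J_integral.
  by rewrite -ItE//; apply: eq_integral => t; rewrite inE => /E ->.
by apply: eq_measurable_fun mF => t; rewrite inE => /E ->.
Qed.

Lemma wnorm_It w f (F : R -> R) : intg I F -> (forall x, I x -> 0 <= F x) ->
  inner w f f = (It I F)%:E -> wnorm w f = (Num.sqrt (It I F))%:E.
Proof.
move=> Fi F0 E; rewrite /wnorm E poweR_EFin powR12_sqrt//; exact: It_ge0.
Qed.

Variables (rho : R) (rho0 : 0 < rho).

Let tauI t : I t -> I (tau rho t).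
Proof. by move=> /intJP/(tau01 rho0)/intJP. Qed.

Lemma meas_tau F : measurable_fun I F -> measurable_fun I (fun t => F (tau rho t)).
Proof.
move=> mF; apply: (@measurable_comp _ _ _ _ _ _ I) => //.
- by move=> _ [t It <-]; exact: tauI.
- by apply: measurable_funTS; exact: measurable_tau.
Qed.

Let mdt : measurable_fun I (dtau rho).
Proof. by apply: measurable_funTS; exact: measurable_dtau. Qed.

Lemma tau_intg F : measurable_fun I F -> intg I F ->
  intg I (fun t => F (tau rho t) * dtau rho t) /\
  It I (fun t => F (tau rho t) * dtau rho t) = It I F.
Proof.
have ge0 (G : R -> R) : measurable_fun I G -> (forall x, I x -> 0 <= G x) -> intg I G ->
    intg I (fun t => G (tau rho t) * dtau rho t) /\
    It I (fun t => G (tau rho t) * dtau rho t) = It I G.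
  move=> mG G0 Gi; have E := tau_change rho0 mG G0.
  have mGt := measurable_funM (meas_tau mG) mdt.
  have Gi' : intg I (fun t => G (tau rho t) * dtau rho t).
    apply/integrableP; split; first exact/measurable_EFinP.
    have -> : (\int[mu]_(t in I) `|(EFin \o (fun t => G (tau rho t) * dtau rho t)%R) t| =
        \int[mu]_(t in I) (G (tau rho t) * dtau rho t)%:E)%E.
      apply: eq_integral => t; rewrite inE => It /=.
      by rewrite ger0_norm// mulr_ge0 ?dtau_ge0 ?G0//; exact: tauI.
    by rewrite -E ItE// ltry.
  by split=> //; rewrite /It /Rintegral -E.
(* A signed integrand is the difference of the nonnegative functions [|F| + F] and [|F|]. *)
move=> mF Fi; have ni := intg_norm mI Fi; have pi := intgD mI ni Fi.
have mn : measurable_fun I (fun x => `|F x|) by exact: intg_meas ni.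
have mp : measurable_fun I (fun x => `|F x| + F x) by exact: intg_meas pi.
have [ni' En] := ge0 _ mn (fun x _ => normr_ge0 _) ni.
have p0 x : I x -> 0 <= `|F x| + F x.
  by move=> _; have := ler_norm (- F x); rewrite normrN; lra.
have [pi' Ep] := ge0 _ mp p0 pi.
have E t : I t -> (`|F (tau rho t)| + F (tau rho t)) * dtau rho t -
    `|F (tau rho t)| * dtau rho t = F (tau rho t) * dtau rho t.
  by move=> _; ring.
split; first by apply: eq_intg E _ => //; exact: intgB.
rewrite -(eq_It E) ItB// En Ep ItD//; ring.
Qed.

(** [tau_intg] for [g] cut off to [[tau rho a, tau rho b]], whose preimage in (0,1) is [[a, b]] by
    monotonicity. *)
Lemma acpair_tau_comp U g : measurable_fun I g -> acpair U g ->
  acpair (fun t => U (tau rho t)) (fun t => g (tau rho t) * dtau rho t).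
Proof.
move=> mg ac a b a0 ab b1.
have a01 : 0 < a < 1 by rewrite a0 (le_lt_trans ab).
have b01 : 0 < b < 1 by rewrite b1 (lt_le_trans a0).
have /andP[c0 c1] := tau01 rho0 a01; have /andP[d0 d1] := tau01 rho0 b01.
have cd : tau rho a <= tau rho b.
  move: ab; rewrite le_eqVlt => /predU1P[->//|ab]; exact/ltW/tau_lt.
have [gi ->] := ac _ _ c0 cd d1.
set A := `[tau rho a, tau rho b]%classic.
have AI : A `<=` I := sub_cc_I c0 d1.
have mA : measurable A by exact: measurable_itv.
have inE t : I t -> (tau rho t \in A) = (t \in `[a, b]%classic).
  move=> /intJP t01; apply/idP/idP; rewrite !inE /A/= !in_itv/= !leNgt !tau_lt_iff//.
have mF : measurable_fun I (g \_ A).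
  by apply/measurable_restrict => //; apply: measurable_funS mg => // x [].
have Fi : intg I (g \_ A).
  rewrite /intg -restrict_EFin; apply/integrable_restrict => //.
  by rewrite setIidr.
have [Fi' E] := tau_intg mF Fi.
have Et t : I t -> (g \_ A) (tau rho t) * dtau rho t =
    ((fun t => g (tau rho t) * dtau rho t) \_ `[a, b]) t.
  by move=> It; rewrite !patchE inE//; case: ifP => // _; rewrite mul0r.
split.
  have := eq_intg mI Et Fi'; rewrite /intg -restrict_EFin => /integrable_restrict.
  move=> /(_ (measurable_itv _) mI).
  by rewrite setIidr//; exact: sub_cc_I.
have sA : I `&` A = A by rewrite setIidr.
have sB : I `&` `[a, b] = `[a, b]%classic by rewrite setIidr//; exact: sub_cc_I.
rewrite /It -{1}sA -sB !Rintegral_mkcondr -[LHS]/(It I (g \_ A)) -E.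
exact: eq_It Et.
Qed.

(** Preimages of null sets are null: substitution with the inverse exponent [rho^-1] writes the
    measure of the preimage of [N] as an integral over (0,1) whose integrand vanishes off [N]. *)
Lemma aeq_tau u h : aeq u h -> aeq (fun t => u (tau rho t)) (fun t => h (tau rho t)).
Proof.
have ri : 0 < rho^-1 by rewrite invr_gt0.
move=> [N [mN N0 sub]].
have mN' : measurable (N : set R) by [].
exists (I `&` tau rho @^-1` N); split.
- by apply: (measurable_funTS (@measurable_tau R rho)).
- rewrite setIC -(tau_change_indic ri); last first.
    by rewrite -(setTI (_ @^-1` _)); apply: (@measurable_tau R rho).
  transitivity (\int[mu]_(x in I) (cst 0%E) x)%E; last by rewrite integral0.
  apply: ae_eq_integral => //.
  + apply/measurable_EFinP; apply: measurable_funM; last first.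
      by apply: measurable_funTS; exact: measurable_dtau.
    apply: (@measurable_comp _ _ _ _ _ _ setT) => //.
      apply: measurable_indic; rewrite -(setTI (_ @^-1` _)).
      by apply: (@measurable_tau R rho).
    by apply: measurable_funTS; exact: measurable_tau.
  + exists N; split=> // x /= nx; apply: contrapT => Nx; apply: nx => /intJP/andP[_ x1].
    rewrite indicE memNset ?mul0r//= tauKV//.
- move=> t /= nt; apply: contrapT => nN; apply: nt => It.
  apply: contrapT => uh; apply: nN; split=> //=; apply: sub => /=.
  by move=> /(_ (tauI It)).
Qed.

Lemma weightE a b t : I t -> weight a b rho t = jw a b (tau rho t) * dtau rho t.
Proof.
move=> /intJP/andP[t0 t1]; have h : 1 - t != 0 by rewrite gt_eqF// subr_gt0.
rewrite /weight /jw /dtau tau_onem -/(tau rho t) -powRrM.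
have -> : rho * (a + 1) - 1 = rho * a + (rho - 1) by ring.
by rewrite [(1 - t) `^ (_ + (rho - 1))]powRD ?h ?implybT//; ring.
Qed.

(** The squared [dtau] is what the chain rule adds to the square of an ordinary derivative; it makes
    the [weight_tilde] norm of that derivative a Jacobi norm of order 1. *)
Lemma weight_tildeE a b t : I t -> dtau rho t ^+ 2 * weight_tilde a b rho t =
  jw (a + 1) (b + 1) (tau rho t) * dtau rho t.
Proof.
move=> /intJP/andP[t0 t1]; have h : 1 - t != 0 by rewrite gt_eqF// subr_gt0.
rewrite /weight_tilde /jw /dtau tau_onem -/(tau rho t) -powRrM.
have -> : rho * (a + 1) = (rho * a + 1) + (rho - 1) by ring.
rewrite [(1 - t) `^ (_ + (rho - 1))]powRD ?h ?implybT//.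
by field; rewrite gt_eqF.
Qed.

Lemma tau_D_rho t : I t -> (1 - t) `^ (1 - rho) / rho * dtau rho t = 1.
Proof.
move=> /intJP/andP[t0 t1]; have h : 1 - t != 0 by rewrite gt_eqF// subr_gt0.
have -> : 1 - rho = - (rho - 1) by ring.
have hp : (1 - t) `^ (rho - 1) != 0 by rewrite gt_eqF// powR_gt0// subr_gt0.
rewrite powRN /dtau; field; rewrite hp /=; by rewrite gt_eqF.
Qed.

End Transfer.

(** * Regular representatives and the projection as a polynomial *)

Section Projection.
Context {R : realType}.
Local Notation mu := (@lebesgue_measure R).
Local Notation I := (@intJ R).
Implicit Types (u g h U F f : R -> R) (a b : R).

Let mI : measurable I := @measurable_intJ R.

Lemma weak_derivativeP k u : weakly_derivable k u ->
  is_weak_derivative k u (weak_derivative k u).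
Proof. exact: xgetPex. Qed.

Lemma measurable_fun_J u : measurable_fun (@J R) u -> measurable_fun I u.
Proof.
move=> mu_; apply: (measurable_funS _ _ mu_); first exact: measurable_itv.
by move=> x; rewrite /J /intJ/= !in_itv/= => /andP[x0 x1]; rewrite !ltW.
Qed.

Lemma L2_sqi a b v : L2 (weight a b 1) v -> sqi (jw a b) v.
Proof.
move=> [mv fv]; have mv' := measurable_fun_J mv; split=> //.
have mF : measurable_fun I (fun x => v x ^+ 2 * jw a b x).
  by apply: measurable_funM; [exact: measurable_funX|exact: jw_meas].
apply/integrableP; split; first exact/measurable_EFinP.
move: fv; rewrite /inner J_integral; last first.
  apply: eq_measurable_fun mF => t; rewrite inE => It.
  by rewrite weight1E// expr2.
apply: le_lt_trans; rewrite le_eqVlt; apply/orP; left; apply/eqP.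
apply: eq_integral => t; rewrite inE => It /=.
by rewrite weight1E// ger0_norm ?expr2// mulr_ge0 ?jw_ge0// -expr2 sqr_ge0.
Qed.

(** [weak_derivative] picks representatives arbitrarily. Below order [s] each is replaced by a
    locally absolutely continuous one, whose derivative is then exchanged for the next
    representative, equal to it almost everywhere. *)
Lemma B1_chain a b s u : B1 a b s u -> exists V : nat -> R -> R,
  [/\ measurable_fun I u, aeq u (V 0%N),
   forall k, (k < s)%N -> acpair (V k) (V k.+1),
   forall k, (k <= s)%N -> sqi (jw (a + k%:R) (b + k%:R)) (V k) &
   measurable_fun I (weak_derivative s u) /\ aeq (weak_derivative s u) (V s)].
Proof.
move=> Bu; pose uk k := weak_derivative k u.
have wd k : (k <= s)%N -> is_weak_derivative k u (uk k).
  by move=> /Bu[wk _]; exact: weak_derivativeP.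
have sk k : (k <= s)%N -> sqi (jw (a + k%:R) (b + k%:R)) (uk k).
  by move=> /Bu[_ /L2_sqi].
have mk k : (k <= s)%N -> measurable_fun I (uk k) by move=> /sk[].
have /choice[V hV] : forall k, exists W : R -> R, (k <= s)%N ->
    [/\ measurable_fun I W, aeq (uk k) W & (k < s)%N -> acpair W (uk k.+1)].
  move=> k; have [ks|sk'] := ltnP k s; last first.
    (* At order [s] no further derivative is required, so the chosen representative stays. *)
    by exists (uk k) => ks; split; [exact: mk|exact: aeW_intJ|lia].
  have w1 := weak_derivative_succ (wd k (ltnW ks)) (wd k.+1 ks).
  have [W aW uW] := weak_acpair w1.
  by exists W => _; split=> //; exact: acpair_meas aW.
exists V; split.
- by have [[mu_ _ _] _ _] := wd 0%N (leq0n s).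
- have [_ e _] := hV 0%N (leq0n s); apply: aeq_trans e.
  exact: weak_derivative0_ae (wd 0%N (leq0n s)).
- move=> k ks; have [_ _ /(_ ks) ac] := hV k (ltnW ks).
  have [m1 e _] := hV k.+1 ks; exact: acpair_aeq (mk _ ks) m1 e ac.
- by move=> k ks; have [m1 e _] := hV k ks; exact: (sqi_aeq m1 e (sk k ks)).1.
- by have [m1 e _] := hV s (leqnn s); split=> //; exact: mk.
Qed.

Lemma wnorm_aeq w f F : measurable_fun I (fun t => f t * f t * w t) ->
  intg I F -> (forall t, I t -> 0 <= F t) ->
  aeq (fun t => f t * f t * w t) F -> wnorm w f = (Num.sqrt (It I F))%:E.
Proof.
move=> mf Fi F0 e; have mF := intg_meas Fi.
have [fi E] := aeq_It mI (@subset_refl _ I) mF mf (aeq_sym e) Fi.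
by apply: wnorm_It => //; rewrite E; apply: inner_It.
Qed.

Lemma wnorm_weight1 a b g v : measurable_fun I g -> aeq g v ->
  sqi (jw a b) v ->
  wnorm (weight a b 1) g = (Num.sqrt (It I (fun x => v x ^+ 2 * jw a b x)))%:E.
Proof.
move=> mg e [mv vi]; apply: wnorm_aeq => //.
- have : measurable_fun I (fun x => g x ^+ 2 * jw a b x).
    by apply: measurable_funM; [exact: measurable_funX|exact: jw_meas].
  by apply: eq_measurable_fun => t; rewrite inE => It; rewrite weight1E// expr2.
- by move=> t It; rewrite mulr_ge0 ?sqr_ge0 ?jw_ge0.
- by apply: (aeq_mp e) => t It ->; rewrite weight1E// expr2.
Qed.

Variables (rho : R) (rho0 : 0 < rho).

Lemma P_rho_poly N q : P_rho rho N q <->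
  exists2 Q : {poly R}, (size Q <= N.+1)%N & q = fun t => Q.[tau rho t].
Proof.
have powE i (t : R) : (1 - t) `^ (i%:R * rho) = (1 - tau rho t) ^+ i.
  by rewrite tau_onem mulrC powRrM powR_mulrn// powR_ge0.
have s1 : size (1 - 'X : {poly R}) = 2%N by rewrite -opprB size_polyN size_XsubC.
split=> [[c ->]|[Q sQ ->]].
  exists (\sum_(i < N.+1) c i *: (1 - 'X) ^+ i).
    apply: (leq_trans (size_sum _ _ _)); apply/bigmax_leqP => i _.
    apply: (leq_trans (size_scale_leq _ _)).
    by apply: (leq_trans (size_poly_exp_leq _ _)); rewrite s1 mul1n.
  apply/funext => t; rewrite horner_sum; apply: eq_bigr => i _.
  by rewrite powE !hornerE.
(* [1 - 'X] is an involution, so composing with it gives the coefficients of [Q] in powers of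
   [1 - 'X]. *)
exists (fun i => (Q \Po (1 - 'X))`_i); apply/funext => t.
have -> : Q.[tau rho t] = (Q \Po (1 - 'X)).[1 - tau rho t].
  by rewrite horner_comp !hornerE subKr.
rewrite (@horner_coef_wide _ N.+1); first by apply: eq_bigr => i _; rewrite powE.
apply: (leq_trans (size_comp_poly_leq _ _)); rewrite s1 muln1.
by case: (size Q) sQ.
Qed.

Lemma pullback_tau f t : I t -> pullback rho f (tau rho t) = f t.
Proof.
move=> /intJP/andP[_ t1]; rewrite /pullback -/(tau rho^-1 _) tauK//.
Qed.

Lemma inner_proj_err a b f (P Q : {poly R}) : -1 < a -> -1 < b ->
  sqi (jw a b) (pullback rho f) ->
  inner (weight a b rho) (f \- (fun t => P.[tau rho t])) (fun t => Q.[tau rho t]) =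
  (It I (fun x => (pullback rho f x - P.[x]) * Q.[x] * jw a b x))%:E.
Proof.
move=> a1 b1 su.
pose G x := (pullback rho f x - P.[x]) * Q.[x] * jw a b x.
have sP := sqi_poly P a1 b1; have sQ := sqi_poly Q a1 b1.
have sd : sqi (jw a b) (fun x => pullback rho f x - P.[x]).
  by apply: sqiB => // x Ix; exact: jw_ge0.
have Gi : intg I G by apply: sqi_prod sd sQ.
have mG := intg_meas Gi.
have [Gti <-] := tau_intg rho0 mG Gi.
apply: inner_It; [exact: intg_meas Gti|exact: Gti|] => t It.
by rewrite weightE// /G pullback_tau//= mulrA.
Qed.

(** [proj_exists] shows that some projection exists, so [xget] does not return its default; the
    chosen element is then read as a polynomial in [tau]. *)
Lemma Proj_poly a b N f : -1 < a -> -1 < b ->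
  sqi (jw a b) (pullback rho f) ->
  exists P : {poly R}, [/\ (size P <= N.+1)%N,
    perp (jw a b) (fun x => pullback rho f x - P.[x]) N.+1 &
    Proj a b rho N f = fun t => P.[tau rho t]].
Proof.
move=> a1 b1 su.
have : is_projection a b rho N f (Proj a b rho N f).
  apply: (@xgetPex _ _ [set p | is_projection a b rho N f p]).
  have [P sP oP] := proj_exists N.+1 a1 b1 su.
  exists (fun t => P.[tau rho t]); split; first by apply/P_rho_poly; exists P.
  by move=> q /P_rho_poly[Q sQ ->]; rewrite inner_proj_err// oP.
move=> [/P_rho_poly[P sP ->] oP]; exists P; split=> // Q sQ.
have : inner (weight a b rho) (f \- (fun t => P.[tau rho t])) (fun t => Q.[tau rho t]) = 0%E.
  by apply: oP; apply/P_rho_poly; exists Q.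
by rewrite inner_proj_err// => -[].
Qed.

Lemma wnorm_weight_tau a b e v : measurable_fun I e ->
  aeq e (fun t => v (tau rho t)) -> sqi (jw a b) v ->
  wnorm (weight a b rho) e = (Num.sqrt (It I (fun x => v x ^+ 2 * jw a b x)))%:E.
Proof.
move=> me ev [mv vi]; have [vti <-] := tau_intg rho0 (intg_meas vi) vi.
have tI t : I t -> I (tau rho t) by move=> /intJP/(tau01 rho0)/intJP.
have m1 : measurable_fun I (fun t => e t ^+ 2 * (jw a b (tau rho t) * dtau rho t)).
  apply: measurable_funM; first exact: measurable_funX.
  apply: measurable_funM; first exact: (meas_tau rho0 (@jw_meas R a b)).
  by apply: measurable_funTS; exact: measurable_dtau.
apply: wnorm_aeq => //.
- by apply: eq_measurable_fun m1 => t; rewrite inE => It; rewrite weightE// expr2.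
- by move=> t It; rewrite mulr_ge0 ?dtau_ge0// mulr_ge0 ?sqr_ge0// jw_ge0.
- by apply: (aeq_mp ev) => t It ->; rewrite weightE// expr2 mulrA.
Qed.

Lemma wnorm_weight_tilde_tau a b d v : measurable_fun I d ->
  aeq d (fun t => v (tau rho t) * dtau rho t) ->
  sqi (jw (a + 1) (b + 1)) v ->
  wnorm (weight_tilde a b rho) d =
  (Num.sqrt (It I (fun x => v x ^+ 2 * jw (a + 1) (b + 1) x)))%:E.
Proof.
move=> md dv [mv vi]; have [vti <-] := tau_intg rho0 (intg_meas vi) vi.
have tI t : I t -> I (tau rho t) by move=> /intJP/(tau01 rho0)/intJP.
have mw : measurable_fun I (weight_tilde a b rho).
  rewrite /weight_tilde -/(tau rho _); apply: measurable_funM.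
    apply: measurable_funM; first exact: measurable_cst.
    apply: (@measurableT_comp _ _ _ _ _ _ (fun y : R => y `^ (rho * a + 1))).
      exact: measurable_powR.
    by apply: measurable_funB; [exact: measurable_cst|exact: measurable_id].
  apply: (@measurableT_comp _ _ _ _ _ _ (fun y : R => y `^ (b + 1))).
    exact: measurable_powR.
  by apply: measurable_funTS; exact: measurable_tau.
apply: wnorm_aeq => //.
- by apply: measurable_funM => //; exact: measurable_funM.
- by move=> t It; rewrite mulr_ge0 ?dtau_ge0// mulr_ge0 ?sqr_ge0// jw_ge0.
- apply: (aeq_mp dv) => t It ->.
  by rewrite -[RHS]mulrA -weight_tildeE//; ring.
Qed.

End Projection.

(** * Norms of the projection error *)

Section Error.
Context {R : realType}.
Local Notation mu := (@lebesgue_measure R).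
Local Notation I := (@intJ R).

Let mI : measurable I := @measurable_intJ R.

Lemma derr_meas (V : nat -> R -> R) (P : {poly R}) i : measurable_fun I (V i) ->
  measurable_fun I (derr V P i).
Proof. by move=> mV; apply: measurable_funB => //; exact: horner_meas. Qed.

Lemma sqrt_error_bound (A B E S : R) (N k : nat) : (1 <= N)%N -> 0 < A -> 0 <= B ->
  0 <= S -> A * N%:R ^+ k * E <= B * S ->
  Num.sqrt E <= Num.sqrt (B / A) * N%:R `^ (- k%:R / 2) * Num.sqrt S.
Proof.
move=> N1 A0 B0 S0 h; have N0 : 0 < N%:R :> R by rewrite ltr0n.
have P0 : 0 < N%:R ^+ k :> R by rewrite exprn_gt0.
have -> : N%:R `^ (- k%:R / 2) = Num.sqrt ((N%:R ^+ k)^-1) :> R.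
  by rewrite powRrM powR12_sqrt ?powR_ge0// powRN powR_mulrn ?ltW.
rewrite -sqrtrM ?divr_ge0 ?(ltW A0)// -sqrtrM; last first.
  by rewrite mulr_ge0 ?divr_ge0 ?invr_ge0 ?(ltW A0) ?(ltW P0).
apply: ler_wsqrtr; have -> : B / A / N%:R ^+ k * S = B * S / (A * N%:R ^+ k).
  by field; rewrite !gt_eqF.
by rewrite ler_pdivlMr ?mulr_gt0// mulrC.
Qed.

(** Multiplying [h] by [N^k] and inserting [hB] trades the factorial ratio for a second power [N^k];
    the root of [N^(-2k)] is the full rate [N^(-k)]. *)
Lemma sqrt_error_bound_unif (K A B E S : R) (N k : nat) : (1 <= N)%N -> 0 < A ->
  0 <= K -> 0 <= S -> N%:R ^+ k * B <= K * A -> A * N%:R ^+ k * E <= B * S ->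
  Num.sqrt E <= Num.sqrt K * N%:R `^ (- k%:R) * Num.sqrt S.
Proof.
move=> N1 A0 K0 S0 hB h; have N0 : 0 < N%:R :> R by rewrite ltr0n.
have P0 : 0 < N%:R ^+ k :> R by rewrite exprn_gt0.
have h2 : A * (N%:R ^+ k) ^+ 2 * E <= A * (K * S).
  have := ler_wpM2l (ltW P0) h; have := ler_wpM2r S0 hB; nra.
have -> : N%:R `^ (- k%:R) = Num.sqrt (((N%:R ^+ k)^-1) ^+ 2) :> R.
  by rewrite sqrtr_sqr ger0_norm ?invr_ge0 ?(ltW P0)// powRN powR_mulrn ?ltW.
rewrite -sqrtrM// -sqrtrM; last by rewrite mulr_ge0 ?sqr_ge0.
apply: ler_wsqrtr; rewrite mulrAC exprVn ler_pdivlMr ?exprn_gt0// mulrC.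
by move: h2; rewrite -mulrA ler_pM2l.
Qed.

Variables (rho : R) (rho0 : 0 < rho).

Lemma weak_derivative_tau (e v g : R -> R) : measurable_fun I e ->
  measurable_fun I g -> acpair v g -> aeq e (fun t => v (tau rho t)) ->
  [/\ weakly_derivable 1 e, measurable_fun I (weak_derivative 1 e) &
   aeq (weak_derivative 1 e) (fun t => g (tau rho t) * dtau rho t)].
Proof.
move=> me mg ac ev; have act := acpair_tau_comp rho0 mg ac.
have mgt : measurable_fun I (fun t => g (tau rho t) * dtau rho t).
  apply: measurable_funM; first exact: (meas_tau rho0 mg).
  by apply: measurable_funTS; exact: measurable_dtau.
have w1 := acpair_weak act mgt me (aeq_sym ev).
have w : weakly_derivable 1 e by exists (fun t => g (tau rho t) * dtau rho t).
have w2 := weak_derivativeP w; split=> //; last exact: weak_derivative1_unique w2 w1.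
by have [_ [mw _ _] _] := w2.
Qed.

Lemma D_rho_tau (e v g : R -> R) : measurable_fun I e ->
  measurable_fun I g -> acpair v g -> aeq e (fun t => v (tau rho t)) ->
  measurable_fun I (D_rho rho e) /\ aeq (D_rho rho e) (fun t => g (tau rho t)).
Proof.
move=> me mg ac ev; have [_ mw we] := weak_derivative_tau me mg ac ev; split.
  apply: measurable_funM => //; apply: measurable_funM => //.
  apply: (@measurableT_comp _ _ _ _ _ _ (fun y : R => y `^ (1 - rho))).
    exact: measurable_powR.
  by apply: measurable_funB; [exact: measurable_cst|exact: measurable_id].
apply: (aeq_mp we) => t It E.
by rewrite /D_rho E mulrCA tau_D_rho// mulr1.
Qed.

(** One family [E i] of squared error norms serves all the estimates; [E 1] is also the squared
    [weight_tilde] norm of the ordinary derivative. *)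
Lemma projection_error_spec (a b : R) (N s : nat) (f : R -> R) :
  -1 < a -> -1 < b -> (1 <= N)%N -> (s <= N.+1)%N -> B1 a b s (pullback rho f) ->
  let e : R -> R := f \- Proj a b rho N f in
  exists (E : nat -> R) (S : R),
  [/\ forall i, (i < s)%N -> weakly_derivable 1 (D_rho_iter rho i e),
   forall i, (i <= s)%N ->
     wnorm (weight (a + i%:R) (b + i%:R) rho) (D_rho_iter rho i e) =
     (Num.sqrt (E i))%:E,
   (1 <= s)%N -> wnorm (weight_tilde a b rho) (weak_derivative 1 e) =
     (Num.sqrt (E 1%N))%:E,
   wnorm (weight (a + s%:R) (b + s%:R) 1) (weak_derivative s (pullback rho f)) =
     (Num.sqrt S)%:E &
   0 <= S /\ forall i, (i <= s)%N ->
     (N.+1 - i)`!%:R * N%:R ^+ (s - i) * E i <= (N.+1 - s)`!%:R * S].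
Proof.
move=> a1 b1 N1 sN Bf e; set u := pullback rho f.
have [V [mu_ uV acV sV [mws ws]]] := B1_chain (Bf : B1 a b s u).
have mV k : (k <= s)%N -> measurable_fun I (V k) by move=> /sV[].
have e0 (c : R) : c + 0%:R = c by rewrite addr0.
have sV0 : sqi (jw a b) (V 0%N) by have := sV 0%N (leq0n s); rewrite !e0.
have su : sqi (jw a b) u by have [] := sqi_aeq mu_ (aeq_sym uV) sV0.
have [P [sP oP eP]] := Proj_poly rho0 N a1 b1 su.
have sPa : sqi (jw a b) (horner P) := sqi_poly P a1 b1.
(* Orthogonality is known for the pullback; the chain needs it for its absolutely continuous
   representative. *)
have oV : perp (jw a b) (fun x => V 0%N x - P.[x]) N.+1.
  move=> Q sQ; rewrite -(oP Q sQ); have sQa := sqi_poly Q a1 b1.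
  have i1 : intg I (fun x => (u x - P.[x]) * Q.[x] * jw a b x).
    by apply: sqi_prod sQa; apply: sqiB => // x _; exact: jw_ge0.
  have i2 : intg I (fun x => (V 0%N x - P.[x]) * Q.[x] * jw a b x).
    by apply: sqi_prod sQa; apply: sqiB => // x _; exact: jw_ge0.
  apply/esym; apply: (proj2 (aeq_It mI (@subset_refl _ I) (intg_meas i1) (intg_meas i2) _ i1)).
  by apply: (aeq_mp uV) => x _ ->.
pose d := derr V P.
have md i : (i <= s)%N -> measurable_fun I (d i) by move=> /mV; exact: derr_meas.
have sd i : (i <= s)%N -> sqi (jw (a + i%:R) (b + i%:R)) (d i).
  by move=> si; apply: sqi_derr sV _ si.
have acd i : (i < s)%N -> acpair (d i) (d i.+1) by move=> si; apply: acpair_derr acV _ si.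
(* [D_rho] takes an arbitrary representative of a weak derivative, so each iterate is known only
   almost everywhere; its prefactor cancels the [dtau] of the chain rule. *)
have De i : (i <= s)%N -> measurable_fun I (D_rho_iter rho i e) /\
    aeq (D_rho_iter rho i e) (fun t => d i (tau rho t)).
  elim: i => [_|i IH si].
    have E t : I t -> u (tau rho t) - P.[tau rho t] = e t.
      by move=> It; rewrite /e /u pullback_tau// eP.
    split.
      have : measurable_fun I (fun t => u (tau rho t) - P.[tau rho t]).
        apply: measurable_funB; first exact: (meas_tau rho0 mu_).
        exact: (meas_tau rho0 (horner_meas P)).
      by apply: eq_measurable_fun => t; rewrite inE => /E.
    apply: (aeq_mp (aeq_tau rho0 uV)) => t It; rewrite -[D_rho_iter rho 0 e t]/(e t).
    by rewrite -E// => ->; rewrite /d /derr derivn0.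
  have [m1 E1] := IH (ltnW si).
  exact: D_rho_tau m1 (md _ si) (acd _ si) E1.
exists (fun i => It I (fun x => d i x ^+ 2 * jw (a + i%:R) (b + i%:R) x)).
exists (It I (fun x => V s x ^+ 2 * jw (a + s%:R) (b + s%:R) x)); split.
- move=> i si; have [m1 E1] := De i (ltnW si).
  by have [] := weak_derivative_tau m1 (md _ si) (acd _ si) E1.
- move=> i si; have [m1 E1] := De i si.
  exact: wnorm_weight_tau m1 E1 (sd i si).
- move=> s1; have [m1 E1] := De 0%N (leq0n s).
  have [_ mw we] := weak_derivative_tau m1 (md _ s1) (acd _ s1) E1.
  exact: wnorm_weight_tilde_tau mw we (sd _ s1).
- exact: wnorm_weight1 mws ws (sV s (leqnn s)).
- split; first by apply: It_ge0 => x _; rewrite mulr_ge0 ?sqr_ge0 ?jw_ge0.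
  by move=> i si; exact: (derr_bound a1 b1 N1 sN acV sV sP oV si).
Qed.

End Error.

(** * The four estimates *)

Theorem proposition3p1 (R : realType) (mu ups rho : R)
  (hmu : -1 < mu) (hups : -1 < ups) (hrho0 : 0 < rho) (hrho1 : rho <= 1) :
  (exists c : R, forall (N j s : nat) (f : R -> R),
    (1 <= N)%N -> (j <= s)%N -> (s <= N.+1)%N ->
    B1 mu ups s (pullback rho f) ->
    let e : R -> R := f \- Proj mu ups rho N f in
    D_rho_derivable rho j e /\
    (wnorm (weight (mu + j%:R) (ups + j%:R) rho) (D_rho_iter rho j e)
     <= (c * Num.sqrt ((N.+1 - s)`!%:R / (N.+1 - j)`!%:R)
           * N%:R `^ ((j%:R - s%:R) / 2))%:E
        * wnorm (weight (mu + s%:R) (ups + s%:R) 1)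
            (weak_derivative s (pullback rho f)))%E)
  /\
  (forall s : nat, exists c : R, forall (N j : nat) (f : R -> R),
    (1 <= N)%N -> (j <= s)%N -> (s <= N.+1)%N ->
    B1 mu ups s (pullback rho f) ->
    let e : R -> R := f \- Proj mu ups rho N f in
    D_rho_derivable rho j e /\
    (wnorm (weight (mu + j%:R) (ups + j%:R) rho) (D_rho_iter rho j e)
     <= (c * N%:R `^ (j%:R - s%:R))%:E
        * wnorm (weight (mu + s%:R) (ups + s%:R) 1)
            (weak_derivative s (pullback rho f)))%E)
  /\
  (forall s : nat, exists c : R, forall (N : nat) (f : R -> R),
    (1 <= N)%N -> (s <= N.+1)%N ->
    B1 mu ups s (pullback rho f) ->
    let e : R -> R := f \- Proj mu ups rho N f in
    (wnorm (weight mu ups rho) e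
     <= (c * N%:R `^ (- s%:R))%:E
        * wnorm (weight (mu + s%:R) (ups + s%:R) 1)
            (weak_derivative s (pullback rho f)))%E)
  /\
  (forall s : nat, (1 <= s)%N -> exists c : R, forall (N : nat) (f : R -> R),
    (1 <= N)%N -> (s <= N.+1)%N ->
    B1 mu ups s (pullback rho f) ->
    let e : R -> R := f \- Proj mu ups rho N f in
    weakly_derivable 1 e /\
    (wnorm (weight_tilde mu ups rho) (weak_derivative 1 e)
     <= (c * N%:R `^ (1 - s%:R))%:E
        * wnorm (weight (mu + s%:R) (ups + s%:R) 1)
            (weak_derivative s (pullback rho f)))%E).
Proof.
have fac_gt0 n : 0 < n`!%:R :> R by rewrite ltr0n fact_gt0.
have pow_sub (j s : nat) : (j <= s)%N -> j%:R - s%:R = - (s - j)%:R :> R.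
  by move=> js; rewrite natrB// opprB.
(* The square of the constant for fixed [s], as supplied by [fact_ratio_bound]. *)
pose K (s : nat) : R := (s.+1 ^ s)%:R.
have K0 s : 0 <= K s by exact: ler0n.
have bound (N j s : nat) (E S : R) : (1 <= N)%N -> (j <= s)%N -> (s <= N.+1)%N ->
    0 <= S -> (N.+1 - j)`!%:R * N%:R ^+ (s - j) * E <= (N.+1 - s)`!%:R * S ->
    Num.sqrt E <= Num.sqrt (K s) * N%:R `^ (j%:R - s%:R) * Num.sqrt S.
  move=> N1 js sN S0 h; rewrite pow_sub//.
  apply: (sqrt_error_bound_unif N1 (fac_gt0 _) (K0 s) S0 _ h).
  by rewrite -natrX -!natrM ler_nat; exact: fact_ratio_bound.
have le_E (A B C : R) (x y : \bar R) : x = A%:E -> y = B%:E -> A <= C * B ->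
    (x <= C%:E * y)%E by move=> -> -> h; rewrite -EFinM lee_fin.
split; [|split; [|split]].
(* The chain of inequalities loses no factor, so 1 serves for all [s] at once. *)
- exists 1 => N j s f N1 js sN Bf e.
  have [E [S [wd wE _ wS [S0 h]]]] := projection_error_spec hrho0 hmu hups N1 sN Bf.
  split; first by move=> i ij; exact: wd (leq_trans ij js).
  apply: (le_E _ _ _ _ _ (wE j js) wS); rewrite mul1r (pow_sub _ _ js).
  by apply: sqrt_error_bound N1 (fac_gt0 _) _ S0 (h j js); rewrite ltW.
- move=> s; exists (Num.sqrt (K s)) => N j f N1 js sN Bf e.
  have [E [S [wd wE _ wS [S0 h]]]] := projection_error_spec hrho0 hmu hups N1 sN Bf.
  split; first by move=> i ij; exact: wd (leq_trans ij js).
  apply: (le_E _ _ _ _ _ (wE j js) wS); exact: bound N1 js sN S0 (h j js).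
- move=> s; exists (Num.sqrt (K s)) => N f N1 sN Bf.
  have [E [S [_ wE _ wS [S0 h]]]] := projection_error_spec hrho0 hmu hups N1 sN Bf.
  have w0 := wE 0%N (leq0n s); rewrite !addr0 in w0.
  apply: (le_E _ _ _ _ _ w0 wS); rewrite -[- s%:R]add0r.
  exact: bound N1 (leq0n s) sN S0 (h _ (leq0n s)).
- move=> s s1; exists (Num.sqrt (K s)) => N f N1 sN Bf e.
  have [E [S [wd _ wT wS [S0 h]]]] := projection_error_spec hrho0 hmu hups N1 sN Bf.
  split; first exact: wd 0%N s1.
  apply: (le_E _ _ _ _ _ (wT s1) wS); exact: bound N1 s1 sN S0 (h _ s1).
Qed.
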